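(* Let $k$ be a positive odd integer, let $N$ be a positive integer such that $4\mid N$ and let $\chi$ be a Dirichlet character modulo $N$. Let $f(z)=\sum_{n=1}^{\infty}a_nq^n\in S_{k/2}(N,\chi)$. Let $a$, $M$ be integers with $M\geq 1$ and $\gcd(a,M)=1$. Let $$R=\frac{k}{24}\,[\mathrm{SL}_2(\mathbb{Z}):\Gamma_1(NM^2)].$$ Suppose that $a_n=0$ for all integers $n$ up to $R+1$ with $n\not\equiv a\pmod M$. Then $a_n=0$ for all $n$ with $n\not\equiv a\pmod M$. Moreover, if $M^2\mid N$, then the implication ''if $a_n=0$ for all integers $n$ up to $R+1$ with $n\not\equiv a\pmod M$, then $a_n=0$ for all $n$ with $n\not\equiv a\pmod M$'' also holds with $R$ instead defined by $$R=\begin{cases}\frac{k}{24}\,[\mathrm{SL}_2(\mathbb{Z}):\Gamma_1(N)] & \text{if } \frac{N}{M}\equiv 0\pmod 4,\\[2pt] \frac{k}{24}\,[\mathrm{SL}_2(\mathbb{Z}):\Gamma_1(2N)] & \text{if } \frac{N}{M}\equiv 2\pmod 4.\end{cases}$$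
   Context: $S_{k/2}(N,\chi)$ is the space of cusp forms of half-integral weight $k/2$, level $N$ (that is, on $\Gamma_0(N)$) and character $\chi$, in the sense of Shimura, with the usual theta automorphy factor: $f(\gamma z)=\chi(d)\,j(\gamma,z)^k f(z)$ for $\gamma=\begin{pmatrix}a&b\\c&d\end{pmatrix}\in\Gamma_0(N)$, where $j(\gamma,z)=\theta(\gamma z)/\theta(z)$ and $\theta(z)=\sum_{n\in\mathbb{Z}}q^{n^2}$. Here $q=e^{2\pi i z}$. *)

(* Defs.v *)
From Stdlib Require Import Reals ZArith List ClassicalEpsilon.
From Coquelicot Require Import Coquelicot.

Set Implicit Arguments.

Record SL2Z := mkSL2Z {
  ma : Z; mb : Z; mc : Z; md : Z;
  SL2Z_det : (ma * md - mb * mc = 1)%Z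
}.

Lemma mulSL2Z_det (g h : SL2Z) :
  ((ma g * ma h + mb g * mc h) * (mc g * mb h + md g * md h)
   - (ma g * mb h + mb g * md h) * (mc g * ma h + md g * mc h) = 1)%Z.
Proof.
  destruct g as [a b c d Hg], h as [a' b' c' d' Hh]; simpl.
  transitivity ((a * d - b * c) * (a' * d' - b' * c'))%Z; [ring|].
  rewrite Hg, Hh; reflexivity.
Qed.

Definition mulSL2Z (g h : SL2Z) : SL2Z := mkSL2Z _ _ _ _ (mulSL2Z_det g h).

Lemma invSL2Z_det (g : SL2Z) :
  (md g * ma g - (- mb g) * (- mc g) = 1)%Z.
Proof. destruct g as [a b c d Hg]; simpl; rewrite <- Hg; ring. Qed.

Definition invSL2Z (g : SL2Z) : SL2Z := mkSL2Z _ _ _ _ (invSL2Z_det g).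

Definition Gamma0 (N : Z) (g : SL2Z) : Prop := (N | mc g)%Z.

Definition Gamma1 (N : Z) (g : SL2Z) : Prop :=
  (N | mc g)%Z /\ (N | ma g - 1)%Z /\ (N | md g - 1)%Z.

(* A finite system of representatives of the right cosets G h, of length m. *)
Definition has_index (G : SL2Z -> Prop) (m : nat) : Prop :=
  exists reps : list SL2Z,
    length reps = m /\
    ForallOrdPairs (fun g h => ~ G (mulSL2Z g (invSL2Z h))) reps /\
    (forall g, Exists (fun h => G (mulSL2Z g (invSL2Z h))) reps).

(* [SL_2(Z) : G]; only meaningful for subgroups of finite index, in particular
   for Gamma1 N with N > 0. The index is taken in SL_2(Z), not modulo -1. *)
Definition SL2Z_index (G : SL2Z -> Prop) : nat :=
  epsilon (inhabits 0%nat) (has_index G).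

Definition is_Dirichlet_character (N : Z) (chi : Z -> C) : Prop :=
  chi 1%Z = RtoC 1 /\
  (forall m n, chi (m * n)%Z = Cmult (chi m) (chi n)) /\
  (forall m, chi (m + N)%Z = chi m) /\
  (forall m, chi m <> RtoC 0 <-> Z.gcd m N = 1%Z).

Definition ZtoC (n : Z) : C := RtoC (IZR n).

Definition Cexp (z : C) : C :=
  Cmult (RtoC (exp (Re z))) (cos (Im z), sin (Im z)).

(* e(z) = exp(2 pi i z), so that q = e(z). *)
Definition e2pi (z : C) : C := Cexp (Cmult (Cmult (RtoC (2 * PI)) Ci) z).

Definition CSeries (u : nat -> C) : C :=
  (Series (fun n => Re (u n)), Series (fun n => Im (u n))).

Definition CSeriesZ (u : Z -> C) : C :=
  Cplus (CSeries (fun n => u (Z.of_nat n)))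
        (CSeries (fun n => u (- Z.of_nat (S n))%Z)).

Definition is_Cseries (u : nat -> C) (s : C) : Prop :=
  is_series (K := C_AbsRing) (V := C_NormedModule) u s.

(* Functions on the upper half-plane are represented by total functions
   C -> C whose values outside it are irrelevant. *)
Definition upper_half_plane (z : C) : Prop := (0 < Im z)%R.

Definition holomorphic_on_H (f : C -> C) : Prop :=
  forall z, upper_half_plane z ->
    ex_derive (K := C_AbsRing) (V := C_NormedModule) f z.

Definition denom (g : SL2Z) (z : C) : C :=
  Cplus (Cmult (ZtoC (mc g)) z) (ZtoC (md g)).

Definition moebius (g : SL2Z) (z : C) : C :=
  Cdiv (Cplus (Cmult (ZtoC (ma g)) z) (ZtoC (mb g))) (denom g z).

Definition theta (z : C) : C :=
  CSeriesZ (fun n => e2pi (Cmult (ZtoC (n * n)) z)).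

Definition theta_factor (g : SL2Z) (z : C) : C :=
  Cdiv (theta (moebius g z)) (theta z).

(* The pairs (g, phi) of Shimura's covering group lying above SL_2(Z). *)
Definition metaplectic (g : SL2Z) (phi : C -> C) : Prop :=
  holomorphic_on_H phi /\
  exists t : C, Cmod t = 1%R /\
    forall z, upper_half_plane z -> Cpow (phi z) 2 = Cmult t (denom g z).

Definition slash (k : nat) (f : C -> C) (g : SL2Z) (phi : C -> C) (z : C) : C :=
  Cdiv (f (moebius g z)) (Cpow (phi z) k).

(* Fourier expansion sum_{n >= 0} b_n e((n + r) z / h) with r in [0,1), whose
   constant term vanishes if r = 0. At a cusp, h may be taken to be its width
   and e(r) the k-th power of the multiplier of the stabiliser's generator;
   existence of one such expansion for some h and r is equivalent. *)
Definition vanishes_at_infinity (f : C -> C) : Prop :=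
  exists (h : nat) (r : R) (b : nat -> C),
    (0 < h)%nat /\ (0 <= r < 1)%R /\ (r = 0%R -> b 0%nat = RtoC 0) /\
    forall z, upper_half_plane z ->
      is_Cseries
        (fun n => Cmult (b n) (e2pi (Cmult (RtoC ((INR n + r) / INR h)) z)))
        (f z).

(* S_{k/2}(N, chi), for odd k and 4 | N. Every cusp is g(oo) for some g in
   SL_2(Z), so the last clause ranges over all cusps. *)
Definition cusp_form (k : nat) (N : Z) (chi : Z -> C) (f : C -> C) : Prop :=
  holomorphic_on_H f /\
  (forall g z, Gamma0 N g -> upper_half_plane z ->
     f (moebius g z)
     = Cmult (Cmult (chi (md g)) (Cpow (theta_factor g z) k)) (f z)) /\
  (forall g phi, metaplectic g phi -> vanishes_at_infinity (slash k f g phi)).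

(* f(z) = sum_{n >= 1} a_n q^n; the value a 0 plays no role. *)
Definition has_q_expansion (f : C -> C) (a : nat -> C) : Prop :=
  forall z, upper_half_plane z ->
    is_Cseries (fun n => Cmult (a (S n)) (Cpow (e2pi z) (S n))) (f z).

Definition Zcongr (x y M : Z) : Prop := (M | x - y)%Z.

Definition vanishing_bound (k : nat) (G : SL2Z -> Prop) : R :=
  (INR k / 24 * INR (SL2Z_index G))%R.

(* Main.v *)
Require Import Defs.
From Stdlib Require Import Reals ZArith Znumtheory Lra Lia List Permutation
  Classical ClassicalEpsilon Eqdep_dec.
From Coquelicot Require Import Coquelicot.

(** Write [f_b] for the part of [f] whose exponents are congruent to [b] modulo
    [M], and let [Q] be [N M^2], [N] or [2 N] according to the case; in all three
    [N], [M^2] and [4 M] divide [Q]. If the hypothesis holds, then [f - f_a], and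
    every [f_b] with [b <> a], vanishes at infinity to an order [s] exceeding
    [k/24 [SL_2(Z) : Gamma_1(Q)] + 1], and the point is to apply a Sturm bound.

    _Translates._ For [g] in [Gamma_1(Q)] with lower left entry [Q c'],
    conjugation by the translation by [u/M] gives an element of [Gamma_0(N)], and
    [f (g z + u/M) = J zeta^(c' u) f (z + u/M)] with [|J|^2 = |c z + d|^k] and a
    fixed [M]-th root of unity [zeta] ([translate_law]). One factor of [zeta] comes
    from [chi], because the conjugation changes the lower right entry modulo [Q/M]
    only. The other comes from theta. There the square of the transformation law
    ([theta_law_Gamma1_4], by generators, from the inversion formula
    [theta_inversion]) leaves a sign, which is read off from the Gauss sums
    governing theta at the cusp [a/c] ([gauss_sum_twist], [theta_pair]).
    Consequently [g] maps [f_b] to [f_(b - c' h)], where [zeta = e(h/M)].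

    _Sturm bound_ ([sturm_bound]). Let [psi = |F| y^w] be invariant under
    [Gamma_1(Q)]. The product of the [psi (g z)] over the cosets is invariant under
    SL_2(Z) and vanishes at infinity to order [t s] if [psi] vanishes to order [s]
    and [t] of the cosets leave [psi] unchanged. Such a product is zero if its
    weight is small compared with the order ([invariant_form_vanishes]): every
    orbit meets the half-plane [y >= 3/5], and there the maximum principle, applied
    between the heights [y] and [lambda y], contradicts the invariance. The constant
    obtained is not that of the valence formula, but [1] and [-1] are two different
    cosets of [Gamma_1(Q)], and this factor of two is more than what was lost.

    _Conclusion._ If [zeta = 1], then [f - f_a] transforms under [Gamma_1(Q)] and
    the Sturm bound applies to it ([rest_vanishes]). If [zeta <> 1], consider the
    product of all pairs [f_b f_(b + h)], [b] running through [a], [a + h],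
    [a + 2 h], and so on. Each pair contains a factor of index other than [a], so
    half of the factors vanish to order [s]; the missing factor of two is provided
    by the conjugate of [(1 0; Q 1)] by the translation by [1/M], a further coset
    which leaves the modulus of the product unchanged. Hence some [f_b] in the orbit
    vanishes, therefore so does [f_a], and the Sturm bound applies to [f = f - f_a].

    Complex analysis enters through functions given by a power series on the unit
    disc: the upper half-plane is reached either by [q = e(z)] or by the Cayley
    transform. Averages over roots of unity give the Cauchy estimates
    ([cauchy_estimate]), these give Weierstrass's theorem on series of analytic
    functions ([analytic_series]), and it gives products and compositions. The
    inversion formula of theta is proved on the imaginary axis following Polya, as
    a limit of the identity expressing the mean of [cos^(2m)] over the [L]-th roots
    of unity through binomial coefficients ([polya_identity]), and extended by the
    identity theorem. *)

Local Open Scope C_scope.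

(** * Finite sums and series of complex numbers *)

Lemma RtoC_neq_0 x : x <> 0%R -> RtoC x <> 0.
Proof. intros H E. apply H. now apply RtoC_inj in E. Qed.

Fixpoint csum (n : nat) (u : nat -> C) : C :=
  match n with O => 0 | S m => csum m u + u m end.

Fixpoint rsum (n : nat) (u : nat -> R) : R :=
  match n with O => 0%R | S m => (rsum m u + u m)%R end.

Lemma csum_ext n (u v : nat -> C) :
  (forall i, (i < n)%nat -> u i = v i) -> csum n u = csum n v.
Proof.
  induction n as [|n IH]; intros H; simpl; [reflexivity|].
  rewrite IH by (intros; apply H; lia). rewrite H by lia. reflexivity.
Qed.

Lemma csum_plus n (u v : nat -> C) :
  csum n (fun i => u i + v i) = csum n u + csum n v.
Proof. induction n as [|n IH]; simpl; [|rewrite IH]; ring. Qed.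

Lemma csum_scal n c (u : nat -> C) : csum n (fun i => c * u i) = c * csum n u.
Proof. induction n as [|n IH]; simpl; [|rewrite IH]; ring. Qed.

Lemma csum_const n c : csum n (fun _ => c) = RtoC (INR n) * c.
Proof.
  induction n as [|n IH]; [simpl; ring|].
  rewrite S_INR. simpl csum. rewrite IH, RtoC_plus. ring.
Qed.

Lemma csum_zero n (u : nat -> C) : (forall i, (i < n)%nat -> u i = 0) -> csum n u = 0.
Proof.
  intros H. rewrite (csum_ext n u (fun _ => 0)) by exact H.
  rewrite csum_const. ring.
Qed.

Lemma csum_split n m (u : nat -> C) :
  csum (n + m) u = csum n u + csum m (fun i => u (n + i)%nat).
Proof.
  induction m as [|m IH]; simpl.
  - rewrite Nat.add_0_r. ring.
  - rewrite Nat.add_succ_r. simpl. rewrite IH. ring.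
Qed.

Lemma csum_single n j (u : nat -> C) : (j < n)%nat ->
  (forall i, (i < n)%nat -> i <> j -> u i = 0) -> csum n u = u j.
Proof.
  intros Hj H. replace n with (j + (1 + (n - j - 1)))%nat by lia.
  rewrite !csum_split. rewrite csum_zero by (intros; apply H; lia).
  rewrite (csum_zero (n - j - 1)) by (intros; apply H; lia).
  simpl. rewrite Nat.add_0_r. ring.
Qed.

Lemma csum_mod n (u : nat -> C) : (Cmod (csum n u) <= rsum n (fun i => Cmod (u i)))%R.
Proof.
  induction n as [|n IH]; simpl; [rewrite Cmod_0; lra|].
  eapply Rle_trans; [apply Cmod_triangle|lra].
Qed.

Lemma rsum_le n (u v : nat -> R) :
  (forall i, (i < n)%nat -> (u i <= v i)%R) -> (rsum n u <= rsum n v)%R.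
Proof.
  induction n as [|n IH]; intros H; simpl; [lra|].
  assert (rsum n u <= rsum n v)%R by (apply IH; intros; apply H; lia).
  assert (u n <= v n)%R by (apply H; lia). lra.
Qed.

Lemma rsum_const n c : rsum n (fun _ => c) = (INR n * c)%R.
Proof. induction n as [|n IH]; [simpl; ring|rewrite S_INR; simpl rsum; rewrite IH; ring]. Qed.

Lemma csum_bound n (u : nat -> C) B : (forall i, (i < n)%nat -> (Cmod (u i) <= B)%R) ->
  (Cmod (csum n u) <= INR n * B)%R.
Proof.
  intros H. eapply Rle_trans; [apply csum_mod|]. rewrite <- rsum_const.
  now apply rsum_le.
Qed.

Lemma sum_n_csum (u : nat -> C) n : sum_n u n = csum (S n) u.
Proof.
  induction n as [|n IH]; [rewrite sum_O; simpl; ring|].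
  rewrite sum_Sn, IH. reflexivity.
Qed.

Lemma sum_n_rsum (u : nat -> R) n : sum_n u n = rsum (S n) u.
Proof.
  induction n as [|n IH]; [rewrite sum_O; simpl; ring|].
  rewrite sum_Sn, IH. reflexivity.
Qed.

Lemma is_Cseries_eps (u : nat -> C) s :
  is_Cseries u s <->
  forall eps : R, (0 < eps)%R -> exists N, forall n, (N <= n)%nat ->
    (Cmod (csum n u - s) < eps)%R.
Proof.
  unfold is_Cseries, is_series. split.
  - intros H eps He.
    destruct (proj1 (filterlim_locally_ball_norm (sum_n u) s) H (mkposreal eps He))
      as [N HN].
    exists (S N). intros [|n] Hn; [lia|].
    rewrite <- sum_n_csum. apply HN. lia.
  - intros H. apply filterlim_locally_ball_norm. intros eps.
    destruct (H eps (cond_pos eps)) as [N HN]. exists N. intros n Hn.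
    unfold ball_norm. rewrite sum_n_csum. apply (HN (S n)). lia.
Qed.

Lemma is_Cseries_unique (u : nat -> C) s t : is_Cseries u s -> is_Cseries u t -> s = t.
Proof.
  intros H1 H2. rewrite is_Cseries_eps in H1, H2.
  destruct (Req_dec (Cmod (s - t)) 0) as [E|E].
  - apply Cmod_eq_0 in E. replace s with (s - t + t) by ring. rewrite E. ring.
  - exfalso. assert (P : (0 < Cmod (s - t) / 2)%R) by (pose proof (Cmod_ge_0 (s - t)); lra).
    destruct (H1 _ P) as [N1 h1], (H2 _ P) as [N2 h2].
    specialize (h1 (N1 + N2)%nat ltac:(lia)). specialize (h2 (N1 + N2)%nat ltac:(lia)).
    set (x := csum (N1 + N2) u) in *.
    assert (Cmod (s - t) <= Cmod (x - s) + Cmod (x - t))%R; [|lra].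
    replace (s - t) with (- (x - s) + (x - t)) by ring.
    rewrite <- (Cmod_opp (x - s)). apply Cmod_triangle.
Qed.

Lemma is_Cseries_ext (u v : nat -> C) s :
  (forall n, u n = v n) -> is_Cseries u s -> is_Cseries v s.
Proof. intros H. apply is_series_ext, H. Qed.

Lemma is_Cseries_plus (u v : nat -> C) s t :
  is_Cseries u s -> is_Cseries v t -> is_Cseries (fun n => u n + v n) (s + t).
Proof. apply (is_series_plus (K := C_AbsRing) (V := C_NormedModule)). Qed.

Lemma is_Cseries_scal c (u : nat -> C) s :
  is_Cseries u s -> is_Cseries (fun n => c * u n) (c * s).
Proof. apply (is_series_scal (K := C_AbsRing) (V := C_NormedModule)). Qed.

Lemma is_Cseries_zero : is_Cseries (fun _ => 0) 0.
Proof.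
  apply is_Cseries_eps. intros eps He. exists 0%nat. intros n _.
  rewrite csum_zero by reflexivity. replace (0 - 0) with (RtoC 0) by ring. now rewrite Cmod_0.
Qed.

Lemma is_Cseries_csum m (u : nat -> nat -> C) (s : nat -> C) :
  (forall i, (i < m)%nat -> is_Cseries (u i) (s i)) ->
  is_Cseries (fun n => csum m (fun i => u i n)) (csum m s).
Proof.
  induction m as [|m IH]; intros H; simpl; [apply is_Cseries_zero|].
  apply is_Cseries_plus; [apply IH; intros|]; apply H; lia.
Qed.

Lemma is_Cseries_tail k (u : nat -> C) s :
  is_Cseries u s <-> is_Cseries (fun n => u (k + n)%nat) (s - csum k u).
Proof.
  rewrite !is_Cseries_eps. split; intros H eps He; destruct (H eps He) as [N HN].
  - exists N. intros n Hn. specialize (HN (k + n)%nat ltac:(lia)).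
    rewrite csum_split in HN.
    replace (csum n (fun i => u (k + i)%nat) - (s - csum k u))
      with (csum k u + csum n (fun i => u (k + i)%nat) - s) by ring. exact HN.
  - exists (k + N)%nat. intros n Hn. replace n with (k + (n - k))%nat by lia.
    rewrite csum_split. specialize (HN (n - k)%nat ltac:(lia)).
    replace (csum k u + csum (n - k) (fun i => u (k + i)%nat) - s)
      with (csum (n - k) (fun i => u (k + i)%nat) - (s - csum k u)) by ring. exact HN.
Qed.

Lemma is_Cseries_finite k (u : nat -> C) :
  (forall n, (k <= n)%nat -> u n = 0) -> is_Cseries u (csum k u).
Proof.
  intros H. apply (is_Cseries_tail k).
  replace (csum k u - csum k u) with (RtoC 0) by ring.
  eapply is_Cseries_ext; [|apply is_Cseries_zero]. intros n. symmetry. apply H. lia.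
Qed.

Lemma is_Cseries_single k (u : nat -> C) :
  (forall n, n <> k -> u n = 0) -> is_Cseries u (u k).
Proof.
  intros H. replace (u k) with (csum (S k) u).
  - apply is_Cseries_finite. intros n Hn. apply H. lia.
  - apply csum_single; [lia|]. intros i _ Hi. now apply H.
Qed.

Lemma rsum_le_Series (b : nat -> R) n :
  (forall n, (0 <= b n)%R) -> ex_series b -> (rsum n b <= Series b)%R.
Proof.
  intros Hb He. destruct n as [|n].
  - simpl. rewrite <- (Rmult_0_l (Series b)), <- Series_scal_l.
    apply Series_le; [|exact He]. intros n. specialize (Hb n). lra.
  - rewrite (Series_incr_n b (S n)) by (lia || exact He).
    assert (H : (0 <= Series (fun k => b (S n + k)%nat))%R).
    { rewrite <- (Rmult_0_l (Series (fun k => b (S n + k)%nat))), <- Series_scal_l.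
      apply Series_le; [intros k; specialize (Hb (S n + k)%nat); lra|].
      now apply (ex_series_incr_n b (S n)). }
    assert (E : sum_f_R0 b n = rsum (S n) b).
    { clear. induction n as [|n IH]; simpl in *; [lra|]. rewrite IH. reflexivity. }
    simpl Init.Nat.pred. rewrite E. lra.
Qed.

Lemma is_Cseries_le (u : nat -> C) s B :
  is_Cseries u s -> (forall n, (Cmod (csum n u) <= B)%R) -> (Cmod s <= B)%R.
Proof.
  intros H HB. apply Rnot_lt_le. intros Hlt. rewrite is_Cseries_eps in H.
  destruct (H (Cmod s - B)%R ltac:(lra)) as [N HN]. specialize (HN N (le_n _)).
  specialize (HB N).
  assert (Cmod s <= Cmod (csum N u) + Cmod (csum N u - s))%R; [|lra].
  replace s with (csum N u + - (csum N u - s)) at 1 by ring.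
  rewrite <- (Cmod_opp (csum N u - s)). apply Cmod_triangle.
Qed.

Lemma is_Cseries_dom (u : nat -> C) (b : nat -> R) s :
  is_Cseries u s -> (forall n, (Cmod (u n) <= b n)%R) -> ex_series b ->
  (Cmod s <= Series b)%R.
Proof.
  intros H Hb He. apply (is_Cseries_le u s _ H). intros n.
  eapply Rle_trans; [apply csum_mod|].
  eapply Rle_trans; [apply rsum_le; intros; apply Hb|].
  apply rsum_le_Series; [|exact He]. intros k. eapply Rle_trans; [apply Cmod_ge_0|apply Hb].
Qed.

Lemma ex_Cseries_dom (u : nat -> C) (b : nat -> R) :
  (forall n, (Cmod (u n) <= b n)%R) -> ex_series b -> exists s, is_Cseries u s.
Proof.
  intros Hb He.
  apply (ex_series_le (K := C_AbsRing) (V := C_CompleteNormedModule) u b); assumption.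
Qed.

Lemma ex_series_dom (a b : nat -> R) :
  (forall n, (0 <= a n <= b n)%R) -> ex_series b -> ex_series a.
Proof.
  intros H. apply (ex_series_le (K := R_AbsRing) (V := R_CompleteNormedModule)).
  intros n. change (Rabs (a n) <= b n)%R. rewrite Rabs_pos_eq; apply H.
Qed.

Lemma is_Cseries_CSeries (u : nat -> C) s : is_Cseries u s -> CSeries u = s.
Proof.
  intros H. rewrite is_Cseries_eps in H. unfold CSeries.
  assert (HRe : forall n, Re (csum n u) = rsum n (fun i => Re (u i))).
  { induction n as [|n IH]; simpl; [reflexivity|]. now rewrite <- IH. }
  assert (HIm : forall n, Im (csum n u) = rsum n (fun i => Im (u i))).
  { induction n as [|n IH]; simpl; [reflexivity|]. now rewrite <- IH. }
  assert (G : forall (p : C -> R), (forall a b : C, p (a - b) = (p a - p b)%R) ->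
     (forall z, (Rabs (p z) <= Cmod z)%R) ->
     (forall n, p (csum n u) = rsum n (fun i => p (u i))) ->
     Series (fun n => p (u n)) = p s).
  { intros p Hm Hp Hs. apply is_series_unique.
    apply filterlim_locally_ball_norm. intros eps.
    destruct (H eps (cond_pos eps)) as [N HN]. exists N. intros n Hn.
    unfold ball_norm. change (Rabs (sum_n (fun n => p (u n)) n - p s) < eps)%R.
    rewrite sum_n_rsum, <- Hs, <- Hm. eapply Rle_lt_trans; [apply Hp|]. apply HN. lia. }
  rewrite (G Re), (G Im).
  - now destruct s.
  - intros [a b] [c d]; simpl; reflexivity.
  - intros z. eapply Rle_trans; [|apply Rmax_Cmod]. apply Rmax_r.
  - exact HIm.
  - intros [a b] [c d]; simpl; reflexivity.
  - apply re_le_Cmod.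
  - exact HRe.
Qed.

Lemma ex_series_geom_scal (K r : R) : (0 <= r < 1)%R -> ex_series (fun n => K * r ^ n)%R.
Proof.
  intros H. apply (ex_series_scal_l (K := R_AbsRing) (V := R_NormedModule) K (fun n => (r ^ n)%R)). apply ex_series_geom.
  rewrite Rabs_pos_eq; lra.
Qed.

Lemma Series_geom_scal (K r : R) : (0 <= r < 1)%R ->
  Series (fun n => K * r ^ n)%R = (K / (1 - r))%R.
Proof.
  intros H. rewrite Series_scal_l, Series_geom by (rewrite Rabs_pos_eq; lra). reflexivity.
Qed.

(** * Power series on the unit disc *)

Definition cis (x : R) : C := (cos x, sin x).

Lemma cis_add x y : cis (x + y) = cis x * cis y.
Proof.
  unfold cis, Cmult; simpl. rewrite cos_plus, sin_plus. f_equal; ring.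
Qed.

Lemma cis_0 : cis 0 = 1.
Proof. unfold cis. rewrite cos_0, sin_0. reflexivity. Qed.

Lemma cis_pow x n : cis x ^ n = cis (INR n * x).
Proof.
  induction n as [|n IH]; [simpl; rewrite Rmult_0_l; symmetry; apply cis_0|].
  rewrite Cpow_S, IH, <- cis_add, S_INR. f_equal. ring.
Qed.

Lemma Cmod_cis x : Cmod (cis x) = 1%R.
Proof.
  unfold Cmod, cis; simpl. rewrite !Rmult_1_r.
  pose proof (sin2_cos2 x) as H. unfold Rsqr in H.
  rewrite Rplus_comm, H. apply sqrt_1.
Qed.

Lemma cis_period (p : Z) : cis (2 * PI * IZR p) = 1.
Proof.
  unfold cis. replace (2 * PI * IZR p)%R with (0 + 2 * IZR p * PI)%R by ring.
  assert (G : forall m x, cos (x + 2 * IZR m * PI) = cos x /\ sin (x + 2 * IZR m * PI) = sin x).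
  { intros m x. destruct (Z_le_gt_dec 0 m) as [Hm|Hm].
    - rewrite <- (Z2Nat.id m Hm), <- INR_IZR_INZ. now rewrite cos_period, sin_period.
    - rewrite <- (cos_period (x + 2 * IZR m * PI) (Z.to_nat (- m))),
        <- (sin_period (x + 2 * IZR m * PI) (Z.to_nat (- m))), INR_IZR_INZ, Z2Nat.id by lia.
      rewrite opp_IZR.
      replace (x + 2 * IZR m * PI + 2 * - IZR m * PI)%R with x by ring. auto. }
  destruct (G p 0%R) as [-> ->]. rewrite cos_0, sin_0. reflexivity.
Qed.

Lemma cis_neq_1 x : (0 < Rabs x < 2 * PI)%R -> cis x <> 1.
Proof.
  intros H E. apply (f_equal fst) in E. simpl in E.
  assert (P : forall y, (0 < y < 2 * PI)%R -> cos y <> 1%R).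
  { intros y Hy Hc. replace y with (2 * (y / 2))%R in Hc by field.
    rewrite cos_2a_sin in Hc. assert (0 < sin (y / 2))%R by (apply sin_gt_0; lra). nra. }
  revert E. unfold Rabs in H. destruct (Rcase_abs x).
  - rewrite <- cos_neg. apply P. lra.
  - apply P. lra.
Qed.

Lemma csum_geom_eq L x : (x - 1) * csum L (fun j => x ^ j) = x ^ L - 1.
Proof.
  induction L as [|L IH]; [simpl; ring|].
  simpl csum. rewrite Cmult_plus_distr_l, IH, Cpow_S. ring.
Qed.

Lemma csum_root_of_unity L x : x ^ L = 1 -> x <> 1 -> csum L (fun j => x ^ j) = 0.
Proof.
  intros H1 H2. pose proof (csum_geom_eq L x) as H. rewrite H1 in H.
  assert (Hx : x - 1 <> 0) by (intros E; apply H2; replace x with (x - 1 + 1) by ring; rewrite E; ring).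
  replace (csum L (fun j => x ^ j)) with ((x - 1) * csum L (fun j => x ^ j) / (x - 1))
    by (field; exact Hx).
  rewrite H. field. exact Hx.
Qed.

Definition analytic_with (c : nat -> C) (F : C -> C) : Prop :=
  forall w, (Cmod w < 1)%R -> is_Cseries (fun n => c n * w ^ n) (F w).

Definition analytic (F : C -> C) : Prop := exists c, analytic_with c F.

Lemma is_Cseries_bounded (u : nat -> C) s :
  is_Cseries u s -> exists B, forall n, (Cmod (u n) <= B)%R.
Proof.
  intros H. rewrite is_Cseries_eps in H. destruct (H 1%R Rlt_0_1) as [N HN].
  assert (E : forall M, exists B, (0 <= B)%R /\ forall n, (n < M)%nat -> (Cmod (u n) <= B)%R).
  { induction M as [|M [B [B0 HB]]]; [exists 0%R; split; [lra|intros; lia]|].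
    exists (B + Cmod (u M))%R. pose proof (Cmod_ge_0 (u M)). split; [lra|].
    intros n Hn. destruct (Nat.eq_dec n M) as [->|Hne]; [lra|].
    assert (Cmod (u n) <= B)%R by (apply HB; lia). lra. }
  destruct (E N) as [B [B0 HB]]. exists (B + 2)%R. intros n.
  destruct (Nat.lt_ge_cases n N) as [Hn|Hn]; [specialize (HB n Hn); lra|].
  pose proof (HN n Hn) as h1. pose proof (HN (S n) ltac:(lia)) as h2. simpl in h2.
  replace (u n) with ((csum n u + u n - s) + - (csum n u - s)) by ring.
  eapply Rle_trans; [apply Cmod_triangle|]. rewrite Cmod_opp. lra.
Qed.

(** Comparison with a geometric series is the form in which absolute
    convergence is used throughout. *)
Lemma analytic_with_geom c F r : analytic_with c F -> (0 <= r < 1)%R ->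
  exists K q, (0 <= K)%R /\ (0 <= q < 1)%R /\ forall n, (Cmod (c n) * r ^ n <= K * q ^ n)%R.
Proof.
  intros H Hr. set (r' := ((1 + r) / 2)%R).
  assert (Hr' : (0 < r' < 1)%R) by (unfold r'; lra).
  destruct (is_Cseries_bounded _ _ (H (RtoC r') ltac:(rewrite Cmod_R, Rabs_pos_eq; lra)))
    as [K HK].
  exists K, (r / r')%R. split; [eapply Rle_trans; [apply Cmod_ge_0|apply (HK 0%nat)]|].
  split.
  - split; [apply Rle_div_r; lra|]. apply Rlt_div_l; unfold r'; lra.
  - intros n. specialize (HK n). rewrite Cmod_mult, Cmod_pow, Cmod_R, Rabs_pos_eq in HK by lra.
    replace (r ^ n)%R with (r' ^ n * (r / r') ^ n)%R
      by (rewrite <- Rpow_mult_distr; f_equal; field; lra).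
    rewrite <- Rmult_assoc. apply Rmult_le_compat_r; [|exact HK].
    apply pow_le. apply Rle_div_r; lra.
Qed.

Lemma geom_lim_0 K q eps : (0 <= q < 1)%R -> (0 < eps)%R ->
  exists N, forall n, (N <= n)%nat -> (K * q ^ n < eps)%R.
Proof.
  intros Hq He.
  destruct (pow_lt_1_zero q ltac:(rewrite Rabs_pos_eq; lra) (eps / (Rabs K + 1))%R) as [N HN].
  { apply Rdiv_lt_0_compat; [lra|]. pose proof (Rabs_pos K). lra. }
  exists N. intros n Hn. specialize (HN n Hn).
  rewrite Rabs_pos_eq in HN by (apply pow_le; lra).
  pose proof (Rabs_pos K). apply Rlt_div_r in HN; [|lra].
  pose proof (Rle_abs K). assert (0 <= q ^ n)%R by (apply pow_le; lra). nra.
Qed.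

Lemma analytic_of_bounded c :
  (forall r, (0 < r < 1)%R -> exists B, forall n, (Cmod (c n) * r ^ n <= B)%R) ->
  analytic_with c (fun w => CSeries (fun n => c n * w ^ n)).
Proof.
  intros H w Hw. pose proof (Cmod_ge_0 w). set (r := ((1 + Cmod w) / 2)%R).
  assert (Hr : (0 < r < 1)%R) by (unfold r; lra).
  destruct (H r Hr) as [B HB].
  destruct (ex_Cseries_dom (fun n => c n * w ^ n) (fun n => B * (Cmod w / r) ^ n)%R) as [s Hs].
  - intros n. rewrite Cmod_mult, Cmod_pow.
    replace (Cmod w ^ n)%R with (r ^ n * (Cmod w / r) ^ n)%R
      by (rewrite <- Rpow_mult_distr; f_equal; field; lra).
    rewrite <- Rmult_assoc. apply Rmult_le_compat_r; [|apply HB].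
    apply pow_le. apply Rle_div_r; lra.
  - apply ex_series_geom_scal. split; [apply Rle_div_r; lra|]. apply Rlt_div_l; unfold r; lra.
  - rewrite (is_Cseries_CSeries _ _ Hs). exact Hs.
Qed.

Lemma Rle_eps a b : (forall eps, (0 < eps)%R -> (a <= b + eps)%R) -> (a <= b)%R.
Proof. intros H. apply le_epsilon. exact H. Qed.

(** Averaging [F] over the [L]-th roots of unity on the circle isolates the
    [n]-th term up to the tail of the series beyond [L]: a discrete form of
    Cauchy's integral formula. *)
Lemma cauchy_estimate c F r B n :
  analytic_with c F -> (0 < r < 1)%R ->
  (forall x, (Cmod (F (RtoC r * cis x)%C) <= B)%R) -> (Cmod (c n) * r ^ n <= B)%R.
Proof.
  intros HF Hr HB.
  destruct (analytic_with_geom c F r HF ltac:(lra)) as (K & q & HK & Hq & Hg).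
  apply Rle_eps. intros eps He.
  destruct (geom_lim_0 (K / (1 - q)) q eps Hq He) as [L0 HL0].
  set (L := S (L0 + n)).
  assert (HL : (0 < INR L)%R) by (apply lt_0_INR; unfold L; lia).
  set (th := (2 * PI / INR L)%R).
  set (u := fun j : nat => RtoC r * cis (INR j * th)).
  assert (Hu : forall j, Cmod (u j) = r).
  { intros j. unfold u. rewrite Cmod_mult, Cmod_cis, Cmod_R, Rabs_pos_eq by lra. ring. }
  set (T := fun m => csum L (fun j => cis (- (INR j * INR n * th)) * (c m * u j ^ m))).
  assert (HT : is_Cseries T (csum L (fun j => cis (- (INR j * INR n * th)) * F (u j)))).
  { apply (is_Cseries_csum L (fun j m => cis (- (INR j * INR n * th)) * (c m * u j ^ m))).
    intros j _. apply is_Cseries_scal. apply HF. rewrite Hu. lra. }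
  assert (HTm : forall m, T m = c m * RtoC r ^ m * csum L (fun j => cis ((INR m - INR n) * th) ^ j)).
  { intros m. unfold T. rewrite <- csum_scal. apply csum_ext. intros j _.
    unfold u. rewrite Cpow_mult_l, !cis_pow.
    transitivity (c m * RtoC r ^ m * (cis (- (INR j * INR n * th)) * cis (INR m * (INR j * th)))); [ring|].
    rewrite <- cis_add. do 2 f_equal. ring. }
  assert (HTn : csum L T = RtoC (INR L) * (c n * RtoC r ^ n)).
  { rewrite (csum_single L n); [|unfold L; lia|].
    - rewrite HTm. replace ((INR n - INR n) * th)%R with 0%R by ring. rewrite cis_0.
      rewrite (csum_ext L _ (fun _ => 1)) by (intros; apply Cpow_1_l).
      rewrite csum_const. ring.
    - intros m Hm Hne. rewrite HTm, csum_root_of_unity; [ring| |].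
      + rewrite cis_pow. replace (INR L * ((INR m - INR n) * th))%R
          with (2 * PI * IZR (Z.of_nat m - Z.of_nat n))%R; [apply cis_period|].
        rewrite minus_IZR, <- !INR_IZR_INZ. unfold th. field. lra.
      + apply cis_neq_1. assert (Hth : (0 < th)%R) by (apply Rdiv_lt_0_compat; pose proof PI_RGT_0; lra).
        rewrite Rabs_mult, (Rabs_pos_eq th) by lra.
        assert (Hd : (0 < Rabs (INR m - INR n) < INR L)%R).
        { split; [apply Rabs_pos_lt; intros E; apply Hne, INR_eq; lra|].
          assert (INR n < INR L)%R by (apply lt_INR; unfold L; lia).
          assert (INR m < INR L)%R by (apply lt_INR; lia).
          pose proof (pos_INR n). pose proof (pos_INR m).
          apply Rabs_def1; lra. }
        split; [nra|]. replace (2 * PI)%R with (INR L * th)%R by (unfold th; field; lra). nra. }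
  apply (is_Cseries_tail L) in HT. rewrite HTn in HT.
  assert (Htail := is_Cseries_dom _ (fun m => (INR L * (K * q ^ L)) * q ^ m)%R _ HT).
  rewrite Series_geom_scal in Htail by exact Hq.
  specialize (HL0 L ltac:(unfold L; lia)).
  assert (Hmain : (INR L * (Cmod (c n) * r ^ n) <= INR L * B + INR L * (K * q ^ L) / (1 - q))%R).
  { replace (INR L * (Cmod (c n) * r ^ n))%R with (Cmod (RtoC (INR L) * (c n * RtoC r ^ n)))
      by (rewrite !Cmod_mult, Cmod_pow, !Cmod_R, !Rabs_pos_eq by lra; ring).
    set (A := csum L (fun j => cis (- (INR j * INR n * th)) * F (u j))) in *.
    replace (RtoC (INR L) * (c n * RtoC r ^ n))
      with (A + - (A - RtoC (INR L) * (c n * RtoC r ^ n))) by ring.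
    eapply Rle_trans; [apply Cmod_triangle|]. rewrite Cmod_opp. apply Rplus_le_compat.
    - apply csum_bound. intros j _. rewrite Cmod_mult, Cmod_cis, Rmult_1_l. apply HB.
    - apply Htail.
      + intros m. rewrite HTm, !Cmod_mult, Cmod_pow, Cmod_R, Rabs_pos_eq by lra.
        assert (H1 : (Cmod (csum L (fun j => cis ((INR (L + m) - INR n) * th) ^ j)%C) <= INR L * 1)%R).
        { apply csum_bound. intros j _. rewrite Cmod_pow, Cmod_cis, pow1. lra. }
        specialize (Hg (L + m)%nat). rewrite (pow_add q) in Hg.
        assert (0 <= Cmod (c (L + m)%nat) * r ^ (L + m))%R.
        { apply Rmult_le_pos; [apply Cmod_ge_0|apply pow_le; lra]. }
        eapply Rle_trans; [apply Rmult_le_compat; [assumption|apply Cmod_ge_0|exact Hg|exact H1]|].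
        right. ring.
      + apply ex_series_geom_scal. exact Hq. }
  replace (INR L * (K * q ^ L) / (1 - q))%R with (INR L * (K / (1 - q) * q ^ L))%R in Hmain
    by (field; lra).
  apply (Rmult_le_reg_l (INR L)); [exact HL|]. nra.
Qed.

Lemma analytic_with_uniform_bound c F r : analytic_with c F -> (0 <= r < 1)%R ->
  exists B, forall w, (Cmod w <= r)%R -> (Cmod (F w) <= B)%R.
Proof.
  intros HF Hr. destruct (analytic_with_geom c F r HF Hr) as (K & q & HK & Hq & Hg).
  exists (Series (fun n => K * q ^ n)%R). intros w Hw.
  apply (is_Cseries_dom (fun n => c n * w ^ n)).
  - apply HF. lra.
  - intros n. eapply Rle_trans; [|apply Hg]. rewrite Cmod_mult, Cmod_pow.
    apply Rmult_le_compat_l; [apply Cmod_ge_0|]. apply pow_incr. pose proof (Cmod_ge_0 w). lra.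
  - apply ex_series_geom_scal. exact Hq.
Qed.

Lemma analytic_uniform_bound F r : analytic F -> (0 <= r < 1)%R ->
  exists B, forall w, (Cmod w <= r)%R -> (Cmod (F w) <= B)%R.
Proof. intros [c H]. apply (analytic_with_uniform_bound c). exact H. Qed.

Lemma fun_choice (A B : Type) (R : A -> B -> Prop) :
  (forall x, exists y, R x y) -> exists f, forall x, R x (f x).
Proof.
  intros H. exists (fun x => proj1_sig (constructive_indefinite_description _ (H x))).
  intros x. exact (proj2_sig (constructive_indefinite_description _ (H x))).
Qed.

(** Weierstrass: the Cauchy estimates make the coefficients of the summands
    summable, and bound the tails of all the summands at once. *)
Lemma analytic_series (G : nat -> C -> C) (F : C -> C) :
  (forall j, analytic (G j)) ->
  (forall r, (0 < r < 1)%R -> exists b : nat -> R, ex_series b /\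
     forall j w, (Cmod w <= r)%R -> (Cmod (G j w) <= b j)%R) ->
  (forall w, (Cmod w < 1)%R -> is_Cseries (fun j => G j w) (F w)) ->
  analytic F.
Proof.
  intros HG Hb HF.
  assert (Hc : exists c : nat -> nat -> C, forall j, analytic_with (c j) (G j)).
  { apply (fun_choice _ _ (fun j c => analytic_with c (G j))). exact HG. }
  destruct Hc as [c Hc].
  assert (Hest : forall r, (0 < r < 1)%R -> exists b : nat -> R, ex_series b /\
    forall j n, (Cmod (c j n) * r ^ n <= b j)%R).
  { intros r Hr. destruct (Hb r Hr) as (b & Hbs & Hbb). exists b. split; [exact Hbs|].
    intros j n. apply (cauchy_estimate _ _ r (b j) n (Hc j) Hr). intros x. apply Hbb.
    rewrite Cmod_mult, Cmod_cis, Cmod_R, Rabs_pos_eq by lra. lra. }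
  assert (HC : exists C0 : nat -> C, forall n, is_Cseries (fun j => c j n) (C0 n)).
  { apply (fun_choice _ _ (fun n s => is_Cseries (fun j => c j n) s)). intros n.
    destruct (Hest (/ 2)%R ltac:(lra)) as (b & Hbs & Hbb).
    apply (ex_Cseries_dom _ (fun j => 2 ^ n * b j)%R).
    - intros j. specialize (Hbb j n). rewrite pow_inv in Hbb.
      assert (0 < 2 ^ n)%R by (apply pow_lt; lra).
      apply (Rmult_le_reg_r (/ 2 ^ n)); [now apply Rinv_0_lt_compat|].
      eapply Rle_trans; [exact Hbb|]. right. field. lra.
    - apply (ex_series_scal_l (K := R_AbsRing) (V := R_NormedModule)). exact Hbs. }
  destruct HC as [C0 HC]. exists C0. intros w Hw. pose proof (Cmod_ge_0 w).
  set (r := ((1 + Cmod w) / 2)%R). assert (Hr : (0 < r < 1)%R) by (unfold r; lra).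
  destruct (Hest r Hr) as (b & Hbs & Hbb).
  set (q := (Cmod w / r)%R).
  assert (Hq : (0 <= q < 1)%R).
  { unfold q. split; [apply Rle_div_r; lra|]. apply Rlt_div_l; unfold r; lra. }
  apply is_Cseries_eps. intros eps He.
  destruct (geom_lim_0 (Series b / (1 - q)) q eps Hq He) as [N HN].
  exists N. intros n Hn. eapply Rle_lt_trans; [|apply (HN n Hn)].
  assert (Hfin : is_Cseries (fun j => csum n (fun i => w ^ i * c j i)) (csum n (fun i => C0 i * w ^ i))).
  { rewrite (csum_ext n _ (fun i => w ^ i * C0 i)) by (intros; ring).
    apply (is_Cseries_csum n (fun i j => w ^ i * c j i)). intros i _. now apply is_Cseries_scal. }
  assert (Hdiff := is_Cseries_plus _ _ _ _ Hfin (is_Cseries_scal (- (1)) _ _ (HF w Hw))).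
  replace (csum n (fun i => C0 i * w ^ i) - F w)
    with (csum n (fun i => C0 i * w ^ i) + - (1) * F w) by ring.
  replace (Series b / (1 - q) * q ^ n)%R with (Series (fun j => (q ^ n / (1 - q)) * b j)%R)
    by (rewrite Series_scal_l; field; lra).
  apply (is_Cseries_dom _ _ _ Hdiff).
  - intros j. simpl.
    assert (Ht := proj1 (is_Cseries_tail n _ _) (Hc j w Hw)).
    replace (csum n (fun i => w ^ i * c j i) + - (1) * G j w)
      with (- (G j w - csum n (fun i => c j i * w ^ i))).
    2:{ rewrite (csum_ext n (fun i => c j i * w ^ i) (fun i => w ^ i * c j i)) by (intros; ring). ring. }
    rewrite Cmod_opp.
    eapply Rle_trans; [apply (is_Cseries_dom _ (fun m => (b j * q ^ n) * q ^ m)%R _ Ht)|].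
    + intros m. rewrite Cmod_mult, Cmod_pow, Rmult_assoc, <- pow_add.
      replace (Cmod w ^ (n + m))%R with (r ^ (n + m) * q ^ (n + m))%R
        by (rewrite <- Rpow_mult_distr; f_equal; unfold q; field; lra).
      rewrite <- Rmult_assoc. apply Rmult_le_compat_r; [apply pow_le; lra|apply Hbb].
    + now apply ex_series_geom_scal.
    + rewrite Series_geom_scal by exact Hq. right. field. lra.
  - apply (ex_series_scal_l (K := R_AbsRing) (V := R_NormedModule)). exact Hbs.
Qed.

Lemma analytic_ext F G :
  (forall w, (Cmod w < 1)%R -> F w = G w) -> analytic F -> analytic G.
Proof. intros H [c Hc]. exists c. intros w Hw. rewrite <- H by exact Hw. now apply Hc. Qed.

Lemma analytic_monomial c n : analytic (fun w => c * w ^ n).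
Proof.
  exists (fun m => if Nat.eq_dec m n then c else RtoC 0). intros w _.
  replace (c * w ^ n) with ((if Nat.eq_dec n n then c else RtoC 0) * w ^ n)
    by (destruct (Nat.eq_dec n n); [reflexivity|contradiction]).
  apply (is_Cseries_single n (fun m => (if Nat.eq_dec m n then c else RtoC 0) * w ^ m)).
  intros m Hm. destruct (Nat.eq_dec m n); [contradiction|ring].
Qed.

Lemma analytic_const c : analytic (fun _ => c).
Proof.
  apply (analytic_ext (fun w => c * w ^ 0)); [intros; simpl; ring|apply analytic_monomial].
Qed.

Lemma analytic_id : analytic (fun w => w).
Proof.
  apply (analytic_ext (fun w => 1 * w ^ 1)); [intros; simpl; ring|apply analytic_monomial].
Qed.

Lemma analytic_plus F G : analytic F -> analytic G -> analytic (fun w => F w + G w).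
Proof.
  intros [c Hc] [d Hd]. exists (fun n => c n + d n). intros w Hw.
  eapply is_Cseries_ext; [|apply is_Cseries_plus; [apply (Hc w Hw)|apply (Hd w Hw)]].
  intros n. simpl. ring.
Qed.

Lemma analytic_scal a F : analytic F -> analytic (fun w => a * F w).
Proof.
  intros [c Hc]. exists (fun n => a * c n). intros w Hw.
  eapply is_Cseries_ext; [|apply is_Cseries_scal, (Hc w Hw)]. intros n. simpl. ring.
Qed.

Lemma analytic_shift n F : analytic F -> analytic (fun w => w ^ n * F w).
Proof.
  intros [c Hc]. exists (fun m => if (m <? n)%nat then RtoC 0 else c (m - n)%nat). intros w Hw.
  apply (is_Cseries_tail n).
  rewrite csum_zero.
  2:{ intros i Hi. apply Nat.ltb_lt in Hi. rewrite Hi. ring. }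
  replace (w ^ n * F w - 0) with (w ^ n * F w) by ring.
  eapply is_Cseries_ext; [|apply is_Cseries_scal, (Hc w Hw)].
  intros m. simpl. replace (n + m <? n)%nat with false by (symmetry; apply Nat.ltb_ge; lia).
  replace (n + m - n)%nat with m by lia. rewrite Cpow_add_r. ring.
Qed.

(** The product is the sum over [n] of the shifts [c n * w ^ n * G w]. *)
Lemma analytic_mult F G : analytic F -> analytic G -> analytic (fun w => F w * G w).
Proof.
  intros [c Hc] HG.
  apply (analytic_series (fun n w => c n * (w ^ n * G w))).
  - intros n. now apply analytic_scal, analytic_shift.
  - intros r Hr. destruct (analytic_with_geom c F r Hc ltac:(lra)) as (K & q & HK & Hq & Hg).
    destruct (analytic_uniform_bound G r HG ltac:(lra)) as [B HB].
    exists (fun n => (K * B) * q ^ n)%R. split; [now apply ex_series_geom_scal|].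
    intros n w Hw. rewrite !Cmod_mult, Cmod_pow, <- Rmult_assoc.
    specialize (Hg n). specialize (HB w Hw). pose proof (Cmod_ge_0 w).
    assert (Cmod w ^ n <= r ^ n)%R by (apply pow_incr; lra).
    assert (0 <= Cmod w ^ n)%R by (apply pow_le; lra).
    pose proof (Cmod_ge_0 (c n)). pose proof (Cmod_ge_0 (G w)).
    replace (K * B * q ^ n)%R with (K * q ^ n * B)%R by ring.
    apply Rmult_le_compat; [now apply Rmult_le_pos|assumption| |assumption].
    eapply Rle_trans; [|exact Hg]. now apply Rmult_le_compat_l.
  - intros w Hw. rewrite Cmult_comm.
    eapply is_Cseries_ext; [|apply is_Cseries_scal, (Hc w Hw)]. intros n. simpl. ring.
Qed.

Lemma analytic_pow F n : analytic F -> analytic (fun w => F w ^ n).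
Proof.
  intros HF. induction n as [|n IH]; [apply (analytic_const 1)|].
  apply (analytic_ext (fun w => F w * F w ^ n)); [reflexivity|]. now apply analytic_mult.
Qed.

Lemma analytic_comp F tau : analytic F -> analytic tau ->
  (forall r, (0 < r < 1)%R -> exists r', (0 <= r' < 1)%R /\
     forall w, (Cmod w <= r)%R -> (Cmod (tau w) <= r')%R) ->
  analytic (fun w => F (tau w)).
Proof.
  intros [c Hc] Ht Hr.
  apply (analytic_series (fun n w => c n * tau w ^ n)).
  - intros n. now apply analytic_scal, analytic_pow.
  - intros r Hr0. destruct (Hr r Hr0) as (r' & Hr' & Hb).
    destruct (analytic_with_geom c F r' Hc Hr') as (K & q & HK & Hq & Hg).
    exists (fun n => K * q ^ n)%R. split; [now apply ex_series_geom_scal|].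
    intros n w Hw. eapply Rle_trans; [|apply Hg]. rewrite Cmod_mult, Cmod_pow.
    apply Rmult_le_compat_l; [apply Cmod_ge_0|]. apply pow_incr.
    split; [apply Cmod_ge_0|now apply Hb].
  - intros w Hw. apply Hc. pose proof (Cmod_ge_0 w).
    destruct (Hr ((1 + Cmod w) / 2)%R ltac:(lra)) as (r' & Hr' & Hb).
    eapply Rle_lt_trans; [apply Hb|]; lra.
Qed.

Lemma analytic_comp_monomial F z n : analytic F -> (Cmod z <= 1)%R -> (0 < n)%nat ->
  analytic (fun w => F (z * w ^ n)).
Proof.
  intros HF Hz Hn. apply (analytic_comp F); [exact HF|apply analytic_monomial|].
  intros r Hr. exists r. split; [lra|]. intros w Hw. rewrite Cmod_mult, Cmod_pow.
  pose proof (Cmod_ge_0 w). pose proof (Cmod_ge_0 z).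
  assert (Cmod w ^ n <= r)%R.
  { destruct n as [|n]; [lia|]. simpl.
    assert (Cmod w ^ n <= 1)%R by (rewrite <- (pow1 n); apply pow_incr; lra).
    assert (0 <= Cmod w ^ n)%R by (apply pow_le; lra). nra. }
  assert (0 <= Cmod w ^ n)%R by (apply pow_le; lra). nra.
Qed.

Lemma analytic_inv_linear e : (Cmod e <= 1)%R -> analytic (fun w => / (1 - e * w)).
Proof.
  intros He. exists (fun n => e ^ n). intros w Hw. pose proof (Cmod_ge_0 w). pose proof (Cmod_ge_0 e).
  assert (Hq : (0 <= Cmod (e * w) < 1)%R) by (rewrite Cmod_mult; nra).
  assert (Hne : 1 - e * w <> 0).
  { intros E. assert (e * w = 1) as E1 by (replace (e * w) with (1 - (1 - e * w)) by ring; rewrite E; ring).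
    rewrite E1, Cmod_1 in Hq. lra. }
  apply is_Cseries_eps. intros eps Heps.
  destruct (geom_lim_0 (/ Cmod (1 - e * w)) _ eps Hq Heps) as [N HN].
  exists N. intros n Hn. specialize (HN n Hn).
  rewrite (csum_ext n _ (fun j => (e * w) ^ j)) by (intros; now rewrite Cpow_mult_l).
  replace (csum n (fun j => (e * w) ^ j) - / (1 - e * w)) with (- (/ (1 - e * w) * (e * w) ^ n)).
  - rewrite Cmod_opp, Cmod_mult, Cmod_inv, Cmod_pow by exact Hne. exact HN.
  - pose proof (csum_geom_eq n (e * w)) as G.
    replace (csum n (fun j => (e * w) ^ j))
      with (- ((e * w - 1) * csum n (fun j => (e * w) ^ j)) / (1 - e * w)) by (field; exact Hne).
    rewrite G. field. exact Hne.
Qed.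

(** Zeros are isolated: below a certain radius the first non-zero coefficient
    dominates the rest of the series. *)
Lemma analytic_nonzero_near_0 F : analytic F ->
  (exists w, (Cmod w < 1)%R /\ F w <> 0) ->
  exists d, (0 < d < 1)%R /\ forall w, (0 < Cmod w < d)%R -> F w <> 0.
Proof.
  intros [c Hc] [w0 [Hw0 HF0]].
  assert (Hex : exists n, c n <> 0).
  { apply NNPP. intros H. apply HF0. apply (is_Cseries_unique _ _ _ (Hc w0 Hw0)).
    eapply is_Cseries_ext; [|apply is_Cseries_zero]. intros n.
    assert (E : c n = 0) by (apply NNPP; intros E; apply H; now exists n). rewrite E. ring. }
  destruct (dec_inh_nat_subset_has_unique_least_element (fun n => c n <> 0)
    (fun n => classic _) Hex) as (n & [Hn Hmin] & _).
  destruct (is_Cseries_bounded _ _ (Hc (RtoC (/ 2)) ltac:(rewrite Cmod_R, Rabs_pos_eq; lra)))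
    as [K HK].
  assert (HK' : forall m, (Cmod (c m) <= (K + 1) * 2 ^ m)%R).
  { intros m. specialize (HK m). rewrite Cmod_mult, Cmod_pow, Cmod_R, Rabs_pos_eq, pow_inv in HK by lra.
    assert (0 < 2 ^ m)%R by (apply pow_lt; lra).
    apply (Rmult_le_reg_r (/ 2 ^ m)); [now apply Rinv_0_lt_compat|].
    rewrite Rmult_assoc, Rinv_r by lra. lra. }
  assert (K0 : (0 <= K)%R) by (eapply Rle_trans; [apply Cmod_ge_0|apply (HK 0%nat)]).
  assert (Hcn : (0 < Cmod (c n))%R) by (now apply Cmod_gt_0).
  assert (H2n : (0 < 2 ^ n)%R) by (apply pow_lt; lra).
  exists (Rmin (/ 4) (Cmod (c n) / ((K + 1) * (4 * 2 ^ n)))).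
  assert (Hpos : (0 < Cmod (c n) / ((K + 1) * (4 * 2 ^ n)))%R) by (apply Rdiv_lt_0_compat; nra).
  split.
  - split; [apply Rmin_pos; lra|]. eapply Rle_lt_trans; [apply Rmin_l|lra].
  - intros w [Hw1 Hw2] HFw.
    assert (Ha : (Cmod w < / 4)%R) by (eapply Rlt_le_trans; [exact Hw2|apply Rmin_l]).
    assert (Hb : (Cmod w < Cmod (c n) / ((K + 1) * (4 * 2 ^ n)))%R)
      by (eapply Rlt_le_trans; [exact Hw2|apply Rmin_r]).
    assert (Ht := proj1 (is_Cseries_tail (S n) _ _) (Hc w ltac:(lra))).
    simpl csum in Ht. rewrite csum_zero in Ht.
    2:{ intros i Hi. destruct (classic (c i = 0)) as [E|E]; [rewrite E; ring|].
        specialize (Hmin i E). lia. }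
    rewrite HFw in Ht.
    assert (Hle := is_Cseries_dom _ (fun m => ((K + 1) * (2 * Cmod w) ^ (S n)) * (2 * Cmod w) ^ m)%R _ Ht).
    rewrite Series_geom_scal in Hle by lra.
    assert (Hle' : (Cmod (c n) * Cmod w ^ n <= (K + 1) * (2 * Cmod w) ^ S n / (1 - 2 * Cmod w))%R).
    { rewrite <- Cmod_pow, <- Cmod_mult, <- (Cmod_opp (c n * w ^ n)).
      replace (- (c n * w ^ n)) with (0 - (0 + c n * w ^ n)) by ring.
      apply Hle; [|apply ex_series_geom_scal; lra].
      intros m. rewrite Cmod_mult, Cmod_pow, Rmult_assoc, <- pow_add, Rpow_mult_distr, <- Rmult_assoc.
      apply Rmult_le_compat_r; [apply pow_le; lra|]. apply HK'. }
    assert (Hwn : (0 < Cmod w ^ n)%R) by (now apply pow_lt).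
    assert (Hd : (/ (1 - 2 * Cmod w) <= 2)%R).
    { replace 2%R with (/ / 2)%R at 2 by field. apply Rinv_le_contravar; lra. }
    simpl in Hle'. rewrite Rpow_mult_distr in Hle'. unfold Rdiv in Hle'.
    apply Rlt_div_r in Hb; [|nra].
    assert (Hfin : (Cmod (c n) * Cmod w ^ n <= (K + 1) * (2 * Cmod w * (2 ^ n * Cmod w ^ n)) * 2)%R).
    { eapply Rle_trans; [exact Hle'|]. apply Rmult_le_compat_l; [|exact Hd].
      apply Rmult_le_pos; [lra|]. apply Rmult_le_pos; [lra|]. apply Rmult_le_pos; lra. }
    apply (Rmult_lt_compat_r (Cmod w ^ n)) in Hb; [|exact Hwn]. nra.
Qed.

Lemma analytic_zero_of_accumulation F : analytic F ->
  (forall d, (0 < d < 1)%R -> exists w, (0 < Cmod w < d)%R /\ F w = 0) ->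
  forall w, (Cmod w < 1)%R -> F w = 0.
Proof.
  intros HF H w Hw. apply NNPP. intros E.
  destruct (analytic_nonzero_near_0 F HF ltac:(now exists w)) as (d & Hd & Hne).
  destruct (H d Hd) as (v & Hv & E'). exact (Hne v Hv E').
Qed.

Lemma analytic_integral_domain F G : analytic F -> analytic G ->
  (forall w, (0 < Cmod w < 1)%R -> F w * G w = 0) ->
  (forall w, (Cmod w < 1)%R -> F w = 0) \/ (forall w, (Cmod w < 1)%R -> G w = 0).
Proof.
  intros HF HG H.
  destruct (classic (exists w, (Cmod w < 1)%R /\ F w <> 0)) as [E|E].
  - right. destruct (analytic_nonzero_near_0 F HF E) as (d & Hd & Hne).
    apply analytic_zero_of_accumulation; [exact HG|]. intros d' Hd'.
    set (x := (Rmin d d' / 2)%R).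
    assert (Hx : (0 < x < d /\ x < d')%R).
    { unfold x. pose proof (Rmin_l d d'). pose proof (Rmin_r d d').
      assert (0 < Rmin d d')%R by (apply Rmin_pos; lra). lra. }
    assert (Hm : Cmod (RtoC x) = x) by (rewrite Cmod_R, Rabs_pos_eq; lra).
    exists (RtoC x). rewrite Hm. split; [lra|].
    assert (F (RtoC x) <> 0) by (apply Hne; rewrite Hm; lra).
    specialize (H (RtoC x) ltac:(rewrite Hm; lra)).
    apply NNPP. intros E2. revert H. now apply Cmult_neq_0.
  - left. intros w Hw. apply NNPP. intros E2. apply E. now exists w.
Qed.

(** * The complex exponential *)

Lemma Cexp_add z w : Cexp (z + w) = Cexp z * Cexp w.
Proof.
  destruct z as [a b], w as [c d]. unfold Cexp, Cmult, Cplus, RtoC; simpl.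
  rewrite exp_plus, cos_plus, sin_plus. f_equal; ring.
Qed.

Lemma Cexp_0 : Cexp 0 = 1.
Proof.
  unfold Cexp, Cmult, RtoC; simpl. rewrite exp_0, cos_0, sin_0. f_equal; ring.
Qed.

Lemma Cmod_Cexp z : Cmod (Cexp z) = exp (Re z).
Proof.
  unfold Cexp. rewrite Cmod_mult, Cmod_R. change (cos (Im z), sin (Im z)) with (cis (Im z)).
  rewrite Cmod_cis, Rabs_pos_eq by (left; apply exp_pos). ring.
Qed.

Lemma Cmod_le_Re_Im z : (Cmod z <= Rabs (Re z) + Rabs (Im z))%R.
Proof.
  replace z with (RtoC (Re z) + Ci * RtoC (Im z)) at 1.
  - eapply Rle_trans; [apply Cmod_triangle|]. rewrite Cmod_mult, !Cmod_R, Cmod_Ci. lra.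
  - destruct z as [a b]. unfold Ci, RtoC, Cplus, Cmult; simpl. f_equal; ring.
Qed.

(** The real part of [w * Cexp (t * z)]. *)
Definition exp_wave (w z : C) (t : R) : R :=
  (exp (t * Re z) * (Re w * cos (t * Im z) - Im w * sin (t * Im z)))%R.

Lemma exp_wave_1 w z : exp_wave w z 1 = Re (w * Cexp z).
Proof.
  destruct w as [a b], z as [x y]. unfold exp_wave, Cexp, Cmult, RtoC; simpl.
  rewrite !Rmult_1_l. ring.
Qed.

Lemma Derive_n_exp_wave n w z t : is_derive_n (exp_wave w z) n t (exp_wave (w * z ^ n) z t).
Proof.
  revert t. induction n as [|n IH]; intros t; simpl.
  - f_equal. ring.
  - apply (is_derive_ext (exp_wave (w * z ^ n) z)).
    + intros s. symmetry. apply is_derive_n_unique, IH.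
    + replace (w * (z * z ^ n)) with (w * z ^ n * z) by ring.
      generalize (w * z ^ n). intros v. unfold exp_wave. auto_derive; [exact I|].
      destruct v as [a b], z as [x y].
      unfold Cmult; simpl. ring.
Qed.

(** Real variable Taylor expansion along the segment from [0] to [z]; the factor
    [w] makes the estimate cover real and imaginary parts alike. *)
Lemma Cexp_taylor w z n :
  (Rabs (Re (w * (Cexp z - csum (S n) (fun j => / INR (fact j) * z ^ j))%C)) <=
   2 * Cmod w * exp (Cmod z) * (Cmod z ^ S n / INR (fact (S n))))%R.
Proof.
  destruct (Taylor_Lagrange (exp_wave w z) n 0 1 Rlt_0_1) as (t & Ht & E).
  { intros t _ k _. destruct k as [|k]; [exact I|].
    exists (exp_wave (w * z ^ S k) z t). exact (Derive_n_exp_wave (S k) w z t). }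
  rewrite exp_wave_1 in E.
  rewrite (is_derive_n_unique _ _ _ _ (Derive_n_exp_wave (S n) w z t)) in E.
  assert (Hs : sum_f_R0 (fun m => ((1 - 0) ^ m / INR (fact m) * Derive_n (exp_wave w z) m 0)%R) n
    = Re (w * csum (S n) (fun j => / INR (fact j) * z ^ j))).
  { clear E. assert (T : forall m, ((1 - 0) ^ m / INR (fact m) * Derive_n (exp_wave w z) m 0)%R
       = Re (w * (/ INR (fact m) * z ^ m))).
    { intros m. rewrite (is_derive_n_unique _ _ _ _ (Derive_n_exp_wave m w z 0)).
      rewrite <- RtoC_inv by apply INR_fact_neq_0. replace (w * (RtoC (/ INR (fact m)) * z ^ m)) with (RtoC (/ INR (fact m)) * (w * z ^ m)) by ring.
      unfold exp_wave. rewrite !Rmult_0_l, exp_0, cos_0, sin_0.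
      replace (1 - 0)%R with 1%R by ring. rewrite pow1.
      destruct (w * z ^ m) as [a b]. unfold Cmult, RtoC; simpl. unfold Rdiv. ring. }
    induction n as [|n IH].
    - cbn [sum_f_R0]. rewrite T. cbn [csum]. f_equal. rewrite Cplus_0_l. reflexivity.
    - cbn [sum_f_R0]. rewrite IH, T. cbn [csum].
      rewrite !Cmult_plus_distr_l. reflexivity. }
  rewrite Hs in E.
  set (S0 := csum (S n) (fun j => / INR (fact j) * z ^ j)) in *.
  replace (Re (w * (Cexp z - S0))) with (Re (w * Cexp z) - Re (w * S0))%R
    by (destruct w, (Cexp z), S0; simpl; ring).
  rewrite E. match goal with |- (Rabs (?a + ?b - ?a) <= _)%R => replace (a + b - a)%R with b by ring end.
  replace (1 - 0)%R with 1%R by ring. rewrite pow1.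
  assert (Hf : (0 < INR (fact (S n)))%R) by apply INR_fact_lt_0.
  rewrite Rabs_mult, Rabs_pos_eq by (apply Rlt_le, Rdiv_lt_0_compat; lra).
  replace (2 * Cmod w * exp (Cmod z) * (Cmod z ^ S n / INR (fact (S n))))%R
    with (1 / INR (fact (S n)) * (exp (Cmod z) * (2 * (Cmod w * Cmod z ^ S n))))%R by (field; lra).
  apply Rmult_le_compat_l; [apply Rlt_le, Rdiv_lt_0_compat; lra|].
  rewrite <- Cmod_pow, <- Cmod_mult.
  set (v := w * z ^ S n). unfold exp_wave. rewrite Rabs_mult, (Rabs_pos_eq (exp _)) by (left; apply exp_pos).
  apply Rmult_le_compat; [left; apply exp_pos|apply Rabs_pos| |].
  - pose proof (re_le_Cmod z) as H1. pose proof (Rle_abs (Re z)). pose proof (Cmod_ge_0 z).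
    destruct (Rle_lt_or_eq_dec (t * Re z) (Cmod z)) as [H2|H2]; [nra| |rewrite H2; lra].
    left. now apply exp_increasing.
  - pose proof (re_le_Cmod v) as H1.
    assert (H2 : (Rabs (Im v) <= Cmod v)%R) by (eapply Rle_trans; [|apply Rmax_Cmod]; apply Rmax_r).
    pose proof (COS_bound (t * Im z)). pose proof (SIN_bound (t * Im z)).
    unfold Rminus. eapply Rle_trans; [apply Rabs_triang|]. rewrite Rabs_Ropp, !Rabs_mult.
    assert (Rabs (cos (t * Im z)) <= 1)%R by (apply Rabs_le; lra).
    assert (Rabs (sin (t * Im z)) <= 1)%R by (apply Rabs_le; lra).
    pose proof (Rabs_pos (Re v)). pose proof (Rabs_pos (Im v)).
    pose proof (Rabs_pos (cos (t * Im z))). pose proof (Rabs_pos (sin (t * Im z))). nra.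
Qed.

Lemma is_Cseries_exp z : is_Cseries (fun j => / INR (fact j) * z ^ j) (Cexp z).
Proof.
  apply is_Cseries_eps. intros eps He.
  set (K := (4 * exp (Cmod z))%R). assert (HK : (0 < K)%R) by (unfold K; pose proof (exp_pos (Cmod z)); lra).
  destruct (cv_speed_pow_fact (Cmod z) (eps / K)%R ltac:(apply Rdiv_lt_0_compat; lra)) as [N HN].
  exists (S N). intros [|n] Hn; [lia|]. specialize (HN (S n) ltac:(lia)).
  unfold Rdist in HN. rewrite Rminus_0_r, Rabs_pos_eq in HN.
  2:{ apply Rmult_le_pos; [apply pow_le, Cmod_ge_0|left; apply Rinv_0_lt_compat, INR_fact_lt_0]. }
  apply Rlt_div_r in HN; [|exact HK].
  set (S0 := csum (S n) (fun j => / INR (fact j) * z ^ j)).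
  rewrite <- Cmod_opp. replace (- (S0 - Cexp z)) with (Cexp z - S0) by ring.
  eapply Rle_lt_trans; [apply Cmod_le_Re_Im|].
  pose proof (Cexp_taylor 1 z n) as H1. pose proof (Cexp_taylor (- Ci) z n) as H2. fold S0 in H1, H2.
  rewrite Cmod_1 in H1. rewrite Cmod_opp, Cmod_Ci in H2.
  replace (Re (1 * (Cexp z - S0))) with (Re (Cexp z - S0)) in H1
    by (destruct (Cexp z - S0); simpl; ring).
  replace (Re (- Ci * (Cexp z - S0))) with (Im (Cexp z - S0)) in H2
    by (destruct (Cexp z - S0); simpl; ring).
  unfold K in HN. lra.
Qed.

Lemma analytic_Cexp p : analytic p -> analytic (fun w => Cexp (p w)).
Proof.
  intros Hp. apply (analytic_series (fun j w => / INR (fact j) * p w ^ j)).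
  - intros j. now apply analytic_scal, analytic_pow.
  - intros r Hr. destruct (analytic_uniform_bound p r Hp ltac:(lra)) as [B HB].
    exists (fun j => / INR (fact j) * B ^ j)%R. split.
    + exists (exp B). apply is_pseries_R, is_exp_Reals.
    + intros j w Hw. assert (0 < INR (fact j))%R by apply INR_fact_lt_0.
      assert (0 < / INR (fact j))%R by now apply Rinv_0_lt_compat.
      rewrite Cmod_mult, <- RtoC_inv, Cmod_R, Cmod_pow, Rabs_pos_eq by lra.
      apply Rmult_le_compat_l; [lra|]. apply pow_incr. split; [apply Cmod_ge_0|now apply HB].
  - intros w _. apply is_Cseries_exp.
Qed.

Lemma e2pi_add z w : e2pi (z + w) = e2pi z * e2pi w.
Proof. unfold e2pi. rewrite <- Cexp_add. f_equal. ring. Qed.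

Lemma e2pi_0 : e2pi 0 = 1.
Proof. unfold e2pi. rewrite Cmult_0_r. apply Cexp_0. Qed.

Lemma Cmod_e2pi z : Cmod (e2pi z) = exp (- (2 * PI * Im z)).
Proof.
  unfold e2pi. rewrite Cmod_Cexp. f_equal. destruct z as [x y]. simpl. ring.
Qed.

Lemma e2pi_neq_0 z : e2pi z <> 0.
Proof. apply Cmod_gt_0. rewrite Cmod_e2pi. apply exp_pos. Qed.

Lemma e2pi_R x : e2pi (RtoC x) = cis (2 * PI * x).
Proof.
  unfold e2pi. replace (RtoC (2 * PI) * Ci * RtoC x) with ((0, 2 * PI * x)%R : C)
    by (unfold Ci, RtoC, Cmult; simpl; f_equal; ring).
  unfold Cexp. simpl Re. simpl Im. rewrite exp_0. fold (cis (2 * PI * x)). ring.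
Qed.

Lemma e2pi_pow z n : e2pi z ^ n = e2pi (RtoC (INR n) * z).
Proof.
  induction n as [|n IH]; [simpl; rewrite Cmult_0_l; symmetry; apply e2pi_0|].
  rewrite Cpow_S, IH, <- e2pi_add, S_INR, RtoC_plus. f_equal. ring.
Qed.

Lemma e2pi_Z p : e2pi (ZtoC p) = 1.
Proof. unfold ZtoC. rewrite e2pi_R. apply cis_period. Qed.

Lemma e2pi_add_Z z p : e2pi (z + ZtoC p) = e2pi z.
Proof. rewrite e2pi_add, e2pi_Z. ring. Qed.

Lemma Cmod_e2pi_lt_1 z : upper_half_plane z -> (0 < Cmod (e2pi z) < 1)%R.
Proof.
  intros H. rewrite Cmod_e2pi. split; [apply exp_pos|]. rewrite <- exp_0.
  apply exp_increasing. unfold upper_half_plane in H. pose proof PI_RGT_0. nra.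
Qed.

(** * The theta function as a power series in q *)

Definition theta_coef (n : nat) : C := match n with O => 1 | S _ => RtoC 2 end.

Definition theta_q (w : C) : C := CSeries (fun n => theta_coef n * w ^ (n * n)).

Lemma theta_q_terms w n : (Cmod w < 1)%R -> (Cmod (theta_coef n * w ^ (n * n)) <= 2 * Cmod w ^ n)%R.
Proof.
  intros Hw. pose proof (Cmod_ge_0 w).
  rewrite Cmod_mult, Cmod_pow.
  assert (Hc : (Cmod (theta_coef n) <= 2)%R).
  { destruct n; simpl; [rewrite Cmod_1; lra|]. rewrite Cmod_R, Rabs_pos_eq; lra. }
  assert (Hp : (Cmod w ^ (n * n) <= Cmod w ^ n)%R).
  { destruct n as [|n]; [simpl; lra|]. replace (S n * S n)%nat with (S n + n * S n)%nat by lia.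
    rewrite pow_add. assert (0 <= Cmod w ^ S n)%R by (apply pow_le; lra).
    assert (Cmod w ^ (n * S n) <= 1)%R by (rewrite <- (pow1 (n * S n)); apply pow_incr; lra). nra. }
  assert (0 <= Cmod w ^ (n * n))%R by (apply pow_le; lra).
  pose proof (Cmod_ge_0 (theta_coef n)).
  apply Rmult_le_compat; assumption.
Qed.

Lemma is_Cseries_theta_q w : (Cmod w < 1)%R ->
  is_Cseries (fun n => theta_coef n * w ^ (n * n)) (theta_q w).
Proof.
  intros Hw. destruct (ex_Cseries_dom (fun n => theta_coef n * w ^ (n * n)) (fun n => 2 * Cmod w ^ n)%R) as [s Hs].
  - intros n. now apply theta_q_terms.
  - apply ex_series_geom_scal. pose proof (Cmod_ge_0 w). lra.
  - unfold theta_q. rewrite (is_Cseries_CSeries _ _ Hs). exact Hs.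
Qed.

Lemma analytic_theta_q : analytic theta_q.
Proof.
  apply (analytic_series (fun n w => theta_coef n * w ^ (n * n))).
  - intros n. apply analytic_monomial.
  - intros r Hr. exists (fun n => 2 * r ^ n)%R. split; [apply ex_series_geom_scal; lra|].
    intros n w Hw. eapply Rle_trans; [apply theta_q_terms; lra|].
    apply Rmult_le_compat_l; [lra|]. apply pow_incr. split; [apply Cmod_ge_0|exact Hw].
  - apply is_Cseries_theta_q.
Qed.

Lemma theta_eq z : upper_half_plane z -> theta z = theta_q (e2pi z).
Proof.
  intros Hz. set (q := e2pi z). assert (Hq : (0 < Cmod q < 1)%R) by now apply Cmod_e2pi_lt_1.
  assert (T : forall p : Z, e2pi (ZtoC (p * p) * z) = q ^ (Z.abs_nat p * Z.abs_nat p)).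
  { intros p. unfold q. rewrite e2pi_pow. unfold ZtoC. do 3 f_equal.
    rewrite INR_IZR_INZ, Nat2Z.inj_mul, Zabs2Nat.id_abs. f_equal. lia. }
  assert (Hb : forall n, (Cmod (q ^ (n * n)) <= 2 * Cmod q ^ n)%R).
  { intros n. eapply Rle_trans; [|apply (theta_q_terms q n); lra].
    rewrite Cmod_mult. pose proof (Cmod_ge_0 (q ^ (n * n))).
    assert (1 <= Cmod (theta_coef n))%R; [|nra].
    destruct n; simpl; [rewrite Cmod_1; lra|]. rewrite Cmod_R, Rabs_pos_eq; lra. }
  destruct (ex_Cseries_dom (fun n => q ^ (n * n)) _ Hb ltac:(apply ex_series_geom_scal; lra)) as [A HA].
  assert (HA' := proj1 (is_Cseries_tail 1 _ _) HA).
  assert (HA1 : is_Cseries (fun n => q ^ (S n * S n)) (A - 1)).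
  { eapply is_Cseries_ext; [|replace (A - 1) with (A - csum 1 (fun n => q ^ (n * n))) by (simpl; ring); exact HA'].
    reflexivity. }
  unfold theta, CSeriesZ.
  rewrite (is_Cseries_CSeries _ A).
  2:{ eapply is_Cseries_ext; [|exact HA]. intros n. simpl. rewrite T, Zabs2Nat.id. reflexivity. }
  rewrite (is_Cseries_CSeries _ (A - 1)).
  2:{ eapply is_Cseries_ext; [|exact HA1]. intros n. cbv beta. rewrite T.
      replace (Z.abs_nat (- Z.of_nat (S n))) with (S n) by lia. reflexivity. }
  apply (is_Cseries_unique (fun n => theta_coef n * q ^ (n * n))); [|apply is_Cseries_theta_q; lra].
  apply (is_Cseries_tail 1).
  replace (A + (A - 1) - csum 1 (fun n => theta_coef n * q ^ (n * n))) with (2 * (A - 1)) by (simpl; ring).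
  eapply is_Cseries_ext; [|apply is_Cseries_scal, HA1]. intros n. reflexivity.
Qed.

Lemma theta_q_near_1 w : (Cmod w < 1)%R ->
  (Cmod (theta_q w - 1) <= 2 * Cmod w / (1 - Cmod w))%R.
Proof.
  intros Hw. pose proof (Cmod_ge_0 w).
  assert (Ht := proj1 (is_Cseries_tail 1 _ _) (is_Cseries_theta_q w Hw)).
  replace (theta_q w - 1) with (theta_q w - csum 1 (fun n => theta_coef n * w ^ (n * n))) by (simpl; ring).
  eapply Rle_trans; [apply (is_Cseries_dom _ (fun n => (2 * Cmod w) * Cmod w ^ n)%R _ Ht)|].
  - intros n. eapply Rle_trans; [apply (theta_q_terms w (1 + n)); exact Hw|]. right. simpl. ring.
  - apply ex_series_geom_scal; lra.
  - rewrite Series_geom_scal by lra. lra.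
Qed.

(** * Functions on the upper half-plane in the disc coordinate *)

(** The uniform lower bound on the height makes the theta series converge
    uniformly along [tau] on smaller discs. *)
Definition analytic_to_H (tau : C -> C) : Prop :=
  analytic tau /\
  forall r, (0 < r < 1)%R -> exists d, (0 < d)%R /\
    forall w, (Cmod w <= r)%R -> (d <= Im (tau w))%R.

Lemma analytic_to_H_H tau w : analytic_to_H tau -> (Cmod w < 1)%R -> upper_half_plane (tau w).
Proof.
  intros [_ H] Hw. pose proof (Cmod_ge_0 w).
  destruct (H ((1 + Cmod w) / 2)%R ltac:(lra)) as (d & Hd & Hb).
  unfold upper_half_plane. specialize (Hb w ltac:(lra)). lra.
Qed.

Lemma analytic_theta tau : analytic_to_H tau -> analytic (fun w => theta (tau w)).
Proof.
  intros Ht. destruct (Ht) as [Ha Hb].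
  apply (analytic_ext (fun w => theta_q (e2pi (tau w)))).
  - intros w Hw. symmetry. apply theta_eq. now apply analytic_to_H_H.
  - apply (analytic_comp theta_q (fun w => e2pi (tau w))); [exact analytic_theta_q| |].
    + unfold e2pi. apply analytic_Cexp. now apply analytic_scal.
    + intros r Hr. destruct (Hb r Hr) as (d & Hd & Hd').
      exists (exp (- (2 * PI * d))). pose proof PI_RGT_0. split.
      * split; [left; apply exp_pos|]. rewrite <- exp_0. apply exp_increasing. nra.
      * intros w Hw. rewrite Cmod_e2pi. specialize (Hd' w Hw).
        destruct (Rle_lt_or_eq_dec _ _ Hd') as [H1|H1]; [|rewrite H1; lra].
        left. apply exp_increasing. nra.
Qed.

Definition cayley (w : C) : C := Ci * (1 + w) / (1 - w).

Lemma one_minus_neq_0 w : (Cmod w < 1)%R -> 1 - w <> 0.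
Proof.
  intros H E. assert (w = 1) as E1 by (replace w with (1 - (1 - w)) by ring; rewrite E; ring).
  rewrite E1, Cmod_1 in H. lra.
Qed.

Lemma Cmod_sqr z : (Cmod z ^ 2 = Re z ^ 2 + Im z ^ 2)%R.
Proof. apply Cmod2_alt. Qed.

Lemma cayley_Im w : (Cmod w < 1)%R ->
  (Im (cayley w) = (1 - Cmod w ^ 2) / Cmod (1 - w) ^ 2)%R.
Proof.
  intros H. pose proof (one_minus_neq_0 w H) as Hne.
  assert (H1 : (Cmod (1 - w) ^ 2 <> 0)%R).
  { apply pow_nonzero. intros E. apply Hne. now apply Cmod_eq_0. }
  rewrite !Cmod_sqr in *. destruct w as [a b]. unfold cayley, Cdiv, Cinv, Cmult, Cplus, Cminus, Copp, Ci, RtoC in *; simpl in *.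
  field. intros E. apply H1. etransitivity; [|exact E]. ring.
Qed.

Lemma cayley_surj z : upper_half_plane z -> exists w, (Cmod w < 1)%R /\ cayley w = z.
Proof.
  intros Hz. unfold upper_half_plane in Hz.
  assert (Hne : z + Ci <> 0).
  { intros E. apply (f_equal Im) in E. destruct z as [a b]. simpl in *. lra. }
  assert (HCi : Ci <> 0) by (intros E; apply (f_equal Im) in E; simpl in E; lra).
  exists ((z - Ci) / (z + Ci)). split.
  - rewrite Cmod_div by exact Hne.
    assert (0 < Cmod (z + Ci))%R by now apply Cmod_gt_0.
    apply Rlt_div_l; [lra|]. rewrite Rmult_1_l.
    apply Rsqr_incrst_0; [|apply Cmod_ge_0|lra].
    rewrite !Rsqr_pow2, !Cmod_sqr. destruct z as [a b]. simpl in *. nra.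
  - assert (H2 : z + Ci - (z - Ci) <> 0).
    { replace (z + Ci - (z - Ci)) with (2 * Ci) by ring. intros E.
      apply (f_equal Im) in E. simpl in E. lra. }
    unfold cayley. field_simplify_eq; [ring|split; assumption].
Qed.

(** * Polya's finite form of the theta inversion *)

Local Open Scope R_scope.

Lemma rsum_ext n (u v : nat -> R) :
  (forall i, (i < n)%nat -> u i = v i) -> rsum n u = rsum n v.
Proof.
  induction n as [|n IH]; intros H; simpl; [reflexivity|].
  rewrite IH by (intros; apply H; lia). rewrite H by lia. reflexivity.
Qed.

Lemma rsum_plus n (u v : nat -> R) : rsum n (fun i => u i + v i) = rsum n u + rsum n v.
Proof. induction n as [|n IH]; simpl; [|rewrite IH]; ring. Qed.

Lemma rsum_scal n c (u : nat -> R) : rsum n (fun i => c * u i) = c * rsum n u.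
Proof. induction n as [|n IH]; simpl; [|rewrite IH]; ring. Qed.

Lemma rsum_swap n m (u : nat -> nat -> R) :
  rsum n (fun i => rsum m (u i)) = rsum m (fun j => rsum n (fun i => u i j)).
Proof.
  induction n as [|n IH]; simpl.
  - induction m as [|m IHm]; simpl; [reflexivity|rewrite <- IHm; ring].
  - rewrite IH, rsum_plus. reflexivity.
Qed.

Lemma rsum_zero n (u : nat -> R) : (forall i, (i < n)%nat -> u i = 0) -> rsum n u = 0.
Proof. intros H. rewrite (rsum_ext n u (fun _ => 0)) by exact H. rewrite rsum_const. ring. Qed.

Lemma rsum_split n m (u : nat -> R) :
  rsum (n + m) u = rsum n u + rsum m (fun i => u (n + i)%nat).
Proof.
  induction m as [|m IH]; simpl.
  - rewrite Nat.add_0_r. ring.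
  - rewrite Nat.add_succ_r. simpl. rewrite IH. ring.
Qed.

Lemma rsum_rev n (u : nat -> R) : rsum n (fun i => u (n - 1 - i)%nat) = rsum n u.
Proof.
  induction n as [|n IH]; [reflexivity|].
  change (rsum (S n) u) with (rsum n u + u n).
  rewrite (rsum_split 1 n), <- IH. cbn [rsum].
  rewrite (rsum_ext n (fun i => u (S n - 1 - (1 + i))%nat) (fun i => u (n - 1 - i)%nat)) by (intros; f_equal; lia).
  replace (S n - 1 - 0)%nat with n by lia. ring.
Qed.

Lemma rsum_multiples L n (g : nat -> R) : (0 < L)%nat ->
  rsum (L * n) (fun k => if (k mod L =? 0)%nat then g k else 0) = rsum n (fun v => g (v * L)%nat).
Proof.
  intros HL. induction n as [|n IH]; [rewrite Nat.mul_0_r; reflexivity|].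
  rewrite Nat.mul_succ_r, rsum_split, IH. cbn [rsum]. f_equal.
  destruct L as [|L]; [lia|].
  rewrite (rsum_split 1 L). cbn [rsum].
  rewrite rsum_zero.
  - replace (S L * n + 0)%nat with (n * S L)%nat by lia.
    rewrite Nat.Div0.mod_mul. cbn [Nat.eqb]. ring.
  - intros i Hi. replace (S L * n + (1 + i))%nat with ((1 + i) + n * S L)%nat by lia.
    rewrite Nat.Div0.mod_add, Nat.mod_small by lia. reflexivity.
Qed.

(** Weights that fold a sum of an even function over the integers. *)
Definition two_sided (n : nat) : R := match n with O => 1 | S _ => 2 end.

(** [walk m k] is [binomial (2 m) (m + k) / 4 ^ m], the distribution of a
    symmetric random walk, given by its recurrence. *)
Fixpoint walk (m k : nat) : R :=
  match m with
  | O => match k with O => 1 | S _ => 0 end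
  | S m' => match k with
            | O => (2 * walk m' 0 + 2 * walk m' 1) / 4
            | S k' => (walk m' k' + 2 * walk m' k + walk m' (S k)) / 4
            end
  end.

Lemma walk_0 m k : (m < k)%nat -> walk m k = 0.
Proof.
  revert k. induction m as [|m IH]; intros [|k] H; simpl; try lia; [reflexivity|].
  rewrite !IH by lia. field.
Qed.

Lemma walk_ratio m k : (INR m + INR k + 1) * walk m (S k) = (INR m - INR k) * walk m k.
Proof.
  revert k. induction m as [|m IH]; intros k.
  - destruct k; simpl; ring.
  - destruct k as [|k].
    + cbn [walk]. pose proof (IH 0%nat) as H0. pose proof (IH 1%nat) as H1.
      rewrite S_INR. simpl INR in *. lra.
    + cbn [walk]. pose proof (IH k) as H0. pose proof (IH (S k)) as H1. pose proof (IH (S (S k))) as H2.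
      rewrite !S_INR in *. lra.
Qed.

Lemma walk_pos m : 0 < walk m 0.
Proof.
  induction m as [|m IH]; [simpl; lra|].
  cbn [walk]. pose proof (walk_ratio m 0) as H. simpl INR in H. pose proof (pos_INR m).
  assert (0 <= walk m 1); [|lra].
  apply (Rmult_le_reg_l (INR m + 0 + 1)); nra.
Qed.

Lemma walk_S_0 m : walk (S m) 0 = walk m 0 * ((2 * INR m + 1) / (2 * INR m + 2)).
Proof.
  cbn [walk]. pose proof (walk_ratio m 0) as H. simpl INR in H. pose proof (pos_INR m).
  assert (E : walk m 1 = INR m / (INR m + 1) * walk m 0).
  { apply (Rmult_eq_reg_l (INR m + 0 + 1)); [rewrite H; field|]; lra. }
  rewrite E. field. lra.
Qed.

Lemma cos_even_power m x K : (m < K)%nat ->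
  cos x ^ (2 * m) = rsum K (fun k => two_sided k * walk m k * cos (2 * INR k * x)).
Proof.
  revert K. induction m as [|m IH]; intros K HK.
  - destruct K as [|K]; [lia|]. replace (S K) with (1 + K)%nat by lia. rewrite rsum_split.
    rewrite (rsum_zero K) by (intros; simpl; ring). simpl.
    rewrite Rmult_0_r, Rmult_0_l, cos_0. ring.
  - assert (Hc : forall k, cos x ^ 2 * cos (2 * INR (S k) * x)
      = (cos (2 * INR k * x) + 2 * cos (2 * INR (S k) * x) + cos (2 * INR (S (S k)) * x)) / 4).
    { intros k. rewrite !S_INR.
      replace (2 * INR k * x) with (2 * (INR k + 1) * x - 2 * x) by ring.
      replace (2 * (INR k + 1 + 1) * x) with (2 * (INR k + 1) * x + 2 * x) by ring.
      rewrite cos_minus, cos_plus, (cos_2a_cos x). field. }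
    assert (Hc0 : cos x ^ 2 * cos (2 * INR 0 * x) = (2 + 2 * cos (2 * INR 1 * x)) / 4).
    { simpl INR. replace (2 * 0 * x) with 0 by ring. rewrite cos_0.
      replace (2 * 1 * x) with (2 * x) by ring. rewrite cos_2a_cos. field. }
    (* Abel rearrangement: the two boundary terms vanish beyond the support of [walk m]. *)
    assert (G : forall n, rsum (S n) (fun k => two_sided k * walk (S m) k * cos (2 * INR k * x))
      - rsum (S n) (fun k => cos x ^ 2 * (two_sided k * walk m k * cos (2 * INR k * x)))
      = (walk m (S n) * cos (2 * INR n * x) - walk m n * cos (2 * INR (S n) * x)) / 2).
    { induction n as [|n IHn].
      - pose proof Hc0 as H0. cbn [rsum two_sided walk].
        replace (cos x ^ 2 * (1 * walk m 0 * cos (2 * INR 0 * x)))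
          with (walk m 0 * (cos x ^ 2 * cos (2 * INR 0 * x))) by ring.
        rewrite H0. replace (2 * INR 0 * x) with 0 by (simpl; ring). rewrite cos_0. field.
      - set (u := fun k => two_sided k * walk (S m) k * cos (2 * INR k * x)) in *.
        set (v := fun k => cos x ^ 2 * (two_sided k * walk m k * cos (2 * INR k * x))) in *.
        change (rsum (S (S n)) u) with (rsum (S n) u + u (S n)).
        change (rsum (S (S n)) v) with (rsum (S n) v + v (S n)).
        replace (rsum (S n) u + u (S n) - (rsum (S n) v + v (S n)))
          with (rsum (S n) u - rsum (S n) v + (u (S n) - v (S n))) by ring.
        rewrite IHn. unfold u, v. cbn [two_sided walk].
        replace (cos x ^ 2 * (2 * walk m (S n) * cos (2 * INR (S n) * x)))
          with (2 * walk m (S n) * (cos x ^ 2 * cos (2 * INR (S n) * x))) by ring.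
        rewrite Hc. field. }
    replace (2 * S m)%nat with (2 + 2 * m)%nat by lia.
    rewrite pow_add, (IH K), <- rsum_scal by lia. destruct K as [|n]; [lia|].
    specialize (G n). rewrite (walk_0 m n), (walk_0 m (S n)) in G by lia. lra.
Qed.

Lemma rsum_cos_multiples L k : (0 < L)%nat ->
  rsum L (fun j => cos (2 * INR k * (PI * INR j / INR L))) = if (k mod L =? 0)%nat then INR L else 0.
Proof.
  intros HL. assert (HL' : 0 < INR L) by (now apply lt_0_INR).
  set (x := cis (2 * PI * (INR k / INR L))).
  assert (E : rsum L (fun j => cos (2 * INR k * (PI * INR j / INR L))) = Re (csum L (fun j => Cpow x j))).
  { assert (G : forall n, rsum n (fun j => cos (2 * INR k * (PI * INR j / INR L))) = Re (csum n (fun j => Cpow x j))).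
    { induction n as [|n IH]; [reflexivity|]. cbn [rsum csum]. rewrite IH. unfold x at 3. rewrite cis_pow.
      simpl. f_equal. f_equal. field. lra. }
    apply G. }
  rewrite E. destruct (Nat.eqb_spec (k mod L) 0) as [H|H].
  - assert (Hx : x = RtoC 1).
    { unfold x. pose proof (Nat.div_mod_eq k L) as D. rewrite H, Nat.add_0_r in D.
      rewrite D at 1. rewrite mult_INR.
      replace (2 * PI * (INR L * INR (k / L) / INR L)) with (2 * PI * IZR (Z.of_nat (k / L)));
        [apply cis_period|]. rewrite <- INR_IZR_INZ. field. lra. }
    rewrite Hx. rewrite (csum_ext L _ (fun _ => RtoC 1)) by (intros; apply Cpow_1_l).
    rewrite csum_const. simpl. ring.
  - rewrite csum_root_of_unity; [reflexivity| |].
    + unfold x. rewrite cis_pow. replace (INR L * (2 * PI * (INR k / INR L))) with (2 * PI * IZR (Z.of_nat k)).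
      * apply cis_period.
      * rewrite <- INR_IZR_INZ. field. lra.
    + unfold x. pose proof (Nat.div_mod_eq k L) as D.
      replace (2 * PI * (INR k / INR L)) with (2 * PI * IZR (Z.of_nat (k / L)) + 2 * PI * (INR (k mod L) / INR L)).
      2:{ rewrite <- INR_IZR_INZ. rewrite D at 3. rewrite plus_INR, mult_INR. field. lra. }
      rewrite cis_add, cis_period, Cmult_1_l. apply cis_neq_1.
      assert (0 < INR (k mod L)) by (apply lt_0_INR; lia).
      assert (INR (k mod L) < INR L) by (apply lt_INR, Nat.mod_upper_bound; lia).
      pose proof PI_RGT_0. assert (0 < INR (k mod L) / INR L < 1).
      { split; [now apply Rdiv_lt_0_compat|]. apply Rlt_div_l; lra. }
      rewrite Rabs_pos_eq; nra.
Qed.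

(** Expanding the even power of the cosine and summing over a full period
    leaves only the frequencies divisible by [L]. *)
Lemma polya_identity L m : (0 < L)%nat ->
  rsum L (fun j => cos (PI * INR j / INR L) ^ (2 * m)) =
  INR L * rsum (S m) (fun v => two_sided v * walk m (v * L)).
Proof.
  intros HL.
  rewrite (rsum_ext L _ (fun j => rsum (L * S m) (fun k => two_sided k * walk m k *
     cos (2 * INR k * (PI * INR j / INR L))))) by (intros; apply cos_even_power; nia).
  rewrite rsum_swap.
  rewrite (rsum_ext (L * S m) _ (fun k => if (k mod L =? 0)%nat then INR L * (two_sided k * walk m k) else 0)).
  - rewrite rsum_multiples by exact HL. rewrite <- rsum_scal. apply rsum_ext. intros v _.
    destruct v; [reflexivity|]. destruct (S v * L)%nat eqn:E; [lia|reflexivity].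
  - intros k _. rewrite rsum_scal, rsum_cos_multiples by exact HL.
    destruct (k mod L =? 0)%nat; ring.
Qed.

Lemma polya_left p m :
  rsum (2 * p + 1) (fun j => cos (PI * INR j / INR (2 * p + 1)) ^ (2 * m)) =
  rsum (S p) (fun j => two_sided j * cos (PI * INR j / INR (2 * p + 1)) ^ (2 * m)).
Proof.
  set (L := (2 * p + 1)%nat). set (u := fun j => cos (PI * INR j / INR L) ^ (2 * m)).
  assert (HL : 0 < INR L) by (apply lt_0_INR; unfold L; lia).
  change (rsum L u = rsum (S p) (fun j => two_sided j * u j)).
  replace (rsum L u) with (rsum (1 + p + p) u) by (f_equal; unfold L; lia).
  rewrite (rsum_split (1 + p) p), (rsum_split 1 p u).
  rewrite <- (rsum_rev p (fun i => u (1 + p + i)%nat)).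
  rewrite (rsum_ext p (fun i => u (1 + p + (p - 1 - i))%nat) (fun i => u (1 + i)%nat)).
  - change (S p) with (1 + p)%nat. rewrite (rsum_split 1 p (fun j => two_sided j * u j)).
    rewrite (rsum_ext p (fun i => two_sided (1 + i) * u (1 + i)%nat) (fun i => 2 * u (1 + i)%nat)) by reflexivity.
    rewrite rsum_scal. cbn [rsum two_sided]. ring.
  - intros i Hi. unfold u. replace (PI * INR (1 + p + (p - 1 - i)) / INR L) with (- (PI * INR (1 + i) / INR L) + PI).
    + rewrite neg_cos, cos_neg, !pow_mult. f_equal. ring.
    + replace (1 + p + (p - 1 - i))%nat with (L - (1 + i))%nat by (unfold L; lia).
      rewrite (minus_INR L) by (unfold L; lia). field. lra.
Qed.

(** * The inversion formula on the imaginary axis *)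

Lemma is_lim_seq_rsum N (a : nat -> nat -> R) (b : nat -> R) :
  (forall n, (n < N)%nat -> is_lim_seq (fun i => a i n) (b n)) ->
  is_lim_seq (fun i => rsum N (a i)) (rsum N b).
Proof.
  induction N as [|N IH]; intros H; simpl; [apply is_lim_seq_const|].
  apply (is_lim_seq_plus' (fun i => rsum N (a i)) (fun i => a i N)).
  - apply IH. intros. apply H. lia.
  - apply H. lia.
Qed.

Lemma Series_abs_le (u M : nat -> R) :
  (forall n, Rabs (u n) <= M n) -> ex_series M -> Rabs (Series u) <= Series M.
Proof.
  intros H HM. assert (Hex : ex_series (fun n => Rabs (u n))).
  { apply (ex_series_dom _ M); [intros n; split; [apply Rabs_pos|apply H]|exact HM]. }
  eapply Rle_trans; [apply Series_Rabs, Hex|].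
  apply Series_le; [intros n; split; [apply Rabs_pos|apply H]|exact HM].
Qed.

Lemma Series_split (u : nat -> R) N : ex_series u ->
  Series u = rsum N u + Series (fun k => u (N + k)%nat).
Proof.
  intros H. destruct N as [|N]; [simpl rsum; rewrite Rplus_0_l; reflexivity|].
  rewrite (Series_incr_n u (S N)) by (lia || exact H). f_equal. simpl Init.Nat.pred.
  rewrite <- sum_n_Reals. apply sum_n_rsum.
Qed.

Lemma Series_tail_small (M : nat -> R) eps : ex_series M -> 0 < eps ->
  exists N, Rabs (Series (fun k => M (N + k)%nat)) < eps.
Proof.
  intros H He. pose proof (Series_correct _ H) as HS.
  destruct (proj1 (filterlim_locally_ball_norm _ _) HS (mkposreal eps He)) as [N HN].
  exists (S N). specialize (HN N (Nat.le_refl N)).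
  unfold ball_norm in HN. change (Rabs (sum_n M N - Series M) < eps) in HN.
  rewrite sum_n_rsum, (Series_split M (S N) H), <- Rabs_Ropp in HN.
  replace (- (rsum (S N) M - (rsum (S N) M + Series (fun k => M (S N + k)%nat))))
    with (Series (fun k => M (S N + k)%nat)) in HN by ring. exact HN.
Qed.

(** Finitely many terms converge separately, and the remaining ones are all
    within a small tail of [M]. *)
Lemma tannery (a : nat -> nat -> R) (b M : nat -> R) :
  ex_series M -> (forall i n, Rabs (a i n) <= M n) ->
  (forall n, is_lim_seq (fun i => a i n) (b n)) ->
  is_lim_seq (fun i => Series (a i)) (Series b).
Proof.
  intros HM Ha Hl.
  assert (Hb : forall n, Rabs (b n) <= M n).
  { intros n. apply (is_lim_seq_le (fun i => Rabs (a i n)) (fun _ => M n) (Rabs (b n)) (M n)).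
    - intros i. apply Ha.
    - apply (is_lim_seq_abs _ (b n)), Hl.
    - apply is_lim_seq_const. }
  assert (Hex : forall u : nat -> R, (forall n, Rabs (u n) <= M n) -> ex_series u).
  { intros u Hu. apply ex_series_Rabs, (ex_series_dom _ M); [|exact HM].
    intros n; split; [apply Rabs_pos|apply Hu]. }
  apply is_lim_seq_spec. intros [eps He]. simpl.
  destruct (Series_tail_small M (eps / 4) HM ltac:(lra)) as [N HN].
  assert (HexN : ex_series (fun k => M (N + k)%nat)) by now apply (ex_series_incr_n M N).
  assert (Hf := is_lim_seq_rsum N a b (fun n _ => Hl n)).
  apply is_lim_seq_spec in Hf. destruct (Hf (mkposreal (eps / 2) ltac:(lra))) as [I HI].
  exists I. intros i Hi. specialize (HI i Hi). simpl in HI.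
  rewrite (Series_split (a i) N), (Series_split b N) by (apply Hex; auto).
  assert (H1 := Series_abs_le (fun k => a i (N + k)%nat) _ (fun k => Ha i (N + k)%nat) HexN).
  assert (H2 := Series_abs_le (fun k => b (N + k)%nat) _ (fun k => Hb (N + k)%nat) HexN).
  pose proof (Rle_abs (Series (fun k => M (N + k)%nat))).
  apply Rabs_def2 in HI. apply Rabs_le_between in H1, H2. apply Rabs_def1; lra.
Qed.

Lemma Series_finite (u : nat -> R) N : (forall n, (N <= n)%nat -> u n = 0) -> Series u = rsum N u.
Proof.
  intros H. apply is_series_unique. apply filterlim_locally_ball_norm. intros eps.
  exists N. intros n Hn. unfold ball_norm. change (Rabs (sum_n u n - rsum N u) < eps).
  rewrite sum_n_rsum. replace (S n) with (N + (S n - N))%nat by lia.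
  rewrite rsum_split, (rsum_zero (S n - N)) by (intros; apply H; lia).
  replace (rsum N u + 0 - rsum N u) with 0 by ring. rewrite Rabs_R0. apply cond_pos.
Qed.

Lemma one_plus_le_exp x : 1 + x <= exp x.
Proof. destruct (Req_dec x 0) as [->|H]; [rewrite exp_0; lra|]. left. now apply exp_ineq1. Qed.

Lemma exp_le a b : a <= b -> exp a <= exp b.
Proof. intros [H|H]; [left; now apply exp_increasing|rewrite H; lra]. Qed.

Lemma exp_pow a n : exp a ^ n = exp (INR n * a).
Proof.
  induction n as [|n IH]; [simpl; now rewrite Rmult_0_l, exp_0|].
  simpl pow. rewrite IH, <- exp_plus, S_INR. f_equal. ring.
Qed.

Lemma sin_cubic x : 0 <= x <= 2 -> x - x ^ 3 / 6 <= sin x <= x.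
Proof.
  intros H. destruct (pre_sin_bound x 0) as [H1 _]; [lra|lra|]. split.
  - eapply Rle_trans; [|exact H1]. right. unfold sin_approx, sin_term; simpl. field.
  - destruct (Req_dec x 0) as [->|Hx]; [rewrite sin_0; lra|]. left. apply sin_lt_x. lra.
Qed.

(** [cos ^ 2] is [1 - sin ^ 2], squeezed between exponentials by
    [1 - u <= exp (- u)] and [1 - u >= exp (- u / (1 - u))]. *)
Lemma cos_power_bounds x m : 0 <= x < 1 ->
  exp (- (INR m * x ^ 2 / (1 - x ^ 2))) <= cos x ^ (2 * m) <= exp (- (INR m * x ^ 2 * (1 - x ^ 2 / 6) ^ 2)).
Proof.
  intros Hx. pose proof (sin_cubic x ltac:(lra)) as Hs.
  assert (Hc : cos x ^ 2 = 1 - sin x ^ 2).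
  { pose proof (sin2_cos2 x) as H. unfold Rsqr in H. simpl. lra. }
  assert (Hx2 : 0 <= x ^ 2 < 1) by (simpl; nra).
  assert (Hs0 : 0 <= sin x) by nra.
  assert (Hsu : sin x ^ 2 <= x ^ 2) by (apply pow_incr; lra).
  assert (Hsl : x ^ 2 * (1 - x ^ 2 / 6) ^ 2 <= sin x ^ 2).
  { replace (x ^ 2 * (1 - x ^ 2 / 6) ^ 2) with ((x - x ^ 3 / 6) ^ 2) by field.
    apply pow_incr. split; [simpl; nra|lra]. }
  rewrite pow_mult, Hc. split.
  - replace (- (INR m * x ^ 2 / (1 - x ^ 2))) with (INR m * - (x ^ 2 / (1 - x ^ 2))) by (field; lra).
    rewrite <- exp_pow. apply pow_incr. split; [left; apply exp_pos|].
    rewrite exp_Ropp. pose proof (one_plus_le_exp (x ^ 2 / (1 - x ^ 2))) as H.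
    replace (1 + x ^ 2 / (1 - x ^ 2)) with (/ (1 - x ^ 2)) in H by (field; lra).
    apply Rinv_le_contravar in H; [|apply Rinv_0_lt_compat; lra]. rewrite Rinv_inv in H. lra.
  - replace (- (INR m * x ^ 2 * (1 - x ^ 2 / 6) ^ 2)) with (INR m * - (x ^ 2 * (1 - x ^ 2 / 6) ^ 2)) by ring.
    rewrite <- exp_pow. apply pow_incr. split; [lra|].
    pose proof (one_plus_le_exp (- (x ^ 2 * (1 - x ^ 2 / 6) ^ 2))). lra.
Qed.

Lemma cos_power_dominated x m : 0 <= x <= 2 -> cos x ^ (2 * m) <= exp (- (INR m * x ^ 2 / 9)).
Proof.
  intros Hx. pose proof (sin_cubic x Hx) as Hs.
  assert (Hc : cos x ^ 2 = 1 - sin x ^ 2).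
  { pose proof (sin2_cos2 x) as H. unfold Rsqr in H. simpl. lra. }
  assert (Hl : (x / 3) ^ 2 <= sin x ^ 2).
  { apply pow_incr. split; [lra|]. eapply Rle_trans; [|apply Hs]. simpl. nra. }
  rewrite pow_mult, Hc. replace (- (INR m * x ^ 2 / 9)) with (INR m * - (x / 3) ^ 2) by field.
  rewrite <- exp_pow. apply pow_incr. split.
  - rewrite <- Hc. apply pow2_ge_0.
  - pose proof (one_plus_le_exp (- (x / 3) ^ 2)). lra.
Qed.

Lemma walk_nonneg m k : 0 <= walk m k.
Proof.
  revert k. induction m as [|m IH]; intros [|k]; simpl; try lra.
  - pose proof (IH 0%nat). pose proof (IH 1%nat). lra.
  - pose proof (IH k). pose proof (IH (S k)). pose proof (IH (S (S k))). lra.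
Qed.

(** The successive ratios are [1 - (2 k + 1) / (m + k + 1)], and the odd
    numbers add up to squares. *)
Lemma walk_upper m n k : (1 <= m)%nat -> (k <= n)%nat ->
  walk m k <= walk m 0 * exp (- (INR k ^ 2 / (INR m + INR n))).
Proof.
  intros Hm. induction k as [|k IH]; intros Hk.
  - simpl. rewrite Rmult_0_l. unfold Rdiv. rewrite Rmult_0_l, Ropp_0, exp_0. lra.
  - specialize (IH ltac:(lia)). pose proof (walk_ratio m k) as Hr. rewrite S_INR.
    assert (Hm1 : 1 <= INR m) by (apply (le_INR 1); lia).
    assert (Hkn : INR k + 1 <= INR n) by (rewrite <- S_INR; apply le_INR; lia).
    pose proof (pos_INR k). pose proof (walk_nonneg m k).
    assert (E : walk m (S k) = walk m k * (1 + - ((2 * INR k + 1) / (INR m + INR k + 1)))).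
    { apply (Rmult_eq_reg_l (INR m + INR k + 1)); [rewrite Hr; field|]; lra. }
    rewrite E. replace (- ((INR k + 1) ^ 2 / (INR m + INR n)))
      with (- (INR k ^ 2 / (INR m + INR n)) + - ((2 * INR k + 1) / (INR m + INR n))) by (field; lra).
    rewrite exp_plus, <- Rmult_assoc.
    assert (H1 : 1 + - ((2 * INR k + 1) / (INR m + INR k + 1)) <= exp (- ((2 * INR k + 1) / (INR m + INR n)))).
    { eapply Rle_trans; [apply one_plus_le_exp|]. apply exp_le, Ropp_le_contravar.
      apply Rmult_le_compat_l; [lra|]. apply Rinv_le_contravar; lra. }
    eapply Rle_trans; [apply Rmult_le_compat_l; [exact (walk_nonneg m k)|exact H1]|].
    apply Rmult_le_compat_r; [left; apply exp_pos|exact IH].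
Qed.

Lemma walk_lower m n k : (n < m)%nat -> (k <= n)%nat ->
  walk m 0 * exp (- (INR k ^ 2 / (INR m - INR n))) <= walk m k.
Proof.
  intros Hm. assert (Hmn : INR n + 1 <= INR m) by (rewrite <- S_INR; apply le_INR; lia).
  induction k as [|k IH]; intros Hk.
  - simpl. rewrite Rmult_0_l. unfold Rdiv. rewrite Rmult_0_l, Ropp_0, exp_0. lra.
  - specialize (IH ltac:(lia)). pose proof (walk_ratio m k) as Hr. rewrite S_INR.
    assert (Hkn : INR k + 1 <= INR n) by (rewrite <- S_INR; apply le_INR; lia).
    pose proof (pos_INR k).
    assert (E : walk m (S k) = walk m k * ((INR m - INR k) / (INR m + INR k + 1))).
    { apply (Rmult_eq_reg_l (INR m + INR k + 1)); [rewrite Hr; field|]; lra. }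
    rewrite E. replace (- ((INR k + 1) ^ 2 / (INR m - INR n)))
      with (- (INR k ^ 2 / (INR m - INR n)) + - ((2 * INR k + 1) / (INR m - INR n))) by (field; lra).
    rewrite exp_plus, <- Rmult_assoc.
    apply Rmult_le_compat; [|left; apply exp_pos|exact IH|].
    + apply Rmult_le_pos; [apply walk_nonneg|left; apply exp_pos].
    + rewrite exp_Ropp. replace ((INR m - INR k) / (INR m + INR k + 1))
        with (/ (1 + (2 * INR k + 1) / (INR m - INR k))) by (field; lra).
      apply Rinv_le_contravar.
      * assert (0 < (2 * INR k + 1) / (INR m - INR k)) by (apply Rdiv_lt_0_compat; lra). lra.
      * eapply Rle_trans; [apply one_plus_le_exp|]. apply exp_le.
        apply Rmult_le_compat_l; [lra|]. apply Rinv_le_contravar; lra.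
Qed.

(** Wallis: only the existence of the limit matters; its value follows from
    the inversion formula itself. *)
Lemma walk_0_sqr_lim : exists W : R, is_lim_seq (fun m => INR m * walk m 0 ^ 2) W.
Proof.
  destruct (ex_finite_lim_seq_incr (fun m => INR m * walk m 0 ^ 2) 1) as [W HW]; [| |now exists W].
  - intros m. rewrite walk_S_0, S_INR. pose proof (pos_INR m) as H. pose proof (walk_pos m) as H0.
    rewrite Rpow_mult_distr.
    replace ((INR m + 1) * (walk m 0 ^ 2 * ((2 * INR m + 1) / (2 * INR m + 2)) ^ 2))
      with (walk m 0 ^ 2 * ((2 * INR m + 1) ^ 2 / (4 * (INR m + 1)))) by (field; lra).
    rewrite Rmult_comm. apply Rmult_le_compat_l; [apply pow2_ge_0|].
    apply Rle_div_r; [lra|]. simpl. nra.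
  - intros m. assert (G : (2 * INR m + 1) * walk m 0 ^ 2 <= 1).
    { induction m as [|m IH]; [simpl; lra|]. rewrite walk_S_0, S_INR.
      pose proof (pos_INR m) as H. pose proof (walk_pos m) as H0. rewrite Rpow_mult_distr.
      eapply Rle_trans; [|exact IH].
      replace ((2 * (INR m + 1) + 1) * (walk m 0 ^ 2 * ((2 * INR m + 1) / (2 * INR m + 2)) ^ 2))
        with (walk m 0 ^ 2 * ((2 * INR m + 1) * ((2 * INR m + 3) * (2 * INR m + 1) / (2 * INR m + 2) ^ 2))) by (field; lra).
      rewrite Rmult_comm. apply Rmult_le_compat_r; [apply pow2_ge_0|].
      
      assert (X : (2 * INR m + 3) * (2 * INR m + 1) / (2 * INR m + 2) ^ 2 <= 1)
        by (apply Rle_div_l; [simpl; nra|]; simpl; nra).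
      apply (Rmult_le_compat_l (2 * INR m + 1)) in X; lra. }
    pose proof (pos_INR m). assert (0 <= walk m 0 ^ 2) by apply pow2_ge_0. nra.
Qed.

Definition rtheta (t : R) : R := Series (fun n => two_sided n * exp (- (PI * t * INR n ^ 2))).

Lemma exp_square_le a n : 0 <= a -> exp (- (a * INR n ^ 2)) <= exp (- a) ^ n.
Proof.
  intros Ha. rewrite exp_pow. apply exp_le.
  assert (INR n <= INR n ^ 2); [|nra].
  destruct n as [|n]; [simpl; lra|]. pose proof (le_INR 1 (S n) ltac:(lia)) as H. change (INR 1) with 1 in H.
  revert H. generalize (INR (S n)). intros x H. nra.
Qed.

Lemma exp_neg_bounds a : 0 < a -> 0 <= exp (- a) < 1.
Proof. intros H. split; [left; apply exp_pos|]. rewrite <- exp_0. apply exp_increasing. lra. Qed.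

Lemma two_sided_bounds n : 1 <= two_sided n <= 2.
Proof. destruct n; simpl; lra. Qed.

Lemma rtheta_pos t : 0 < t -> 1 <= rtheta t.
Proof.
  intros Ht. unfold rtheta.
  assert (HPt : 0 < PI * t) by (apply Rmult_lt_0_compat; [apply PI_RGT_0|exact Ht]).
  assert (Hex : ex_series (fun n => two_sided n * exp (- (PI * t * INR n ^ 2)))).
  { apply (ex_series_dom _ (fun n => 2 * exp (- (PI * t)) ^ n)).
    - intros n. pose proof (two_sided_bounds n). pose proof (exp_pos (- (PI * t * INR n ^ 2))).
      pose proof (exp_square_le (PI * t) n ltac:(lra)).
      split; [apply Rmult_le_pos; lra|apply Rmult_le_compat; lra].
    - now apply ex_series_geom_scal, exp_neg_bounds. }
  pose proof (rsum_le_Series _ 1 (fun n => Rmult_le_pos _ _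
    (Rle_trans _ _ _ Rle_0_1 (proj1 (two_sided_bounds n))) (Rlt_le _ _ (exp_pos _))) Hex) as H1.
  cbn [rsum two_sided] in H1.
  replace (- (PI * t * INR 0 ^ 2)) with 0 in H1 by (simpl; ring). rewrite exp_0 in H1.
  eapply Rle_trans; [|exact H1]. lra.
Qed.

Lemma is_lim_seq_exp_opp (u : nat -> R) (l : R) : is_lim_seq u l -> is_lim_seq (fun i => exp (- u i)) (exp (- l)).
Proof.
  intros H. apply (is_lim_seq_continuous (fun x => exp (- x)) u l); [|exact H].
  apply derivable_continuous_pt. apply derivable_pt_comp.
  - apply derivable_pt_opp, derivable_pt_id.
  - apply derivable_pt_exp.
Qed.

Section Limits.
Variables (s : R) (m : nat -> nat).
Hypothesis Hs : 0 < s.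
Let L (i : nat) : R := INR (2 * i + 1).
Hypothesis Hm : forall i, s * L i ^ 2 <= INR (m i) <= s * L i ^ 2 + 1.

Lemma lim_L_ge i : INR i + 1 <= L i /\ 1 <= L i.
Proof. unfold L. rewrite plus_INR, mult_INR. pose proof (pos_INR i). simpl. lra. Qed.

Lemma lim_inv_L : is_lim_seq (fun i => / L i) 0.
Proof.
  apply (is_lim_seq_le_le (fun _ => 0) _ (fun i => / (INR i + 1))).
  - intros i. pose proof (lim_L_ge i). pose proof (pos_INR i).
    split; [left; apply Rinv_0_lt_compat; lra|]. apply Rinv_le_contravar; lra.
  - apply is_lim_seq_const.
  - apply (is_lim_seq_ext (fun i => / INR (S i))); [intros; now rewrite S_INR|].
    apply (is_lim_seq_incr_1 (fun i => / INR i)).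
    replace (Finite 0) with (Rbar_inv p_infty) by reflexivity.
    apply is_lim_seq_inv; [apply is_lim_seq_INR|discriminate].
Qed.

Lemma lim_m_L : is_lim_seq (fun i => INR (m i) / L i ^ 2) s.
Proof.
  apply (is_lim_seq_le_le (fun _ => s) _ (fun i => s + / L i * / L i)).
  - intros i. pose proof (lim_L_ge i). specialize (Hm i).
    assert (0 < L i ^ 2) by (apply pow_lt; lra). split.
    + apply Rle_div_r; lra.
    + apply Rle_div_l; [lra|]. replace ((s + / L i * / L i) * L i ^ 2) with (s * L i ^ 2 + 1) by (field; lra). lra.
  - apply is_lim_seq_const.
  - replace (Finite s) with (Finite (s + 0 * 0)) by (f_equal; ring).
    apply (is_lim_seq_plus' (fun _ => s)); [apply is_lim_seq_const|].
    apply is_lim_seq_mult'; apply lim_inv_L.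
Qed.

Lemma lim_m_infty : is_lim_seq (fun i => INR (m i)) p_infty.
Proof.
  apply (is_lim_seq_le_p_loc (fun i => s * INR i)).
  - exists 0%nat. intros i _. specialize (Hm i). pose proof (lim_L_ge i). pose proof (pos_INR i).
    assert (INR i <= L i ^ 2) by (simpl; nra). nra.
  - replace p_infty with (Rbar_mult s p_infty).
    + apply is_lim_seq_scal_l, is_lim_seq_INR.
    + simpl. destruct (Rle_dec 0 s) as [H|H]; [|lra].
      destruct (Rle_lt_or_eq_dec 0 s H); [reflexivity|lra].
Qed.

Lemma cos_power_lim j :
  is_lim_seq (fun i => cos (PI * INR j / L i) ^ (2 * m i)) (exp (- (PI * (PI * s) * INR j ^ 2))).
Proof.
  set (x := fun i => PI * INR j / L i).
  assert (Hx : is_lim_seq x 0).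
  { replace (Finite 0) with (Finite (PI * INR j * 0)) by (f_equal; ring).
    apply (is_lim_seq_scal_l (fun i => / L i) (PI * INR j) 0), lim_inv_L. }
  assert (Hx2 : is_lim_seq (fun i => x i ^ 2) 0).
  { replace (Finite 0) with (Finite (0 * 0)) by (f_equal; ring).
    apply (is_lim_seq_ext (fun i => x i * x i)); [intros; ring|]. now apply is_lim_seq_mult'. }
  assert (Hmx : is_lim_seq (fun i => INR (m i) * x i ^ 2) (PI * (PI * s) * INR j ^ 2)).
  { replace (Finite (PI * (PI * s) * INR j ^ 2)) with (Finite ((PI * INR j) ^ 2 * s)) by (f_equal; ring).
    apply (is_lim_seq_ext (fun i => (PI * INR j) ^ 2 * (INR (m i) / L i ^ 2))).
    - intros i. unfold x. pose proof (lim_L_ge i). field. lra.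
    - apply (is_lim_seq_scal_l _ _ s), lim_m_L. }
  apply (is_lim_seq_le_le_loc (fun i => exp (- (INR (m i) * x i ^ 2 / (1 - x i ^ 2))))
           _ (fun i => exp (- (INR (m i) * x i ^ 2 * (1 - x i ^ 2 / 6) ^ 2)))).
  - apply is_lim_seq_spec in Hx. destruct (Hx (mkposreal 1 Rlt_0_1)) as [N HN].
    exists N. intros i Hi. specialize (HN i Hi). simpl in HN. rewrite Rminus_0_r in HN.
    apply Rabs_def2 in HN. apply cos_power_bounds. split; [|lra].
    unfold x. pose proof (lim_L_ge i). pose proof PI_RGT_0. pose proof (pos_INR j).
    apply Rmult_le_pos; [apply Rmult_le_pos; lra|left; apply Rinv_0_lt_compat; lra].
  - apply is_lim_seq_exp_opp.
    replace (Finite (PI * (PI * s) * INR j ^ 2)) with (Finite (PI * (PI * s) * INR j ^ 2 / (1 - 0))) by (f_equal; field).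
    apply is_lim_seq_div'; [exact Hmx| |lra].
    apply is_lim_seq_minus'; [apply is_lim_seq_const|exact Hx2].
  - apply is_lim_seq_exp_opp.
    replace (Finite (PI * (PI * s) * INR j ^ 2)) with (Finite (PI * (PI * s) * INR j ^ 2 * ((1 - 0 * / 6) * (1 - 0 * / 6)))) by (f_equal; field).
    apply is_lim_seq_mult'; [exact Hmx|].
    apply (is_lim_seq_ext (fun i => (1 - x i ^ 2 * / 6) * (1 - x i ^ 2 * / 6))); [intros; simpl; unfold Rdiv; ring|].
    assert (G : is_lim_seq (fun i => 1 - x i ^ 2 * / 6) (1 - 0 * / 6)).
    { apply is_lim_seq_minus'; [apply is_lim_seq_const|].
      apply (is_lim_seq_scal_r _ (/ 6) 0), Hx2. }
    now apply is_lim_seq_mult'.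
Qed.

Lemma left_lim :
  is_lim_seq (fun i => rsum (2 * i + 1) (fun j => cos (PI * INR j / L i) ^ (2 * m i))) (rtheta (PI * s)).
Proof.
  set (a := fun i j => if (j <=? i)%nat then two_sided j * cos (PI * INR j / L i) ^ (2 * m i) else 0).
  apply (is_lim_seq_ext (fun i => Series (a i))).
  { intros i. unfold L. rewrite polya_left, (Series_finite (a i) (S i)).
    - apply rsum_ext. intros j Hj. unfold a. now replace (j <=? i)%nat with true by (symmetry; apply Nat.leb_le; lia).
    - intros j Hj. unfold a. now replace (j <=? i)%nat with false by (symmetry; apply Nat.leb_gt; lia). }
  apply (tannery a _ (fun j => 2 * exp (- (PI ^ 2 * s / 9)) ^ j)).
  - apply ex_series_geom_scal, exp_neg_bounds. pose proof PI_RGT_0.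
    assert (0 < PI ^ 2) by (apply pow_lt; lra). assert (0 < PI ^ 2 * s) by (now apply Rmult_lt_0_compat). lra.
  - intros i j. unfold a. pose proof (two_sided_bounds j) as H2.
    assert (He : 0 < exp (- (PI ^ 2 * s / 9))) by apply exp_pos.
    destruct (Nat.leb_spec j i) as [Hj|Hj].
    2:{ rewrite Rabs_R0. apply Rmult_le_pos; [lra|]. apply pow_le. lra. }
    rewrite Rabs_mult, (Rabs_pos_eq (two_sided j)) by lra.
    rewrite Rabs_pos_eq by (rewrite pow_mult; apply pow_le, pow2_ge_0).
    apply Rmult_le_compat; [lra|rewrite pow_mult; apply pow_le, pow2_ge_0|lra|].
    pose proof (lim_L_ge i) as HL. pose proof PI_RGT_0. pose proof PI_4. pose proof (pos_INR j).
    eapply Rle_trans; [apply cos_power_dominated|].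
    + split; [apply Rmult_le_pos; [apply Rmult_le_pos; lra|left; apply Rinv_0_lt_compat; lra]|].
      apply Rle_div_l; [lra|]. unfold L. rewrite plus_INR, mult_INR. apply le_INR in Hj. simpl. nra.
    + eapply Rle_trans; [|apply exp_square_le].
      * apply exp_le, Ropp_le_contravar. specialize (Hm i).
        assert (0 < L i ^ 2) by (apply pow_lt; lra).
        assert (E : s <= INR (m i) / L i ^ 2) by (apply Rle_div_r; lra).
        replace (INR (m i) * (PI * INR j / L i) ^ 2 / 9) with (PI ^ 2 * INR j ^ 2 / 9 * (INR (m i) / L i ^ 2)) by (field; lra).
        replace (PI ^ 2 * s / 9 * INR j ^ 2) with (PI ^ 2 * INR j ^ 2 / 9 * s) by field.
        apply Rmult_le_compat_l; [|exact E].
        assert (0 <= PI ^ 2 * INR j ^ 2) by (apply Rmult_le_pos; apply pow2_ge_0). lra.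
      * assert (0 <= PI ^ 2 * s) by (apply Rmult_le_pos; [apply pow2_ge_0|lra]). lra.
  - intros j. apply (is_lim_seq_ext_loc (fun i => two_sided j * cos (PI * INR j / L i) ^ (2 * m i))).
    + exists j. intros i Hi. unfold a. now replace (j <=? i)%nat with true by (symmetry; apply Nat.leb_le; lia).
    + apply (is_lim_seq_scal_l _ (two_sided j) (exp (- (PI * (PI * s) * INR j ^ 2)))), cos_power_lim.
Qed.

Lemma walk_term_lim v :
  is_lim_seq (fun i => walk (m i) (v * (2 * i + 1)) / walk (m i) 0) (exp (- (PI * / (PI * s) * INR v ^ 2))).
Proof.
  set (n := fun i => (v * (2 * i + 1))%nat).
  assert (Hn : forall i, INR (n i) = INR v * L i) by (intros; unfold n, L; now rewrite mult_INR).
  assert (Hlim : forall e : R, is_lim_seq (fun i => INR (n i) ^ 2 / (INR (m i) + e * INR (n i))) (PI * / (PI * s) * INR v ^ 2)).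
  { intros e. pose proof PI_RGT_0.
    replace (Finite (PI * / (PI * s) * INR v ^ 2)) with (Finite (INR v ^ 2 / (s + e * INR v * 0))) by (f_equal; field; lra).
    apply (is_lim_seq_ext_loc (fun i => INR v ^ 2 / (INR (m i) / L i ^ 2 + e * INR v * / L i))).
    - assert (G : is_lim_seq (fun i => INR (m i) / L i ^ 2 + e * INR v * / L i) (s + e * INR v * 0)).
      { apply is_lim_seq_plus'; [apply lim_m_L|]. apply (is_lim_seq_scal_l _ (e * INR v) 0), lim_inv_L. }
      apply is_lim_seq_spec in G. destruct (G (mkposreal s Hs)) as [N HN].
      exists N. intros i Hi. specialize (HN i Hi). cbn [pos] in HN. apply Rabs_def2 in HN.
      pose proof (lim_L_ge i). rewrite Hn. field.
      split; [|lra].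
      intros E. assert (INR (m i) / L i ^ 2 + e * INR v * / L i = (INR (m i) + e * (INR v * L i)) / L i ^ 2) by (field; lra).
      rewrite H1 in HN. rewrite E in HN. unfold Rdiv in HN. lra.
    - apply is_lim_seq_div'; [apply is_lim_seq_const| |lra].
      apply is_lim_seq_plus'; [apply lim_m_L|]. apply (is_lim_seq_scal_l _ (e * INR v) 0), lim_inv_L. }
  assert (Hlt : eventually (fun i => (n i < m i)%nat)).
  { assert (G : is_lim_seq (fun i => INR v * / L i) 0).
    { replace (Finite 0) with (Finite (INR v * 0)) by (f_equal; ring).
      apply (is_lim_seq_scal_l _ (INR v) 0), lim_inv_L. }
    apply is_lim_seq_spec in G. destruct (G (mkposreal s Hs)) as [N HN].
    exists N. intros i Hi. specialize (HN i Hi). simpl in HN. rewrite Rminus_0_r in HN. apply Rabs_def2 in HN.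
    apply INR_lt. rewrite Hn. pose proof (lim_L_ge i). specialize (Hm i).
    assert (INR v < s * L i); [|simpl in Hm; nra].
    replace (INR v) with (INR v * / L i * L i) by (field; lra). apply Rmult_lt_compat_r; lra. }
  apply (is_lim_seq_le_le_loc (fun i => exp (- (INR (n i) ^ 2 / (INR (m i) + -1 * INR (n i)))))
           _ (fun i => exp (- (INR (n i) ^ 2 / (INR (m i) + 1 * INR (n i)))))).
  - destruct Hlt as [N HN]. exists N. intros i Hi. specialize (HN i Hi).
    pose proof (walk_pos (m i)).
    replace (INR (m i) + -1 * INR (n i)) with (INR (m i) - INR (n i)) by ring. rewrite Rmult_1_l.
    split.
    + apply Rle_div_r; [lra|]. rewrite Rmult_comm. now apply walk_lower.
    + apply Rle_div_l; [lra|]. rewrite Rmult_comm. apply walk_upper; lia.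
  - apply is_lim_seq_exp_opp, Hlim.
  - apply is_lim_seq_exp_opp, Hlim.
Qed.

Lemma right_lim :
  is_lim_seq (fun i => rsum (S (m i)) (fun v => two_sided v * walk (m i) (v * (2 * i + 1))) / walk (m i) 0)
    (rtheta (/ (PI * s))).
Proof.
  set (a := fun i v => two_sided v * (walk (m i) (v * (2 * i + 1)) / walk (m i) 0)).
  apply (is_lim_seq_ext (fun i => Series (a i))).
  { intros i. pose proof (walk_pos (m i)). rewrite (Series_finite (a i) (S (m i))).
    - unfold Rdiv. rewrite Rmult_comm, <- rsum_scal. apply rsum_ext. intros v _. unfold a. field. lra.
    - intros v Hv. unfold a. rewrite walk_0 by nia. unfold Rdiv. ring. }
  apply (tannery a _ (fun v => 2 * exp (- / (2 * (s + 1))) ^ v)).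
  - apply ex_series_geom_scal, exp_neg_bounds. apply Rinv_0_lt_compat. lra.
  - intros i v. unfold a. pose proof (two_sided_bounds v). pose proof (walk_pos (m i)) as Hw.
    pose proof (walk_nonneg (m i) (v * (2 * i + 1))) as Hw'.
    set (n := (v * (2 * i + 1))%nat) in *.
    assert (Hq : 0 <= walk (m i) n / walk (m i) 0) by (apply Rle_div_r; lra).
    rewrite Rabs_pos_eq by (apply Rmult_le_pos; lra).
    apply Rmult_le_compat; [lra|exact Hq|lra|].
    pose proof (lim_L_ge i) as HL. specialize (Hm i).
    destruct (Nat.le_gt_cases n (m i)) as [Hn|Hn].
    2:{ rewrite walk_0 by exact Hn. unfold Rdiv. rewrite Rmult_0_l. apply pow_le. left. apply exp_pos. }
    assert (HL2 : 1 <= L i ^ 2) by (simpl; nra).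
    assert (Hm1 : 0 < INR (m i)) by nra.
    eapply Rle_trans; [|apply exp_square_le; left; apply Rinv_0_lt_compat; lra].
    apply Rle_div_l; [lra|]. rewrite Rmult_comm. eapply Rle_trans; [apply (walk_upper (m i) n n); [|lia]|].
    + destruct (m i); [simpl in Hm1; lra|lia].
    + apply Rmult_le_compat_l; [lra|]. apply exp_le, Ropp_le_contravar.
      assert (En : INR n = INR v * L i) by (unfold n, L; now rewrite mult_INR). rewrite En.
      apply le_INR in Hn. rewrite En in Hn. assert (0 <= INR v * L i) by (apply Rmult_le_pos; [apply pos_INR|lra]).
      apply (Rle_div_r _ _ (INR (m i) + INR v * L i)); [lra|].
      replace (/ (2 * (s + 1)) * INR v ^ 2 * (INR (m i) + INR v * L i))
        with (INR v ^ 2 * ((INR (m i) + INR v * L i) / (2 * (s + 1)))) by (field; lra).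
      rewrite Rpow_mult_distr. apply Rmult_le_compat_l; [apply pow2_ge_0|].
      apply Rle_div_l; [lra|]. nra.
  - intros v. apply (is_lim_seq_scal_l _ (two_sided v) (exp (- (PI * / (PI * s) * INR v ^ 2)))), walk_term_lim.
Qed.

End Limits.

(** Polya's identity with [L = 2 i + 1] and [m] close to [s L ^ 2]: the left
    side tends to a theta series at [t], the right side, divided by the central
    coefficient, to one at [1 / t]. *)
Lemma rtheta_inversion_up_to_constant :
  exists W : R, forall t, 0 < t -> rtheta t ^ 2 * t = W * rtheta (/ t) ^ 2.
Proof.
  destruct walk_0_sqr_lim as [W HW]. exists (PI * W). intros t Ht. pose proof PI_RGT_0 as HPI.
  set (s := t / PI). assert (Hs : 0 < s) by (unfold s; now apply Rdiv_lt_0_compat).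
  assert (Hex : exists m : nat -> nat, forall i,
    s * INR (2 * i + 1) ^ 2 <= INR (m i) <= s * INR (2 * i + 1) ^ 2 + 1).
  { apply (fun_choice nat nat (fun i mi => s * INR (2 * i + 1) ^ 2 <= INR mi <= s * INR (2 * i + 1) ^ 2 + 1)).
    intros i. set (r := s * INR (2 * i + 1) ^ 2).
    assert (Hr : 0 <= r) by (apply Rmult_le_pos; [lra|apply pow2_ge_0]).
    destruct (archimed r) as [H1 H2]. exists (Z.to_nat (up r)).
    assert (0 <= up r)%Z by (apply le_IZR; lra).
    rewrite INR_IZR_INZ, Z2Nat.id by assumption. lra. }
  destruct Hex as [m Hm].
  pose proof (left_lim s m Hs Hm) as HA. pose proof (right_lim s m Hs Hm) as HB.
  replace (PI * s) with t in HA, HB by (unfold s; field; lra).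
  pose proof (rtheta_pos t Ht) as PA. pose proof (rtheta_pos (/ t) ltac:(now apply Rinv_0_lt_compat)) as PB.
  set (A := fun i => rsum (2 * i + 1) (fun j => cos (PI * INR j / INR (2 * i + 1)) ^ (2 * m i))) in *.
  set (B := fun i => rsum (S (m i)) (fun v => two_sided v * walk (m i) (v * (2 * i + 1))) / walk (m i) 0) in *.
  (* [INR L * walk m 0 = A / B], and its square is [L ^ 2 / m * (m * walk m 0 ^ 2)]. *)
  assert (H1 : is_lim_seq (fun i => A i ^ 2 * (INR (m i) / INR (2 * i + 1) ^ 2)) (rtheta t ^ 2 * s)).
  { apply is_lim_seq_mult'; [|exact (lim_m_L s m Hm)].
    apply (is_lim_seq_ext (fun i => A i * A i)); [intros; ring|].
    replace (rtheta t ^ 2) with (rtheta t * rtheta t) by ring. now apply is_lim_seq_mult'. }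
  assert (H2 : is_lim_seq (fun i => INR (m i) * walk (m i) 0 ^ 2 * B i ^ 2) (W * rtheta (/ t) ^ 2)).
  { apply is_lim_seq_mult'.
    - apply is_lim_seq_spec. intros eps. apply is_lim_seq_spec in HW. destruct (HW eps) as [N HN].
      pose proof (lim_m_infty s m Hs Hm) as Hinf. apply is_lim_seq_spec in Hinf.
      destruct (Hinf (INR N)) as [N' HN']. exists N'. intros i Hi. apply HN. specialize (HN' i Hi).
      apply INR_lt in HN'. lia.
    - apply (is_lim_seq_ext (fun i => B i * B i)); [intros; ring|].
      replace (rtheta (/ t) ^ 2) with (rtheta (/ t) * rtheta (/ t)) by ring. now apply is_lim_seq_mult'. }
  assert (E : forall i, INR (m i) * walk (m i) 0 ^ 2 * B i ^ 2 = A i ^ 2 * (INR (m i) / INR (2 * i + 1) ^ 2)).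
  { intros i. unfold A. rewrite polya_identity by lia. unfold B. pose proof (walk_pos (m i)).
    assert (0 < INR (2 * i + 1)) by (apply lt_0_INR; lia). field. lra. }
  apply (is_lim_seq_ext _ _ _ E) in H2. apply is_lim_seq_unique in H1, H2. rewrite H1 in H2.
  apply (f_equal real) in H2. cbn [real] in H2. unfold s in H2.
  replace (rtheta t ^ 2 * t) with (PI * (rtheta t ^ 2 * (t / PI))) by (field; lra). rewrite H2. ring.
Qed.

(** The constant is found at the fixed point [t = 1]. *)
Lemma rtheta_inversion t : 0 < t -> rtheta (/ t) ^ 2 = t * rtheta t ^ 2.
Proof.
  intros Ht. destruct rtheta_inversion_up_to_constant as [W HW].
  pose proof (HW 1 Rlt_0_1) as H1. rewrite Rinv_1 in H1. pose proof (rtheta_pos 1 Rlt_0_1) as P.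
  assert (W = 1) as ->.
  { assert (0 < rtheta 1 ^ 2) by (apply pow_lt; lra).
    apply (Rmult_eq_reg_r (rtheta 1 ^ 2)); lra. }
  specialize (HW t Ht). lra.
Qed.

(** * The inversion formula on the upper half-plane *)

Local Open Scope C_scope.

Lemma analytic_cayley : analytic cayley.
Proof.
  apply (analytic_ext (fun w => (Ci * (1 + w)) * / (1 - 1 * w))).
  - intros w _. unfold cayley, Cdiv. do 2 f_equal. ring.
  - apply analytic_mult.
    + apply analytic_scal, analytic_plus; [apply analytic_const|apply analytic_id].
    + apply analytic_inv_linear. rewrite Cmod_1. lra.
Qed.

Lemma cayley_Im_lower w r : (0 < r < 1)%R -> (Cmod w <= r)%R ->
  ((1 - r) / 4 <= Im (cayley w))%R.
Proof.
  intros Hr Hw. pose proof (Cmod_ge_0 w). rewrite cayley_Im by lra.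
  assert (H2 : (0 < Cmod (1 - w) ^ 2)%R).
  { apply pow_lt, Cmod_gt_0, one_minus_neq_0. lra. }
  assert (H3 : (Cmod (1 - w) <= 2)%R).
  { unfold Cminus. eapply Rle_trans; [apply Cmod_triangle|]. rewrite Cmod_opp, Cmod_1. lra. }
  apply (Rle_div_r _ _ (Cmod (1 - w) ^ 2)); [exact H2|].
  assert (H4 : (Cmod (1 - w) ^ 2 <= 4)%R).
  { pose proof (Cmod_ge_0 (1 - w)). simpl. nra. }
  simpl in *. nra.
Qed.

Lemma cayley_H w : (Cmod w < 1)%R -> upper_half_plane (cayley w).
Proof.
  intros Hw. pose proof (Cmod_ge_0 w). unfold upper_half_plane.
  pose proof (cayley_Im_lower w ((1 + Cmod w) / 2) ltac:(lra) ltac:(lra)). lra.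
Qed.

Lemma cayley_Cmod_upper w r : (0 < r < 1)%R -> (Cmod w <= r)%R -> (Cmod (cayley w) <= 2 / (1 - r))%R.
Proof.
  intros Hr Hw. pose proof (Cmod_ge_0 w). unfold cayley.
  assert (Hne : 1 - w <> 0) by (apply one_minus_neq_0; lra).
  rewrite Cmod_div, Cmod_mult, Cmod_Ci, Rmult_1_l by exact Hne.
  assert (H1 : (1 - r <= Cmod (1 - w))%R).
  { assert (Cmod 1 <= Cmod (1 - w) + Cmod w)%R; [|rewrite Cmod_1 in *; lra].
    replace (RtoC 1) with ((1 - w) + w) at 1 by ring. apply Cmod_triangle. }
  assert (H2 : (Cmod (1 + w) <= 2)%R) by (eapply Rle_trans; [apply Cmod_triangle|]; rewrite Cmod_1; lra).
  apply Rmult_le_compat; [apply Cmod_ge_0|left; apply Rinv_0_lt_compat; lra|exact H2|].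
  apply Rinv_le_contravar; lra.
Qed.

Lemma analytic_to_H_half_cayley : analytic_to_H (fun w => RtoC (/ 2) * cayley w).
Proof.
  split; [apply analytic_scal, analytic_cayley|].
  intros r Hr. exists ((1 - r) / 8)%R. split; [lra|]. intros w Hw.
  pose proof (cayley_Im_lower w r Hr Hw).
  replace (Im (RtoC (/ 2) * cayley w)) with (/ 2 * Im (cayley w))%R
    by (destruct (cayley w); simpl; ring). lra.
Qed.

Lemma theta_imaginary_axis t : (0 < t)%R -> theta ((0, t / 2)%R : C) = RtoC (rtheta t).
Proof.
  intros Ht. rewrite theta_eq by (unfold upper_half_plane; simpl; lra).
  assert (E : e2pi ((0, t / 2)%R : C) = RtoC (exp (- (PI * t)))).
  { unfold e2pi. replace (RtoC (2 * PI) * Ci * ((0, t / 2)%R : C)) with (RtoC (- (PI * t))).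
    - unfold Cexp. simpl Re. simpl Im. rewrite cos_0, sin_0. unfold RtoC, Cmult; simpl. f_equal; ring.
    - unfold RtoC, Ci, Cmult; simpl. f_equal; field. }
  rewrite E. unfold theta_q, CSeries.
  assert (T : forall n, theta_coef n * RtoC (exp (- (PI * t))) ^ (n * n)
     = RtoC (two_sided n * exp (- (PI * t * INR n ^ 2)))).
  { intros n. rewrite <- RtoC_pow, exp_pow, RtoC_mult, mult_INR. f_equal; [destruct n; reflexivity|].
    do 2 f_equal. ring. }
  unfold RtoC at 3. f_equal.
  - apply Series_ext. intros n. rewrite T. reflexivity.
  - rewrite (Series_ext _ (fun _ => 0%R)) by (intros n; rewrite T; reflexivity).
    apply (Series_finite (fun _ => 0%R) 0). reflexivity.
Qed.

(** Both sides are analytic in the disc coordinate, in which the inversion is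
    [w -> - w], and they agree on the real diameter. *)
Lemma theta_inversion z : upper_half_plane z ->
  theta (- (1) / (4 * z)) ^ 2 = - (2) * Ci * z * theta z ^ 2.
Proof.
  intros Hz.
  set (tau := fun w => RtoC (/ 2) * cayley w).
  assert (Hneg : forall w, (Cmod w < 1)%R -> (Cmod (- (1) * w ^ 1) < 1)%R).
  { intros w Hw. rewrite Cpow_1_r, Cmod_mult, Cmod_m1. lra. }
  assert (Ath : analytic (fun w => theta (tau w) ^ 2)).
  { apply analytic_pow, analytic_theta, analytic_to_H_half_cayley. }
  assert (Athm : analytic (fun w => theta (tau (- (1) * w ^ 1)) ^ 2)).
  { apply (analytic_comp_monomial (fun w => theta (tau w) ^ 2) (- (1)) 1); [exact Ath| |lia].
    rewrite Cmod_m1. lra. }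
  assert (Alin : forall e, analytic (fun w => 1 + e * w)).
  { intros e. apply analytic_plus; [apply analytic_const|apply analytic_scal, analytic_id]. }
  set (D := fun w => (1 + - (1) * w) * theta (tau (- (1) * w ^ 1)) ^ 2 + - (1) * ((1 + 1 * w) * theta (tau w) ^ 2)).
  assert (AD : analytic D).
  { apply analytic_plus; [|apply analytic_scal]; apply analytic_mult; auto. }
  assert (HD : forall w, (Cmod w < 1)%R -> D w = 0).
  { apply analytic_zero_of_accumulation; [exact AD|]. intros d Hd.
    exists (RtoC (d / 2)). rewrite Cmod_R, Rabs_pos_eq by lra. split; [lra|].
    set (x := (d / 2)%R). assert (Hx : (0 < x < 1)%R) by (unfold x; lra). clearbody x.
    set (t := ((1 + x) / (1 - x))%R). assert (Ht : (0 < t)%R) by (apply Rdiv_lt_0_compat; lra).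
    assert (E1 : tau (RtoC x) = ((0, t / 2)%R : C)).
    { unfold tau, cayley, t, Ci, Cdiv, Cinv, Cmult, Cplus, Cminus, Copp, RtoC; simpl. f_equal; field; nra. }
    assert (E2 : tau (- (1) * RtoC x ^ 1) = ((0, / t / 2)%R : C)).
    { unfold tau, cayley, t, Ci, Cdiv, Cinv, Cmult, Cplus, Cminus, Copp, RtoC; simpl. f_equal; field; nra. }
    unfold D. rewrite E1, E2, !theta_imaginary_axis by (try apply Rinv_0_lt_compat; exact Ht).
    rewrite <- !RtoC_pow, rtheta_inversion by exact Ht.
    rewrite <- !RtoC_opp, <- !RtoC_mult, <- !RtoC_plus, <- !RtoC_mult, <- !RtoC_plus. f_equal.
    unfold t. field. lra. }
  assert (H2z : upper_half_plane (2 * z)).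
  { unfold upper_half_plane in *. destruct z as [a b]. simpl in *. lra. }
  destruct (cayley_surj (2 * z) H2z) as (w & Hw & Ew).
  assert (Hne : 1 - w <> 0) by now apply one_minus_neq_0.
  assert (Hz0 : z <> 0).
  { intros E. rewrite E in Hz. unfold upper_half_plane in Hz. simpl in Hz. lra. }
  assert (Hpe : 1 + w <> 0).
  { intros E. apply Hz0. unfold cayley in Ew. rewrite E in Ew.
    replace z with (/ 2 * (2 * z)) by field. rewrite <- Ew.
    unfold Cdiv. ring. }
  assert (E1 : tau w = z).
  { unfold tau. rewrite Ew. rewrite RtoC_inv by lra. field. }
  assert (E2 : tau (- (1) * w ^ 1) = - (1) / (4 * z)).
  { rewrite <- E1. unfold tau, cayley. rewrite RtoC_inv by lra.
    assert (HC : Ci * Ci = - (1)) by (unfold Ci, Cmult, RtoC, Copp; simpl; f_equal; ring).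
    assert (HCi : Ci <> 0) by (intros E; apply (f_equal Im) in E; simpl in E; lra).
    rewrite Cpow_1_r. replace (1 + - (1) * w) with (1 - w) by ring.
    replace (1 - - (1) * w) with (1 + w) by ring.
    set (A := / 2 * (Ci * (1 - w) / (1 + w))). set (B := / 2 * (Ci * (1 + w) / (1 - w))).
    assert (HAB : 4 * A * B = - (1)).
    { rewrite <- HC. unfold A, B. field. repeat split; assumption. }
    assert (HB : B <> 0) by (intros E; rewrite E, Cmult_0_r in HAB; apply (f_equal Re) in HAB; simpl in HAB; lra).
    rewrite <- HAB. field. exact HB. }
  specialize (HD w Hw). unfold D in HD. rewrite E1, E2 in HD.
  assert (HD' : (1 - w) * theta (- (1) / (4 * z)) ^ 2 = (1 + w) * theta z ^ 2).
  { replace ((1 - w) * theta (- (1) / (4 * z)) ^ 2) with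
      ((1 + - (1) * w) * theta (- (1) / (4 * z)) ^ 2 + - (1) * ((1 + 1 * w) * theta z ^ 2) + (1 + w) * theta z ^ 2) by ring.
    rewrite HD. ring. }
  replace (theta (- (1) / (4 * z)) ^ 2) with ((1 - w) * theta (- (1) / (4 * z)) ^ 2 / (1 - w)) by (field; exact Hne).
  rewrite HD'. replace (- (2) * Ci * z) with (- Ci * (2 * z)) by ring. rewrite <- Ew. unfold cayley.
  assert (HC : Ci * Ci = - (1)) by (unfold Ci, Cmult, RtoC, Copp; simpl; f_equal; ring).
  transitivity (- (Ci * Ci) * (1 + w) / (1 - w) * theta z ^ 2); [rewrite HC|]; field; exact Hne.
Qed.

(** * The modular group acting on the upper half-plane *)

Lemma ZtoC_plus a b : ZtoC (a + b) = ZtoC a + ZtoC b.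
Proof. unfold ZtoC. now rewrite plus_IZR, RtoC_plus. Qed.
Lemma ZtoC_mult a b : ZtoC (a * b) = ZtoC a * ZtoC b.
Proof. unfold ZtoC. now rewrite mult_IZR, RtoC_mult. Qed.
Lemma ZtoC_opp a : ZtoC (- a) = - ZtoC a.
Proof. unfold ZtoC. now rewrite opp_IZR, RtoC_opp. Qed.
Lemma ZtoC_minus a b : ZtoC (a - b) = ZtoC a - ZtoC b.
Proof. unfold ZtoC. now rewrite minus_IZR, RtoC_minus. Qed.
Lemma ZtoC_inj a b : ZtoC a = ZtoC b -> a = b.
Proof. intros H. apply eq_IZR. now apply (f_equal Re) in H. Qed.
Lemma ZtoC_neq_0 a : a <> 0%Z -> ZtoC a <> 0.
Proof. intros H E. apply H. now apply ZtoC_inj. Qed.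

Lemma denom_neq_0 g z : upper_half_plane z -> denom g z <> 0.
Proof.
  intros Hz E. unfold upper_half_plane in Hz. unfold denom in E.
  destruct z as [x y]. unfold ZtoC, Cplus, Cmult, RtoC in E. simpl in E, Hz.
  injection E as E1 E2. ring_simplify in E2.
  assert (Hc : IZR (mc g) = 0%R) by (apply (Rmult_eq_reg_r y); lra).
  rewrite Hc in E1. ring_simplify in E1.
  apply eq_IZR in Hc. apply (eq_IZR _ 0) in E1. pose proof (SL2Z_det g) as D. rewrite Hc, E1 in D. lia.
Qed.

Lemma Im_moebius g z : upper_half_plane z ->
  Im (moebius g z) = (Im z / Cmod (denom g z) ^ 2)%R.
Proof.
  intros Hz. pose proof (denom_neq_0 g z Hz) as Hd.
  assert (Hd2 : (Cmod (denom g z) ^ 2 <> 0)%R).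
  { apply pow_nonzero. intros E. apply Hd. now apply Cmod_eq_0. }
  rewrite Cmod_sqr in *. pose proof (SL2Z_det g) as D. apply (f_equal IZR) in D.
  rewrite minus_IZR, !mult_IZR in D.
  destruct z as [x y]. unfold moebius, denom, ZtoC, Cdiv, Cinv, Cmult, Cplus, RtoC in *. simpl in *.
  set (a := IZR (ma g)) in *. set (b := IZR (mb g)) in *. set (c := IZR (mc g)) in *. set (d := IZR (md g)) in *.
  replace (y / ((c * x - 0 * y + d) * ((c * x - 0 * y + d) * 1) + (c * y + 0 * x + 0) * ((c * y + 0 * x + 0) * 1)))%R
    with ((a * d - b * c) * y / ((c * x - 0 * y + d) * ((c * x - 0 * y + d) * 1) + (c * y + 0 * x + 0) * ((c * y + 0 * x + 0) * 1)))%R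
    by (rewrite D; f_equal; ring).
  field. intros E. apply Hd2. etransitivity; [|exact E]. ring.
Qed.

Lemma moebius_H g z : upper_half_plane z -> upper_half_plane (moebius g z).
Proof.
  intros Hz. unfold upper_half_plane. rewrite Im_moebius by exact Hz.
  apply Rdiv_lt_0_compat; [exact Hz|]. now apply pow_lt, Cmod_gt_0, denom_neq_0.
Qed.

Lemma denom_mul g h z : upper_half_plane z ->
  denom (mulSL2Z g h) z = denom g (moebius h z) * denom h z.
Proof.
  intros Hz. pose proof (denom_neq_0 h z Hz) as Hd. unfold moebius.
  unfold denom at 1 2. simpl mc. simpl md. rewrite !ZtoC_plus, !ZtoC_mult.
  replace (ZtoC (mc g) * ((ZtoC (ma h) * z + ZtoC (mb h)) / denom h z) + ZtoC (md g))
    with ((ZtoC (mc g) * (ZtoC (ma h) * z + ZtoC (mb h)) + ZtoC (md g) * denom h z) / denom h z)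
    by (field; exact Hd).
  unfold denom in *. field. exact Hd.
Qed.

Lemma moebius_mul g h z : upper_half_plane z ->
  moebius (mulSL2Z g h) z = moebius g (moebius h z).
Proof.
  intros Hz. pose proof (denom_neq_0 h z Hz) as Hd.
  pose proof (denom_neq_0 g _ (moebius_H h z Hz)) as Hd2.
  assert (E : ZtoC (ma (mulSL2Z g h)) * z + ZtoC (mb (mulSL2Z g h))
     = (ZtoC (ma g) * moebius h z + ZtoC (mb g)) * denom h z).
  { unfold moebius. simpl ma. simpl mb. rewrite !ZtoC_plus, !ZtoC_mult.
    replace ((ZtoC (ma g) * ((ZtoC (ma h) * z + ZtoC (mb h)) / denom h z) + ZtoC (mb g)) * denom h z)
      with (ZtoC (ma g) * (ZtoC (ma h) * z + ZtoC (mb h)) + ZtoC (mb g) * denom h z) by (field; exact Hd).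
    unfold denom. ring. }
  unfold moebius at 1. rewrite E, denom_mul by exact Hz.
  generalize dependent (moebius h z). intros w Hd2 _. unfold moebius. field. split; assumption.
Qed.

Lemma moebius_eq g h z : ma g = ma h -> mb g = mb h -> mc g = mc h -> md g = md h ->
  moebius g z = moebius h z.
Proof. unfold moebius, denom. now intros -> -> -> ->. Qed.

Lemma moebius_inv_r g z : upper_half_plane z -> moebius g (moebius (invSL2Z g) z) = z.
Proof.
  intros Hz. rewrite <- moebius_mul by exact Hz. unfold moebius, denom. simpl.
  pose proof (SL2Z_det g) as D.
  replace (ma g * md g + mb g * - mc g)%Z with 1%Z by lia.
  replace (ma g * - mb g + mb g * ma g)%Z with 0%Z by lia.
  replace (mc g * md g + md g * - mc g)%Z with 0%Z by lia.
  replace (mc g * - mb g + md g * ma g)%Z with 1%Z by lia.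
  unfold ZtoC. field.
Qed.

(** * The square of theta under Gamma_1(4) *)

Definition theta_law (g : SL2Z) : Prop :=
  forall z, upper_half_plane z -> theta (moebius g z) ^ 2 = denom g z * theta z ^ 2.

Lemma theta_law_cancel g h : theta_law h -> theta_law (mulSL2Z g h) -> theta_law g.
Proof.
  intros Hh Hgh z Hz.
  set (z' := moebius (invSL2Z h) z).
  assert (Hz' : upper_half_plane z') by now apply moebius_H.
  assert (E : moebius h z' = z) by now apply moebius_inv_r.
  specialize (Hh z' Hz'). specialize (Hgh z' Hz').
  rewrite moebius_mul, denom_mul, E in Hgh by exact Hz'. rewrite E in Hh.
  rewrite Hgh, Hh. ring.
Qed.

Lemma theta_period z p : upper_half_plane z -> theta (z + ZtoC p) = theta z.
Proof.
  intros Hz. rewrite !theta_eq; [now rewrite e2pi_add_Z|exact Hz|].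
  unfold upper_half_plane in *. destruct z. simpl in *. lra.
Qed.

Lemma translation_det n : (1 * 1 - n * 0 = 1)%Z. Proof. ring. Qed.
Definition translation (n : Z) : SL2Z := mkSL2Z 1 n 0 1 (translation_det n).

Lemma lower_unipotent_det c : (1 * 1 - 0 * c = 1)%Z. Proof. ring. Qed.
Definition lower_unipotent (c : Z) : SL2Z := mkSL2Z 1 0 c 1 (lower_unipotent_det c).

Lemma theta_law_translation n : theta_law (translation n).
Proof.
  intros z Hz. unfold moebius, denom. cbn [ma mb mc md translation].
  change (ZtoC 1) with (RtoC 1). change (ZtoC 0) with (RtoC 0).
  replace ((RtoC 1 * z + ZtoC n) / (RtoC 0 * z + RtoC 1)) with (z + ZtoC n).
  - rewrite theta_period by exact Hz. ring.
  - field.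
Qed.

Lemma theta_law_lower m : theta_law (lower_unipotent (4 * m)).
Proof.
  intros z Hz. assert (Hz0 : z <> 0).
  { intros E. rewrite E in Hz. unfold upper_half_plane in Hz. simpl in Hz. lra. }
  pose proof (denom_neq_0 (lower_unipotent (4 * m)) z Hz) as Hd.
  unfold denom in Hd. unfold moebius, denom. cbn [ma mb mc md lower_unipotent] in *.
  rewrite ZtoC_mult in *. 
  change (ZtoC 4) with (RtoC 4) in *. change (ZtoC 1) with (RtoC 1) in *. change (ZtoC 0) with (RtoC 0) in *.
  (* [V z = -1 / (4 w)] with [w = -1 / (4 z) - m]. *)
  set (w := - (1) / (4 * z) + ZtoC (- m)).
  assert (Hw : w = - (4 * ZtoC m * z + 1) / (4 * z)).
  { unfold w. rewrite ZtoC_opp. field. exact Hz0. }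
  assert (Hw0 : upper_half_plane (- (1) / (4 * z))).
  { unfold upper_half_plane in *. destruct z as [x y]. unfold Cdiv, Cinv, Cmult, Copp, RtoC. simpl in *.
    match goal with |- (0 < ?a)%R => replace a with (4 * y / ((4 * x) ^ 2 + (4 * y) ^ 2))%R by (field; nra) end.
    apply Rdiv_lt_0_compat; nra. }
  assert (HwH : upper_half_plane w).
  { unfold w, upper_half_plane in *. destruct (- (1) / (4 * z)) as [p q]. simpl in *. lra. }
  replace ((1 * z + 0) / (4 * ZtoC m * z + 1)) with (- (1) / (4 * w)).
  - rewrite theta_inversion by exact HwH. unfold w at 2.
    rewrite theta_period by exact Hw0. rewrite theta_inversion by exact Hz.
    rewrite Hw. assert (HC : Ci * Ci = - (1)) by (unfold Ci, Cmult, RtoC, Copp; simpl; f_equal; ring).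
    transitivity (- (Ci * Ci) * (4 * ZtoC m * z + 1) * theta z ^ 2); [field; exact Hz0|rewrite HC; ring].
  - rewrite Hw. field. repeat split; try assumption.
Qed.

Lemma Z_round c d : c <> 0%Z -> exists n, (2 * Z.abs (d + n * c) <= Z.abs c)%Z.
Proof.
  intros Hc. pose proof (Z.div_mod d (Z.abs c) ltac:(lia)) as E.
  pose proof (Z.mod_pos_bound d (Z.abs c) ltac:(lia)) as B.
  assert (G : forall k, exists n, (d + n * c = d + k * Z.abs c)%Z).
  { intros k. exists (k * Z.sgn c)%Z. f_equal.
    destruct c as [|p|p]; cbn [Z.sgn Z.abs]; [ring|ring|].
    change (Z.neg p) with (- Z.pos p)%Z. ring. }
  destruct (Z_le_gt_dec (2 * (d mod Z.abs c)) (Z.abs c)) as [H|H].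
  - destruct (G (- (d / Z.abs c))%Z) as [n Hn]. exists n. rewrite Hn. lia.
  - destruct (G (- (d / Z.abs c) - 1)%Z) as [n Hn]. exists n. rewrite Hn. lia.
Qed.

(** Gamma_1(4) is generated by [T] and [V = (1 0; 4 1)]: multiplying by powers
    of [T] and [V] on the right runs a Euclidean descent on the bottom row. *)
Lemma theta_law_Gamma1_4 g : (4 | mc g)%Z -> (4 | md g - 1)%Z -> theta_law g.
Proof.
  remember (Z.to_nat (Z.abs (mc g))) as k eqn:Hk. revert g Hk.
  induction k as [k IH] using (well_founded_induction Wf_nat.lt_wf). intros g Hk Hc Hd.
  destruct (Z.eq_dec (mc g) 0) as [H0|H0].
  - pose proof (SL2Z_det g) as D. rewrite H0 in D. destruct Hd as [q Hq].
    assert (Hd1 : md g = 1%Z).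
    { assert (Hdv : (md g | 1)%Z) by (exists (ma g); lia).
      apply Z.divide_1_r in Hdv. lia. }
    assert (Ha1 : ma g = 1%Z) by (rewrite Hd1 in D; lia).
    intros z Hz. pose proof (theta_law_translation (mb g) z Hz) as T.
    rewrite (moebius_eq g (translation (mb g))) by (simpl; lia).
    unfold denom in *. simpl in T. rewrite H0, Hd1. exact T.
  - destruct (Z_round (mc g) (md g) H0) as [n Hn].
    apply (theta_law_cancel g (translation n)); [apply theta_law_translation|].
    set (g' := mulSL2Z g (translation n)).
    assert (Ec : mc g' = mc g) by (unfold g'; simpl; lia).
    assert (Ed : md g' = (md g + n * mc g)%Z) by (unfold g'; simpl; lia).
    assert (Hd' : (4 | md g' - 1)%Z).
    { rewrite Ed. replace (md g + n * mc g - 1)%Z with ((md g - 1) + n * mc g)%Z by ring.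
      apply Z.divide_add_r; [exact Hd|]. now apply Z.divide_mul_r. }
    destruct (Z.eq_dec (md g') 0) as [E0|E0].
    { rewrite E0 in Hd'. destruct Hd' as [q Hq]. lia. }
    destruct Hc as [e He].
    destruct (Z_round (4 * md g') (mc g) ltac:(lia)) as [m Hm].
    apply (theta_law_cancel g' (lower_unipotent (4 * m))); [apply theta_law_lower|].
    assert (Ec'' : mc (mulSL2Z g' (lower_unipotent (4 * m))) = (mc g + m * (4 * md g'))%Z)
      by (change (mc g' * 1 + md g' * (4 * m) = mc g + m * (4 * md g'))%Z; rewrite Ec; ring).
    assert (Ed'' : md (mulSL2Z g' (lower_unipotent (4 * m))) = md g')
      by (change (mc g' * 0 + md g' * 1 = md g')%Z; ring).
    apply (IH (Z.to_nat (Z.abs (mc (mulSL2Z g' (lower_unipotent (4 * m))))))); [|reflexivity| |].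
    + rewrite Ec'', Hk. destruct Hd' as [q Hq]. rewrite <- Ed in Hn. lia.
    + rewrite Ec'', He. exists (e + m * md g')%Z. ring.
    + rewrite Ed''. exact Hd'.
Qed.

(** * Gauss sums and the cusps of theta *)

Definition phase (r : R) : C := e2pi (RtoC r).

Lemma phase_add r s : phase (r + s) = phase r * phase s.
Proof. unfold phase. now rewrite RtoC_plus, e2pi_add. Qed.

Lemma phase_Z p : phase (IZR p) = 1.
Proof. apply e2pi_Z. Qed.

Lemma phase_add_Z r p : phase (r + IZR p) = phase r.
Proof. rewrite phase_add, phase_Z. ring. Qed.

Lemma Cmod_phase r : Cmod (phase r) = 1%R.
Proof. unfold phase. rewrite e2pi_R. apply Cmod_cis. Qed.

Lemma phase_1_integer r : phase r = 1 -> exists p : Z, r = IZR p.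
Proof.
  intros H. destruct (archimed r) as [H1 H2].
  set (p := up r) in *. destruct (Req_dec r (IZR p - 1)) as [E|E].
  - exists (p - 1)%Z. rewrite minus_IZR. exact E.
  - exfalso. assert (H3 : phase (IZR p - r) = 1).
    { replace (IZR p - r)%R with (- r + IZR p)%R by ring. rewrite phase_add_Z.
      replace (phase (- r)) with (phase r * phase (- r)) by (rewrite H; ring).
      rewrite <- phase_add. replace (r + - r)%R with (IZR 0) by ring. apply phase_Z. }
    unfold phase in H3. rewrite e2pi_R in H3. revert H3. apply cis_neq_1.
    pose proof PI_RGT_0. rewrite Rabs_pos_eq by nra. nra.
Qed.

Lemma phase_sub_Z r s p : (r - s)%R = IZR p -> phase r = phase s.
Proof. intros H. replace r with (s + IZR p)%R by lra. apply phase_add_Z. Qed.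

Lemma csum_periodic_shift (g : nat -> C) L s : (forall n, g (n + L)%nat = g n) ->
  csum L (fun n => g (n + s)%nat) = csum L g.
Proof.
  intros H. induction s as [|s IH].
  - apply csum_ext. intros. f_equal. lia.
  - rewrite <- IH. destruct L as [|L]; [reflexivity|].
    change (csum (S L) (fun n => g (n + S s)%nat)) with (csum L (fun n => g (n + S s)%nat) + g (L + S s)%nat).
    change (csum (S L)) with (csum (1 + L)). rewrite csum_split. simpl csum at 2.
    replace (L + S s)%nat with (s + S L)%nat by lia. rewrite H.
    rewrite (csum_ext L (fun n => g (n + S s)%nat) (fun i => g (1 + i + s)%nat)) by (intros; f_equal; lia).
    simpl. ring.
Qed.

Lemma csum_periodic_bound (g : nat -> C) L B : (0 < L)%nat -> (forall n, g (n + L)%nat = g n) ->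
  csum L g = 0 -> (forall n, (Cmod (g n) <= B)%R) -> forall n, (Cmod (csum n g) <= INR L * B)%R.
Proof.
  intros HL Hp H0 HB n.
  assert (Hpq : forall q i, g (q * L + i)%nat = g i).
  { induction q as [|q IH]; intros i; [reflexivity|]. rewrite <- (IH i).
    replace (S q * L + i)%nat with (q * L + i + L)%nat by lia. apply Hp. }
  assert (Hq : forall q, csum (q * L) g = 0).
  { induction q as [|q IH]; [reflexivity|]. replace (S q * L)%nat with (q * L + L)%nat by lia.
    rewrite csum_split, IH, (csum_ext L _ g) by (intros; apply Hpq). rewrite H0. ring. }
  rewrite (Nat.div_mod_eq n L), (Nat.mul_comm L), csum_split, Hq, Cplus_0_l.
  pose proof (Nat.mod_upper_bound n L ltac:(lia)).
  eapply Rle_trans; [apply csum_bound; intros; apply HB|].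
  apply Rmult_le_compat_r; [eapply Rle_trans; [apply Cmod_ge_0|apply (HB 0%nat)]|].
  apply le_INR. lia.
Qed.

Lemma abel_bound (g : nat -> C) (v : nat -> R) K :
  (forall n, (0 <= v (S n) <= v n)%R) -> (forall n, (Cmod (csum n g) <= K)%R) ->
  forall n, (Cmod (csum n (fun i => g i * v i)%C) <= K * v 0%nat)%R.
Proof.
  intros Hv HK n. assert (K0 : (0 <= K)%R) by (eapply Rle_trans; [apply Cmod_ge_0|apply (HK 0%nat)]).
  assert (Hv0 : forall n, (0 <= v n)%R).
  { intros [|i]; [|apply Hv]. pose proof (Hv 0%nat). lra. }
  destruct n as [|n]; [simpl; rewrite Cmod_0; specialize (Hv0 0%nat); nra|].
  assert (E : forall n, csum (S n) (fun i => g i * v i)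
    = csum (S n) g * v n + csum n (fun i => csum (S i) g * RtoC (v i - v (S i)))).
  { clear n. induction n as [|n IH]; [simpl; ring|].
    change (csum (S (S n)) (fun i => g i * v i)) with (csum (S n) (fun i => g i * v i) + g (S n) * v (S n)).
    rewrite IH.
    change (csum (S n) (fun i => csum (S i) g * RtoC (v i - v (S i))))
      with (csum n (fun i => csum (S i) g * RtoC (v i - v (S i))) + csum (S n) g * RtoC (v n - v (S n))).
    change (csum (S (S n)) g) with (csum (S n) g + g (S n)). rewrite RtoC_minus. ring. }
  rewrite E. eapply Rle_trans; [apply Cmod_triangle|].
  assert (H1 : (Cmod (csum (S n) g * v n) <= K * v n)%R).
  { rewrite Cmod_mult, Cmod_R, Rabs_pos_eq by apply Hv0. apply Rmult_le_compat_r; [apply Hv0|apply HK]. }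
  assert (H2 : forall n, (Cmod (csum n (fun i => csum (S i) g * RtoC (v i - v (S i)))%C) <= K * (v 0%nat - v n))%R).
  { clear - Hv HK K0. induction n as [|n IH]; [simpl; rewrite Cmod_0; lra|].
    change (csum (S n) (fun i => csum (S i) g * RtoC (v i - v (S i))))
      with (csum n (fun i => csum (S i) g * RtoC (v i - v (S i))) + csum (S n) g * RtoC (v n - v (S n))).
    eapply Rle_trans; [apply Cmod_triangle|]. rewrite (Cmod_mult (csum (S n) g)), Cmod_R.
    pose proof (Hv n). rewrite Rabs_pos_eq by lra.
    assert (Cmod (csum (S n) g) * (v n - v (S n)) <= K * (v n - v (S n)))%R
      by (apply Rmult_le_compat_r; [lra|apply HK]). lra. }
  specialize (H2 n). lra.
Qed.

Definition gauss_sum (p c : Z) : C :=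
  csum (Z.to_nat (Z.abs c)) (fun n => phase (INR n ^ 2 * (IZR p / IZR c))).

Definition gaussian_sum (eps : R) : R := Series (fun n => exp (- (2 * PI * eps * INR n ^ 2))).

Lemma gaussian_ex_series eps : (0 < eps)%R -> ex_series (fun n => exp (- (2 * PI * eps * INR n ^ 2))).
Proof.
  intros He. assert (H : (0 < 2 * PI * eps)%R) by (pose proof PI_RGT_0; apply Rmult_lt_0_compat; lra).
  apply (ex_series_dom _ (fun n => 1 * exp (- (2 * PI * eps)) ^ n)%R).
  - intros n. split; [left; apply exp_pos|]. rewrite Rmult_1_l. apply exp_square_le. lra.
  - now apply ex_series_geom_scal, exp_neg_bounds.
Qed.

Lemma gaussian_sum_unbounded B : exists e0, (0 < e0)%R /\
  forall eps, (0 < eps <= e0)%R -> (B <= gaussian_sum eps)%R.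
Proof.
  destruct (INR_unbounded (3 * Rabs B + 1)) as [n Hn].
  pose proof PI_RGT_0. pose proof PI_4. assert (Hn0 : (1 < INR n)%R) by (pose proof (Rabs_pos B); lra).
  exists (/ (8 * INR n ^ 2))%R. assert (Hp : (0 < INR n ^ 2)%R) by (apply pow_lt; lra).
  split; [apply Rinv_0_lt_compat; lra|]. intros eps He.
  eapply Rle_trans; [|apply (rsum_le_Series _ n); [intros; left; apply exp_pos|apply gaussian_ex_series; lra]].
  assert (H1 : forall i, (i < n)%nat -> (/ 3 <= exp (- (2 * PI * eps * INR i ^ 2)))%R).
  { intros i Hi. apply lt_INR in Hi. pose proof (pos_INR i).
    apply Rle_trans with (exp (Ropp 1)).
    - rewrite exp_Ropp. apply Rinv_le_contravar; [apply exp_pos|]. apply exp_le_3.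
    - apply exp_le, Ropp_le_contravar.
      assert (INR i ^ 2 <= INR n ^ 2)%R by (apply pow_incr; lra).
      assert (eps * (8 * INR n ^ 2) <= 1)%R by (apply (Rle_div_r _ _ (8 * INR n ^ 2)); [lra|]; unfold Rdiv; lra).
      assert (0 <= eps * INR i ^ 2)%R by (apply Rmult_le_pos; [lra|apply pow2_ge_0]).
      assert (eps * INR i ^ 2 <= eps * INR n ^ 2)%R by (apply Rmult_le_compat_l; lra).
      replace (2 * PI * eps * INR i ^ 2)%R with (2 * PI * (eps * INR i ^ 2))%R by ring. nra. }
  apply rsum_le in H1. rewrite rsum_const in H1. pose proof (Rle_abs B). lra.
Qed.

Lemma int_div_nat c : c <> 0%Z -> exists s : Z, (s = 1 \/ s = -1)%Z /\
  Z.of_nat (Z.to_nat (Z.abs c)) = (s * c)%Z.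
Proof. intros H. destruct (Z_lt_le_dec c 0); [exists (-1)%Z|exists 1%Z]; split; lia. Qed.

(** Near the cusp [p / c] the terms of theta have the periodic phases of a
    Gauss sum, against a decreasing weight; only their mean value matters. *)
Lemma theta_near_cusp p c eps : c <> 0%Z -> (0 < eps)%R ->
  (Cmod (theta ((IZR p / IZR c, eps)%R : C)
    - 2 * (gauss_sum p c / INR (Z.to_nat (Z.abs c))) * gaussian_sum eps)%C <= 4 * INR (Z.to_nat (Z.abs c)) + 1)%R.
Proof.
  intros Hc He. set (L := Z.to_nat (Z.abs c)). set (x := (IZR p / IZR c)%R).
  assert (HL : (0 < L)%nat) by (unfold L; lia). assert (HL' : (0 < INR L)%R) by now apply lt_0_INR.
  assert (Hc' : IZR c <> 0%R) by (intros E; apply Hc; now apply eq_IZR).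
  set (ph := fun n : nat => phase (INR n ^ 2 * x)).
  set (v := fun n : nat => exp (- (2 * PI * eps * INR n ^ 2))).
  set (mu := gauss_sum p c / INR L).
  assert (Hper : forall n, ph (n + L)%nat = ph n).
  { intros n. destruct (int_div_nat c Hc) as (s & Hs & E). fold L in E.
    unfold ph. apply (phase_sub_Z _ _ (p * s * (2 * Z.of_nat n + s * c))%Z).
    rewrite plus_INR, !mult_IZR, plus_IZR, !mult_IZR, <- INR_IZR_INZ.
    replace (INR L) with (IZR s * IZR c)%R by (rewrite <- mult_IZR, <- E, <- INR_IZR_INZ; reflexivity).
    unfold x. field. exact Hc'. }
  assert (Hmu : csum L (fun n => ph n - mu) = 0).
  { rewrite (csum_ext L _ (fun n => ph n + - mu)) by reflexivity. rewrite csum_plus, csum_const.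
    unfold mu. change (csum L ph) with (gauss_sum p c). field.
    apply RtoC_neq_0. lra. }
  assert (HG : (Cmod mu <= 1)%R).
  { unfold mu. rewrite Cmod_div, Cmod_R, Rabs_pos_eq by (try lra; apply RtoC_neq_0; lra).
    apply Rle_div_l; [exact HL'|]. rewrite Rmult_1_l, <- (Rmult_1_r (INR L)).
    apply csum_bound. intros. rewrite Cmod_phase. lra. }
  assert (Hb : forall n, (Cmod (csum n (fun n => ph n - mu)%C) <= INR L * 2)%R).
  { apply csum_periodic_bound; [exact HL| |exact Hmu|].
    - intros n. now rewrite Hper.
    - intros n. unfold Cminus. eapply Rle_trans; [apply Cmod_triangle|]. rewrite Cmod_opp. unfold ph. rewrite Cmod_phase. lra. }
  assert (Hv : forall n, (0 <= v (S n) <= v n)%R).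
  { intros n. unfold v. split; [left; apply exp_pos|]. apply exp_le, Ropp_le_contravar.
    pose proof PI_RGT_0. apply Rmult_le_compat_l; [apply Rmult_le_pos; lra|].
    rewrite S_INR. pose proof (pos_INR n). apply pow_incr. lra. }
  assert (HA := abel_bound _ v _ Hv Hb).
  set (z := ((x, eps)%R : C)).
  assert (Hz : upper_half_plane z) by (unfold upper_half_plane, z; simpl; lra).
  assert (Hterm : forall n : nat, e2pi z ^ (n * n) = ph n * v n).
  { intros n. rewrite e2pi_pow. unfold ph, phase, v.
    replace (RtoC (INR (n * n)) * z) with (RtoC (INR n ^ 2 * x) + ((0, INR n ^ 2 * eps)%R : C)).
    - rewrite e2pi_add. f_equal. unfold e2pi.
      replace (RtoC (2 * PI) * Ci * ((0, INR n ^ 2 * eps)%R : C)) with (RtoC (- (2 * PI * eps * INR n ^ 2))).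
      + unfold Cexp. simpl Re. simpl Im. rewrite cos_0, sin_0. unfold RtoC, Cmult; simpl. f_equal; ring.
      + unfold RtoC, Ci, Cmult; simpl. f_equal; ring.
    - rewrite mult_INR. unfold z, RtoC, Cmult, Cplus; simpl. f_equal; ring. }
  assert (Hth : is_Cseries (fun n => ph n * v n) ((theta z + 1) / 2)).
  { rewrite theta_eq by exact Hz.
    assert (HH := is_Cseries_theta_q _ (proj2 (Cmod_e2pi_lt_1 z Hz))).
    assert (H1 : is_Cseries (fun n => match n with O => RtoC 1 | S _ => RtoC 0 end) 1).
    { apply (is_Cseries_single 0 (fun n => match n with O => RtoC 1 | S _ => RtoC 0 end)). intros [|n] Hn; [lia|reflexivity]. }
    assert (H2 := is_Cseries_scal (/ 2) _ _ (is_Cseries_plus _ _ _ _ HH H1)).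
    replace ((theta_q (e2pi z) + 1) / 2) with (/ 2 * (theta_q (e2pi z) + 1)) by (field).
    eapply is_Cseries_ext; [|exact H2]. intros n. simpl. rewrite Hterm. destruct n; simpl.
    - unfold ph, v. simpl. rewrite !Rmult_0_l, Rmult_0_r, Ropp_0, exp_0. unfold phase. rewrite e2pi_0. field.
    - field. }
  assert (Hg : is_Cseries (fun n => RtoC (v n)) (RtoC (gaussian_sum eps))).
  { destruct (ex_Cseries_dom (fun n => RtoC (v n)) v) as [s Hs].
    - intros n. rewrite Cmod_R, Rabs_pos_eq by (left; apply exp_pos). lra.
    - now apply gaussian_ex_series.
    - replace (RtoC (gaussian_sum eps)) with s; [exact Hs|].
      rewrite <- (is_Cseries_CSeries _ _ Hs). unfold CSeries, gaussian_sum, RtoC. f_equal.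
      apply (Series_finite (fun _ => 0%R) 0). reflexivity. }
  assert (Hd := is_Cseries_plus _ _ _ _ Hth (is_Cseries_scal (- mu) _ _ Hg)).
  assert (Hd' : (Cmod ((theta z + 1) / 2 + - mu * gaussian_sum eps)%C <= 2 * INR L)%R).
  { apply (is_Cseries_le _ _ _ Hd). intros n.
    rewrite (csum_ext n _ (fun i => (ph i - mu) * v i)) by (intros; ring).
    eapply Rle_trans; [apply HA|]. unfold v. simpl. rewrite Rmult_0_l, Rmult_0_r, Ropp_0, exp_0. lra. }
  replace (theta z - 2 * mu * gaussian_sum eps)
    with (2 * ((theta z + 1) / 2 + - mu * gaussian_sum eps) + - (1)) by field.
  eapply Rle_trans; [apply Cmod_triangle|]. rewrite Cmod_mult, Cmod_m1, Cmod_R, Rabs_pos_eq by lra. lra.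
Qed.

(** A Gauss sum is unchanged by a shift of the summation variable; where the
    shift multiplies the phase by [x n <> 1], the terms cancel. *)
Lemma shifted_sum_vanishes L s (ph D x : nat -> C) :
  (forall n, ph (n + L)%nat = ph n) -> (forall n, D (n + L)%nat = D n) -> (forall n, x (n + L)%nat = x n) ->
  (forall n, D (n + s)%nat = D n) -> (forall n, x (n + s)%nat = x n) ->
  (forall n, ph (n + s)%nat = ph n * x n) -> (forall n, x n = 1 -> D n = 0) ->
  csum L (fun n => ph n * D n) = 0.
Proof.
  intros HpL HDL HxL HDs Hxs Hps H0.
  set (E := fun n => D n / (1 - x n)).
  assert (HE : forall n, D n = E n - x n * E n).
  { intros n. unfold E. destruct (classic (x n = 1)) as [Hx|Hx].
    - rewrite (H0 n Hx). unfold Cdiv. ring.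
    - field. intros E'. apply Hx. replace (x n) with (1 - (1 - x n)) by ring. rewrite E'. ring. }
  rewrite (csum_ext L _ (fun n => ph n * E n + - (1) * (ph (n + s)%nat * E (n + s)%nat))).
  - rewrite csum_plus, csum_scal.
    rewrite (csum_periodic_shift (fun n => ph n * E n) L s).
    + ring.
    + intros n. unfold E. now rewrite HpL, HDL, HxL.
  - intros n _. rewrite HE at 1. rewrite Hps. unfold E. rewrite HDs, Hxs. ring.
Qed.

Definition admissible_level (M Q : Z) : Prop :=
  (1 <= M)%Z /\ (0 < Q)%Z /\ (M * M | Q)%Z /\ (4 * M | Q)%Z.

Lemma level_quotient M Q q : (1 <= M)%Z -> Q = (q * (M * M))%Z -> (Q / M = M * q)%Z.
Proof.
  intros HM ->. replace (q * (M * M))%Z with (M * q * M)%Z by ring. apply Z.div_mul. lia.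
Qed.

(** The translation by [u / M] multiplies the multiplier of theta by the
    additive character [phase (u * theta_twist M Q * c' / 2)], where
    [c = Q * c'] is the lower left entry. *)
Definition theta_twist (M Q : Z) : Z :=
  if Z.eq_dec (M mod 4) 0 then 0%Z else (Q / (2 * (M * M)))%Z.

Lemma theta_twist_spec M Q : admissible_level M Q ->
  ((4 | M)%Z /\ theta_twist M Q = 0%Z) \/
  (~ (4 | M)%Z /\ Q = (2 * (M * M) * theta_twist M Q)%Z /\ ((2 | M)%Z \/ (2 | theta_twist M Q)%Z)).
Proof.
  intros (HM & HQ & [q Hq] & [r Hr]). unfold theta_twist.
  destruct (Z.eq_dec (M mod 4) 0) as [H|H].
  - left. split; [|reflexivity]. apply Z.mod_divide; [lia|exact H].
  - right. assert (H4 : ~ (4 | M)%Z) by (intros D; apply H, Z.mod_divide; [lia|exact D]).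
    split; [exact H4|].
    assert (E : (M * q = 4 * r)%Z) by (apply (Z.mul_reg_l _ _ M); lia).
    destruct (Zeven_odd_dec M) as [Hev|Hod].
    + apply Zeven_ex in Hev. destruct Hev as [m Hm].
      assert (Hq2 : (2 | q)%Z).
      { apply (Gauss 2 m q); [exists r; lia|].
        destruct (Zeven_odd_dec m) as [Hme|Hmo].
        - exfalso. apply H4. apply Zeven_ex in Hme. destruct Hme as [k Hk]. exists k. lia.
        - apply Zodd_ex in Hmo. destruct Hmo as [k Hk].
          apply bezout_rel_prime. apply (Bezout_intro 2 m 1 (- k) 1). lia. }
      destruct Hq2 as [k Hk].
      assert (Et : (Q / (2 * (M * M)) = k)%Z) by (rewrite Hq, Hk; replace (k * 2 * (M * M))%Z with (k * (2 * (M * M)))%Z by ring; apply Z.div_mul; nia).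
      rewrite Et. split; [rewrite Hq, Hk; ring|]. left. exists m. lia.
    + apply Zodd_ex in Hod. destruct Hod as [m Hm].
      assert (Hq4 : (4 | q)%Z).
      { apply (Gauss 4 M q); [exists r; lia|]. 
        assert (Hs : exists s t, (s * 4 + t * M = 1)%Z).
        { destruct (Zeven_odd_dec m) as [Hme|Hmo].
          - apply Zeven_ex in Hme. destruct Hme as [k Hk]. exists (- k)%Z, 1%Z. lia.
          - apply Zodd_ex in Hmo. destruct Hmo as [k Hk]. exists (k + 1)%Z, (-1)%Z. lia. }
        destruct Hs as (s & t & Hst). apply bezout_rel_prime. exact (Bezout_intro 4 M 1 s t Hst). }
      destruct Hq4 as [k Hk].
      assert (Et : (Q / (2 * (M * M)) = 2 * k)%Z) by (rewrite Hq, Hk; replace (k * 4 * (M * M))%Z with (2 * k * (2 * (M * M)))%Z by ring; apply Z.div_mul; nia).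
      rewrite Et. split; [rewrite Hq, Hk; ring|]. right. exists k. ring.
Qed.

(** Changing [a / c] by [u / M] inserts the factors [phase (n ^ 2 u / M)] into
    the Gauss sum; shifts of the summation variable cancel all terms but those
    where this factor is the same sign. *)
Lemma gauss_sum_twist M Q a b d c' u : admissible_level M Q ->
  (a * d - b * (Q * c') = 1)%Z -> (Q * c' <> 0)%Z ->
  gauss_sum (a + Q / M * c' * u) (Q * c') =
  phase (IZR (u * theta_twist M Q * c') / 2) * gauss_sum a (Q * c').
Proof.
  intros HA Hdet Hc. pose proof (theta_twist_spec M Q HA) as HT.
  set (k := theta_twist M Q) in *. destruct HA as (HM & HQ & [q Hq] & [r Hr]).
  set (c := (Q * c')%Z) in *. set (L := Z.to_nat (Z.abs c)).
  assert (HM' : IZR M <> 0%R) by (intros E; apply eq_IZR in E; lia).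
  assert (Hc' : IZR c <> 0%R) by (intros E; apply eq_IZR in E; lia).
  pose proof (level_quotient M Q q HM Hq) as HQM.
  assert (Ec : c = (M * (M * q * c'))%Z) by (unfold c; rewrite Hq; ring).
  destruct (int_div_nat c Hc) as (sg & Hsg & EL). fold L in EL.
  assert (EL' : INR L = (IZR sg * IZR c)%R) by (rewrite <- mult_IZR, <- EL; apply INR_IZR_INZ).
  set (w := phase (IZR (u * k * c') / 2)).
  set (ph := fun n : nat => phase (INR n ^ 2 * (IZR a / IZR c))).
  set (D := fun n : nat => phase (INR n ^ 2 * (IZR u / IZR M)) - w).
  assert (Hsum : csum L (fun n => ph n * D n) = 0).
  2:{ unfold gauss_sum. fold L. rewrite <- csum_scal.
      transitivity (csum L (fun n => ph n * D n) + csum L (fun n => w * ph n)); [|rewrite Hsum, Cplus_0_l; reflexivity].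
      rewrite <- csum_plus. apply csum_ext. intros n _. unfold D.
      replace (ph n * (phase (INR n ^ 2 * (IZR u / IZR M)) - w) + w * ph n)
        with (ph n * phase (INR n ^ 2 * (IZR u / IZR M))) by ring.
      unfold ph. rewrite <- phase_add. f_equal. rewrite HQM, plus_IZR.
      replace (IZR (M * q * c' * u)) with (IZR c * IZR u / IZR M)%R.
      - field. split; assumption.
      - rewrite Ec, !mult_IZR. field. exact HM'. }
  assert (HphL : forall n, ph (n + L)%nat = ph n).
  { intros n. apply (phase_sub_Z _ _ (a * sg * (2 * Z.of_nat n + sg * c))%Z).
    rewrite plus_INR, EL', !mult_IZR, plus_IZR, !mult_IZR, <- INR_IZR_INZ. field. exact Hc'. }
  assert (HD : forall s t, Z.of_nat s = (M * t)%Z -> forall n, D (n + s)%nat = D n).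
  { intros s t Hs n. unfold D. f_equal.
    apply (phase_sub_Z _ _ (u * t * (2 * Z.of_nat n + M * t))%Z).
    rewrite plus_INR, (INR_IZR_INZ s), Hs, !mult_IZR, plus_IZR, !mult_IZR, <- INR_IZR_INZ. field. exact HM'. }
  (* If [2 n = M j], then [n ^ 2 u / M] equals [M j ^ 2 u / 4]. *)
  assert (HD0 : forall n j, (2 * Z.of_nat n = M * j)%Z -> (4 | u * (M * j * j - 2 * (k * c')))%Z -> D n = 0).
  { intros n j Hn [t Ht]. unfold D.
    assert (E : phase (INR n ^ 2 * (IZR u / IZR M)) = w); [|rewrite E; ring].
    apply (phase_sub_Z _ _ t).
    assert (HnR : INR n = (IZR M * IZR j / 2)%R).
    { apply (f_equal IZR) in Hn. rewrite !mult_IZR, <- INR_IZR_INZ in Hn. lra. }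
    apply (f_equal IZR) in Ht. rewrite !mult_IZR, minus_IZR, !mult_IZR in Ht.
    rewrite HnR, !mult_IZR.
    replace ((IZR M * IZR j / 2) ^ 2 * (IZR u / IZR M))%R with (IZR M * IZR j * IZR j * IZR u / 4)%R by (field; exact HM').
    lra. }
  assert (Hrel : forall X, (2 * M | a * X)%Z -> (2 * M | X)%Z).
  { intros X [t Ht]. exists (t * d - b * X * (2 * r * c'))%Z.
    assert (EX : (X = X * (a * d - b * c))%Z) by (rewrite Hdet; ring).
    rewrite EX at 1. replace (X * (a * d - b * c))%Z with (a * X * d - X * b * c)%Z by ring.
    rewrite Ht. unfold c. rewrite Hr. ring. }
  destruct HT as [[[m Hm] Hk]|(H4 & HQk & Hpar)].
  (* The shift by [|c| / M] leaves the [n] with [M | 2 n], for which [n ^ 2 / M]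
     is an integer because [4 | M]. *)
  - assert (Hs0 : (0 <= sg * (M * q * c'))%Z) by (destruct Hsg; subst sg; nia).
    set (s := Z.to_nat (sg * (M * q * c'))).
    assert (Es : Z.of_nat s = (M * (sg * q * c'))%Z) by (unfold s; rewrite Z2Nat.id by exact Hs0; ring).
    assert (EsR : INR s = (IZR sg * IZR c / IZR M)%R).
    { rewrite INR_IZR_INZ, Es, Ec, !mult_IZR. field. exact HM'. }
    set (x := fun n : nat => phase (INR n * (2 * IZR sg * IZR a / IZR M))).
    assert (Hx : forall s' t, Z.of_nat s' = (M * t)%Z -> forall n, x (n + s')%nat = x n).
    { intros s' t Hs n. apply (phase_sub_Z _ _ (t * 2 * sg * a)%Z).
      rewrite plus_INR, (INR_IZR_INZ s'), Hs, !mult_IZR. field. exact HM'. }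
    apply (shifted_sum_vanishes L s ph D x HphL).
    + apply (HD L (sg * (M * q * c'))%Z). rewrite EL, Ec. ring.
    + apply (Hx L (sg * (M * q * c'))%Z). rewrite EL, Ec. ring.
    + now apply (HD s (sg * q * c')%Z).
    + now apply (Hx s (sg * q * c')%Z).
    + intros n. unfold ph, x. rewrite <- phase_add. apply (phase_sub_Z _ _ (q * c' * a)%Z).
      rewrite plus_INR, EsR, !mult_IZR.
      assert (Ec2 : IZR c = (IZR M * IZR M * IZR q * IZR c')%R) by (rewrite Ec, !mult_IZR; ring).
      assert (Esg : (IZR sg * IZR sg = 1)%R) by (destruct Hsg; subst sg; simpl; lra).
      rewrite <- (Rmult_1_l (IZR q * IZR c' * IZR a)), <- Esg. rewrite Ec2 in *. field.
      repeat split; try assumption; intros E; apply Hc'; rewrite E; ring.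
    + intros n Hn. apply phase_1_integer in Hn. destruct Hn as [p Hp].
      assert (HZ : (a * (2 * (2 * sg * Z.of_nat n)) = p * (2 * M))%Z).
      { apply eq_IZR. rewrite !mult_IZR, <- INR_IZR_INZ.
        replace (IZR p) with (INR n * (2 * IZR sg * IZR a / IZR M))%R. field. exact HM'. }
      destruct (Hrel (2 * (2 * sg * Z.of_nat n))%Z ltac:(exists p; exact HZ)) as [j Hj].
      apply (HD0 n (j * sg)%Z).
      * destruct Hsg; subst sg; lia.
      * rewrite Hk, Hm. exists (u * (m * j * j * (sg * sg)))%Z. ring.
  (* The shift by [|c| / (2 M)], still a multiple of [M], also decides the parity
     of [2 n / M] for the remaining [n]. *)
  - assert (Ec2 : c = (2 * M * (M * k * c'))%Z) by (unfold c; rewrite HQk; ring).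
    assert (Hs0 : (0 <= sg * (M * k * c'))%Z) by (destruct Hsg; subst sg; nia).
    set (s := Z.to_nat (sg * (M * k * c'))).
    assert (Es : Z.of_nat s = (M * (sg * k * c'))%Z) by (unfold s; rewrite Z2Nat.id by exact Hs0; ring).
    assert (EsR : INR s = (IZR sg * IZR c / (2 * IZR M))%R).
    { rewrite INR_IZR_INZ, Es, Ec2, !mult_IZR. field. exact HM'. }
    set (x := fun n : nat => phase (INR n * (IZR sg * IZR a / IZR M) + IZR k * IZR c' * IZR a / 2)).
    assert (Hx : forall s' t, Z.of_nat s' = (M * t)%Z -> forall n, x (n + s')%nat = x n).
    { intros s' t Hs n. apply (phase_sub_Z _ _ (t * sg * a)%Z).
      rewrite plus_INR, (INR_IZR_INZ s'), Hs, !mult_IZR. field. exact HM'. }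
    apply (shifted_sum_vanishes L s ph D x HphL).
    + apply (HD L (sg * (2 * M * k * c'))%Z). rewrite EL, Ec2. ring.
    + apply (Hx L (sg * (2 * M * k * c'))%Z). rewrite EL, Ec2. ring.
    + now apply (HD s (sg * k * c')%Z).
    + now apply (Hx s (sg * k * c')%Z).
    + intros n. unfold ph, x. rewrite <- phase_add. apply (phase_sub_Z _ _ 0%Z).
      rewrite plus_INR, EsR.
      assert (Ec3 : IZR c = (2 * IZR M * IZR M * IZR k * IZR c')%R) by (rewrite Ec2, !mult_IZR; ring).
      assert (Esg : (IZR sg * IZR sg = 1)%R) by (destruct Hsg; subst sg; simpl; lra).
      replace (IZR k * IZR c' * IZR a / 2)%R with (IZR sg * IZR sg * (IZR k * IZR c' * IZR a / 2))%R by (rewrite Esg; ring).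
      rewrite Ec3 in *. field.
      repeat split; try assumption; intros E; apply Hc'; rewrite E; ring.
    + intros n Hn. apply phase_1_integer in Hn. destruct Hn as [p Hp].
      assert (HZ : (a * (2 * sg * Z.of_nat n + M * k * c') = p * (2 * M))%Z).
      { apply eq_IZR. rewrite !mult_IZR, plus_IZR, !mult_IZR, <- INR_IZR_INZ, <- Hp. field. exact HM'. }
      destruct (Hrel _ (ex_intro _ p HZ)) as [j Hj].
      apply (HD0 n (sg * (2 * j - k * c'))%Z).
      * destruct Hsg; subst sg; lia.
      * apply Z.divide_mul_r.
        replace (M * (sg * (2 * j - k * c')) * (sg * (2 * j - k * c')))%Z
          with (sg * sg * (M * ((2 * j - k * c') * (2 * j - k * c'))))%Z by ring.
        replace (sg * sg)%Z with 1%Z by (destruct Hsg; subst sg; ring).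
        set (y := (k * c')%Z) in *.
        destruct (Zeven_odd_dec y) as [Hy|Hy].
        -- apply Zeven_ex in Hy. destruct Hy as [y2 Hy]. rewrite Hy.
           exists (M * ((j - y2) * (j - y2)) - y2)%Z. ring.
        -- assert (HMe : (2 | M)%Z).
           { destruct Hpar as [H|[t H]]; [exact H|]. exfalso. unfold y in Hy. rewrite H in Hy.
             replace (t * 2 * c')%Z with (2 * (t * c'))%Z in Hy by ring.
             apply (Zodd_not_Zeven _ Hy). apply Zeven_2p. }
           destruct HMe as [m Hm]. destruct (Zeven_odd_dec m) as [Hme|Hmo].
           ++ exfalso. apply H4. apply Zeven_ex in Hme. destruct Hme as [m2 Hm2]. exists m2. lia.
           ++ apply Zodd_ex in Hmo, Hy. destruct Hmo as [m2 Hm2], Hy as [y2 Hy2].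
              rewrite Hm, Hm2, Hy2.
              exists ((2 * m2 + 1) * (2 * (j - y2) * (j - y2 - 1)) + m2 - y2)%Z. ring.
Qed.

(** * Theta at the translates by multiples of 1/M *)

Definition frac (u M : Z) : C := RtoC (IZR u / IZR M).

Lemma plus_real_H z x : upper_half_plane z -> upper_half_plane (z + RtoC x).
Proof. unfold upper_half_plane. destruct z. simpl. lra. Qed.

Lemma frac_H z u M : upper_half_plane z -> upper_half_plane (z + frac u M).
Proof. apply plus_real_H. Qed.

(** Conjugation by the translation by [u / M] preserves integrality because
    [M ^ 2 | Q]. The lower right entry is preserved modulo [Q / M], not modulo
    [Q]. *)
Lemma conjugate_by_translation M Q g u : admissible_level M Q ->
  (Q | mc g)%Z -> (Q | ma g - 1)%Z -> (Q | md g - 1)%Z ->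
  exists h, mc h = mc g /\ md h = (md g - Q / M * (mc g / Q) * u)%Z /\
    forall z, upper_half_plane z ->
      moebius h (z + frac u M) = moebius g z + frac u M /\
      denom h (z + frac u M) = denom g z.
Proof.
  intros (HM & HQ & [q Hq] & _) [c' Hc] [p Hp] [r Hr].
  pose proof (level_quotient M Q q HM Hq) as HQM.
  assert (HcQ : (mc g / Q = c')%Z) by (rewrite Hc; apply Z.div_mul; lia).
  set (c1 := (q * c')%Z). set (e := (M * q * (r - p))%Z).
  assert (Hc1 : mc g = (M * M * c1)%Z) by (unfold c1; rewrite Hc, Hq; ring).
  assert (He : (md g - ma g = M * e)%Z).
  { replace (md g - ma g)%Z with ((md g - 1) - (ma g - 1))%Z by ring.
    rewrite Hp, Hr, Hq. unfold e. ring. }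
  pose proof (SL2Z_det g) as D. rewrite Hc1 in D.
  assert (Hdet : ((ma g + M * c1 * u) * (md g - M * c1 * u) - (mb g + e * u - c1 * u * u) * (M * M * c1) = 1)%Z).
  { transitivity (ma g * md g - mb g * (M * M * c1) + M * c1 * u * ((md g - ma g) - M * e))%Z; [ring|].
    rewrite D, He. ring. }
  exists (mkSL2Z _ _ _ _ Hdet). cbn [mc md]. split; [now rewrite Hc1|]. split.
  { rewrite HQM, HcQ. unfold c1. ring. }
  intros z Hz. pose proof (denom_neq_0 g z Hz) as Hd.
  assert (HMC : ZtoC M <> 0) by (apply ZtoC_neq_0; lia).
  assert (Ef : frac u M = ZtoC u / ZtoC M).
  { unfold frac, ZtoC. rewrite <- RtoC_div; [reflexivity|]. intros E. apply eq_IZR in E. lia. }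
  assert (Eden : denom (mkSL2Z _ _ _ _ Hdet) (z + frac u M) = denom g z).
  { unfold denom. cbn [mc md]. rewrite Hc1, Ef, ZtoC_minus, !ZtoC_mult. field. exact HMC. }
  split; [|exact Eden].
  unfold moebius. rewrite Eden. cbn [ma mb mc md]. rewrite Ef.
  unfold Cdiv at 1 3.
  assert (HeC : ZtoC e = (ZtoC (md g) - ZtoC (ma g)) / ZtoC M).
  { rewrite <- ZtoC_minus, He, ZtoC_mult. field. exact HMC. }
  rewrite ZtoC_minus, !ZtoC_plus, !ZtoC_mult, HeC.
  unfold denom in *. rewrite Hc1, !ZtoC_mult in *. field. split; assumption.
Qed.

Lemma theta_law_translate M Q g u z : admissible_level M Q ->
  (Q | mc g)%Z -> (Q | ma g - 1)%Z -> (Q | md g - 1)%Z -> upper_half_plane z ->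
  theta (moebius g z + frac u M) ^ 2 = denom g z * theta (z + frac u M) ^ 2.
Proof.
  intros HA Hc Ha Hd Hz.
  destruct (conjugate_by_translation M Q g u HA Hc Ha Hd) as (h & Ec & Ed & Hh).
  destruct (Hh z Hz) as [<- <-]. destruct HA as (HM & HQ & _ & [r Hr]).
  assert (H4 : (4 | Q)%Z) by (exists (r * M)%Z; rewrite Hr; ring).
  apply theta_law_Gamma1_4; [| |now apply frac_H].
  - rewrite Ec. now apply (Z.divide_trans _ Q).
  - rewrite Ed. replace (md g - Q / M * (mc g / Q) * u - 1)%Z with (md g - 1 + - (Q / M) * ((mc g / Q) * u))%Z by ring.
    apply Z.divide_add_r; [now apply (Z.divide_trans _ Q)|].
    apply Z.divide_mul_l, Z.divide_opp_r. exists r. rewrite Hr.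
    replace (r * (4 * M))%Z with (r * 4 * M)%Z by ring. apply Z.div_mul. lia.
Qed.

(** In the disc coordinate the pole of [g] lies on the unit circle, so that its
    denominator is inverted by a geometric series. *)
Lemma analytic_to_H_moebius g x : analytic_to_H (fun w => moebius g (cayley w) + RtoC x).
Proof.
  set (a := ZtoC (ma g)). set (b := ZtoC (mb g)). set (c := ZtoC (mc g)). set (d := ZtoC (md g)).
  assert (HiH : upper_half_plane Ci) by (unfold upper_half_plane; simpl; lra).
  assert (Hden : d + c * Ci <> 0).
  { pose proof (denom_neq_0 g Ci HiH) as H. unfold denom in H. fold c d in H.
    rewrite Cplus_comm. exact H. }
  assert (HcR : exists c0 d0 : R, c = RtoC c0 /\ d = RtoC d0) by (exists (IZR (mc g)), (IZR (md g)); split; reflexivity).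
  split.
  - set (e := (d - c * Ci) / (d + c * Ci)).
    assert (He : Cmod e = 1%R).
    { unfold e. rewrite Cmod_div by exact Hden.
      assert (E : Cmod (d - c * Ci) = Cmod (d + c * Ci)).
      { destruct HcR as (c0 & d0 & -> & ->). unfold Cmod. f_equal.
        unfold Ci, RtoC, Cmult, Cplus, Cminus, Copp; simpl. ring. }
      rewrite E. apply Rinv_r. intros E0. apply Hden. now apply Cmod_eq_0. }
    apply (analytic_ext (fun w => (/ (d + c * Ci) * (a * (Ci * (1 + w)) + b * (1 + - (1) * w))) * / (1 - e * w) + RtoC x)).
    + intros w Hw. assert (Hne : 1 - w <> 0) by now apply one_minus_neq_0.
      pose proof (cayley_H w Hw) as Hz.
      pose proof (denom_neq_0 g _ Hz) as Hd. f_equal.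
      unfold moebius. unfold denom in *. fold a b c d in Hd |- *.
      assert (Ecay : cayley w = Ci * (1 + w) / (1 - w)) by reflexivity.
      assert (H1 : 1 - e * w <> 0).
      { intros E1. assert (E2 : e * w = 1) by (replace (e * w) with (1 - (1 - e * w)) by ring; rewrite E1; ring).
        apply (f_equal Cmod) in E2. rewrite Cmod_mult, He, Cmod_1 in E2. lra. }
      assert (Hd2 : (d + c * Ci) * (1 - e * w) = (c * cayley w + d) * (1 - w)).
      { rewrite Ecay. unfold e. field. split; assumption. }
      assert (Hnum : a * (Ci * (1 + w)) + b * (1 + - (1) * w) = (a * cayley w + b) * (1 - w)).
      { rewrite Ecay. field. exact Hne. }
      rewrite Hnum.
      transitivity ((a * cayley w + b) * (1 - w) / ((d + c * Ci) * (1 - e * w))); [field; split; assumption|].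
      rewrite Hd2. field. split; assumption.
    + apply analytic_plus; [|apply analytic_const]. apply analytic_mult.
      * apply analytic_scal, analytic_plus; apply analytic_scal.
        -- apply analytic_scal, analytic_plus; [apply analytic_const|apply analytic_id].
        -- apply analytic_plus; [apply analytic_const|apply analytic_scal, analytic_id].
      * apply analytic_inv_linear. lra.
  - intros r Hr. set (K := (Cmod c * (2 / (1 - r)) + Cmod d + 1)%R).
    assert (HK : (1 <= K)%R).
    { unfold K. pose proof (Cmod_ge_0 c). pose proof (Cmod_ge_0 d).
      assert (0 <= 2 / (1 - r))%R by (apply Rlt_le, Rdiv_lt_0_compat; lra).
      assert (0 <= Cmod c * (2 / (1 - r)))%R by now apply Rmult_le_pos. lra. }
    exists ((1 - r) / 4 / K ^ 2)%R.
    assert (HK2 : (0 < K ^ 2)%R) by (apply pow_lt; lra).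
    split; [apply Rdiv_lt_0_compat; lra|]. intros w Hw.
    pose proof (cayley_Im_lower w r Hr Hw) as HI. pose proof (cayley_Cmod_upper w r Hr Hw) as HU.
    assert (Hz : upper_half_plane (cayley w)) by (unfold upper_half_plane; lra).
    replace (Im (moebius g (cayley w) + RtoC x)) with (Im (moebius g (cayley w))) by (destruct (moebius g (cayley w)); simpl; ring).
    rewrite Im_moebius by exact Hz.
    assert (HD : (0 < Cmod (denom g (cayley w)))%R) by (now apply Cmod_gt_0, denom_neq_0).
    assert (HDK : (Cmod (denom g (cayley w)) <= K)%R).
    { unfold denom. fold c d. eapply Rle_trans; [apply Cmod_triangle|]. rewrite Cmod_mult. unfold K.
      pose proof (Cmod_ge_0 c). assert (Cmod c * Cmod (cayley w) <= Cmod c * (2 / (1 - r)))%R by now apply Rmult_le_compat_l. lra. }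
    assert (HD2 : (0 < Cmod (denom g (cayley w)) ^ 2)%R) by now apply pow_lt.
    apply Rmult_le_compat; [lra|left; now apply Rinv_0_lt_compat|exact HI|].
    apply Rinv_le_contravar; [exact HD2|]. apply pow_incr. lra.
Qed.

Lemma theta_near_1 z : (2 <= Im z)%R -> (Cmod (theta z - 1) <= / 4)%R.
Proof.
  intros Hz. assert (HzH : upper_half_plane z) by (unfold upper_half_plane; lra).
  rewrite theta_eq by exact HzH. pose proof (Cmod_e2pi_lt_1 z HzH) as Hq.
  eapply Rle_trans; [apply theta_q_near_1; lra|].
  assert (H9 : (Cmod (e2pi z) <= / 9)%R).
  { rewrite Cmod_e2pi, exp_Ropp. apply Rinv_le_contravar; [lra|].
    eapply Rle_trans; [|apply one_plus_le_exp]. pose proof PI2_3_2. nra. }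
  apply Rle_div_l; lra.
Qed.

Lemma moebius_near_cusp g y : mc g <> 0%Z -> (0 < y)%R ->
  moebius g ((- IZR (md g) / IZR (mc g), y)%R : C) = ((IZR (ma g) / IZR (mc g), / (IZR (mc g) ^ 2 * y))%R : C).
Proof.
  intros Hc Hy. assert (Hc' : IZR (mc g) <> 0%R) by (intros E; apply Hc; now apply eq_IZR).
  pose proof (SL2Z_det g) as D. apply (f_equal IZR) in D. rewrite minus_IZR, !mult_IZR in D.
  set (z := ((- IZR (md g) / IZR (mc g), y)%R : C)).
  assert (Hz : upper_half_plane z) by exact Hy.
  pose proof (denom_neq_0 g z Hz) as Hd.
  assert (Eden : denom g z = ((0, IZR (mc g) * y)%R : C)).
  { unfold denom, z, ZtoC, RtoC, Cmult, Cplus; simpl. f_equal; field; exact Hc'. }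
  unfold moebius. rewrite Eden in *.
  match goal with |- ?A / ?B = ?E => assert (G : A = E * B) end.
  { unfold z, ZtoC, RtoC, Cmult, Cplus; simpl.
    f_equal; [|field; lra].
    replace (IZR (ma g) * (- IZR (md g) / IZR (mc g)) - 0 * y + IZR (mb g))%R
      with (- (IZR (ma g) * IZR (md g) - IZR (mb g) * IZR (mc g)) / IZR (mc g))%R by (field; exact Hc').
    rewrite D. field. lra. }
  rewrite G. field. exact Hd.
Qed.

Lemma phase_half_sqr t : phase (IZR t / 2) * phase (IZR t / 2) = 1.
Proof. rewrite <- phase_add. replace (IZR t / 2 + IZR t / 2)%R with (IZR t) by field. apply phase_Z. Qed.

(** The vertical half-line through [- d / c], which [g] maps to the one above
    the cusp [a / c]. *)
Definition cusp_line (g : SL2Z) (y : R) : C := (- IZR (md g) / IZR (mc g), y)%R.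

Definition gauss_mean (g : SL2Z) : C :=
  2 * (gauss_sum (ma g) (mc g) / INR (Z.to_nat (Z.abs (mc g)))).

Lemma cusp_line_H g y : (0 < y)%R -> upper_half_plane (cusp_line g y).
Proof. intros H. exact H. Qed.

Lemma theta_translate_at_cusp M Q g t y : admissible_level M Q -> (Q | mc g)%Z -> mc g <> 0%Z -> (0 < y)%R ->
  (Cmod (theta (moebius g (cusp_line g y) + frac t M)
     - phase (IZR (t * theta_twist M Q * (mc g / Q)) / 2) * gauss_mean g * gaussian_sum (/ (IZR (mc g) ^ 2 * y)))%C
   <= 4 * INR (Z.to_nat (Z.abs (mc g))) + 1)%R.
Proof.
  intros HA Hc Hc0 Hy. pose proof HA as (HM & HQ & HMM & H4M).
  set (c' := (mc g / Q)%Z). set (k := theta_twist M Q).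
  assert (Ec : mc g = (Q * c')%Z) by (destruct Hc as [r Hr]; unfold c'; rewrite Hr, Z.div_mul by lia; ring).
  assert (HcR : (IZR (mc g) <> 0)%R) by (intros E; apply Hc0; now apply eq_IZR).
  set (eps := (/ (IZR (mc g) ^ 2 * y))%R).
  assert (Heps : (0 < eps)%R) by (apply Rinv_0_lt_compat, Rmult_lt_0_compat; [now apply pow2_gt_0|exact Hy]).
  pose proof (theta_near_cusp (ma g + Q / M * c' * t) (mc g) eps Hc0 Heps) as H.
  pose proof (gauss_sum_twist M Q (ma g) (mb g) (md g) c' t HA) as HG.
  rewrite <- Ec in HG. specialize (HG (SL2Z_det g) Hc0). rewrite HG in H. fold k in H.
  replace (moebius g (cusp_line g y) + frac t M) with ((IZR (ma g + Q / M * c' * t) / IZR (mc g), eps)%R : C).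
  - unfold gauss_mean.
    replace (phase (IZR (t * k * c') / 2) * (2 * (gauss_sum (ma g) (mc g) / INR (Z.to_nat (Z.abs (mc g))))))
      with (2 * (phase (IZR (t * k * c') / 2) * gauss_sum (ma g) (mc g) / INR (Z.to_nat (Z.abs (mc g)))))
      by (unfold Cdiv; ring).
    exact H.
  - unfold cusp_line. rewrite moebius_near_cusp by assumption. unfold frac, RtoC, Cplus; simpl.
    f_equal; [|unfold eps; simpl; ring].
    destruct HMM as [q Hq].
    pose proof (level_quotient M Q q HM Hq) as HQM.
    rewrite HQM, plus_IZR, !mult_IZR.
    assert (Ec2 : IZR (mc g) = (IZR M * IZR M * IZR q * IZR c')%R) by (rewrite Ec, Hq, !mult_IZR; ring).
    assert (HM' : IZR M <> 0%R) by (intros E; apply eq_IZR in E; lia).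
    rewrite Ec2 in *. field. repeat split; try assumption; intros E; apply HcR; rewrite E; ring.
Qed.

(** The transformation law makes theta unbounded near the cusp [a / c]; if the
    Gauss sum vanished it would be bounded there. *)
Lemma gauss_mean_neq_0 M Q g : admissible_level M Q ->
  (Q | mc g)%Z -> (Q | ma g - 1)%Z -> (Q | md g - 1)%Z -> mc g <> 0%Z -> gauss_mean g <> 0.
Proof.
  intros HA Hc Ha Hd Hc0 E.
  assert (HcR : (IZR (mc g) <> 0)%R) by (intros E0; apply Hc0; now apply eq_IZR).
  set (L := INR (Z.to_nat (Z.abs (mc g)))). assert (HL0 : (0 <= L)%R) by apply pos_INR.
  assert (Hac : (0 < Rabs (IZR (mc g)))%R) by now apply Rabs_pos_lt.
  (* At this height [|c z + d| = |c| y] exceeds [4 (4 L + 1) ^ 2], whereas [|theta z| >= 1/2]. *)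
  set (y := (2 + (4 * L + 2) ^ 2 * 4 / Rabs (IZR (mc g)))%R).
  assert (Hy : (2 <= y)%R).
  { assert (0 <= (4 * L + 2) ^ 2 * 4 / Rabs (IZR (mc g)))%R; [|unfold y; lra].
    apply Rle_div_r; [exact Hac|]. rewrite Rmult_0_l. pose proof (pow2_ge_0 (4 * L + 2)). lra. }
  set (z := cusp_line g y).
  assert (Hz : upper_half_plane z) by (apply cusp_line_H; lra).
  pose proof (theta_translate_at_cusp M Q g 0 y HA Hc Hc0 ltac:(lra)) as H0.
  pose proof (theta_law_translate M Q g 0 z HA Hc Ha Hd Hz) as HL.
  rewrite E, Cmult_0_r, Cmult_0_l in H0. fold z L in H0.
  set (T := theta (moebius g z + frac 0 M)) in *. replace (T - 0) with T in H0 by ring.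
  apply (f_equal Cmod) in HL. rewrite Cmod_mult, !Cmod_pow in HL.
  assert (H1 : (/ 2 <= Cmod (theta (z + frac 0 M)))%R).
  { pose proof (theta_near_1 (z + frac 0 M) ltac:(unfold z, cusp_line, frac; simpl; lra)) as Hn.
    set (X := theta (z + frac 0 M)) in *.
    assert (Cmod 1 <= Cmod X + Cmod (X - 1))%R; [|rewrite Cmod_1 in *; lra].
    replace (RtoC 1) with (X + - (X - 1)) at 1 by ring. rewrite <- (Cmod_opp (X - 1)). apply Cmod_triangle. }
  assert (Hden : Cmod (denom g z) = (Rabs (IZR (mc g)) * y)%R).
  { replace (denom g z) with (Ci * RtoC (IZR (mc g) * y)).
    - rewrite Cmod_mult, Cmod_Ci, Cmod_R, Rabs_mult, (Rabs_pos_eq y) by lra. ring.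
    - unfold denom, z, cusp_line, ZtoC, Ci, RtoC, Cmult, Cplus; simpl. f_equal; field; exact HcR. }
  rewrite Hden in HL.
  assert (H2 : (/ 4 <= Cmod (theta (z + frac 0 M)) ^ 2)%R) by (simpl; nra).
  assert (H3 : (Cmod T ^ 2 <= (4 * L + 1) ^ 2)%R) by (apply pow_incr; split; [apply Cmod_ge_0|exact H0]).
  assert (H4 : (Rabs (IZR (mc g)) * y = 2 * Rabs (IZR (mc g)) + (4 * L + 2) ^ 2 * 4)%R) by (unfold y; field; lra).
  rewrite HL, H4 in H3.
  assert (H5 : ((2 * Rabs (IZR (mc g)) + (4 * L + 2) ^ 2 * 4) * / 4 <= (4 * L + 1) ^ 2)%R).
  { eapply Rle_trans; [|exact H3]. apply Rmult_le_compat_l; [|exact H2].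
    pose proof (pow2_ge_0 (4 * L + 2)). lra. }
  simpl in H5. nra.
Qed.

(** Both products are asymptotic to [wu * wv * gauss_mean g] times the Gaussian
    sum, which tends to infinity, so they cannot cancel. *)
Lemma theta_pair_no_cancellation M Q g u v : admissible_level M Q ->
  (Q | mc g)%Z -> (Q | ma g - 1)%Z -> (Q | md g - 1)%Z -> mc g <> 0%Z ->
  let w t := phase (IZR (t * theta_twist M Q * (mc g / Q)) / 2) in
  exists z, upper_half_plane z /\
    w v * (theta (moebius g z + frac u M) * theta (z + frac v M)) +
    w u * (theta (moebius g z + frac v M) * theta (z + frac u M)) <> 0.
Proof.
  intros HA Hc Ha Hd Hc0 w.
  set (L := INR (Z.to_nat (Z.abs (mc g)))). assert (HL0 : (0 <= L)%R) by apply pos_INR.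
  assert (HcR : (IZR (mc g) <> 0)%R) by (intros E; apply Hc0; now apply eq_IZR).
  assert (Hc2 : (0 < IZR (mc g) ^ 2)%R) by (apply pow2_gt_0; exact HcR).
  set (al := gauss_mean g).
  assert (Hal : (0 < Cmod al)%R) by (apply Cmod_gt_0; now apply (gauss_mean_neq_0 M Q g)).
  destruct (gaussian_sum_unbounded ((4 * L + 2) * 2 / Cmod al)) as (e0 & He0 & HS).
  assert (Hce : (0 < IZR (mc g) ^ 2 * e0)%R) by now apply Rmult_lt_0_compat.
  assert (Hie : (0 < / (IZR (mc g) ^ 2 * e0))%R) by now apply Rinv_0_lt_compat.
  set (y := (2 + / (IZR (mc g) ^ 2 * e0))%R). assert (Hy : (2 <= y)%R) by (unfold y; lra).
  set (eps := (/ (IZR (mc g) ^ 2 * y))%R).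
  assert (Hey : (0 < eps <= e0)%R).
  { split; [apply Rinv_0_lt_compat, Rmult_lt_0_compat; lra|].
    unfold eps. rewrite <- (Rinv_inv e0). apply Rinv_le_contravar; [now apply Rinv_0_lt_compat|].
    replace (/ e0)%R with (IZR (mc g) ^ 2 * / (IZR (mc g) ^ 2 * e0))%R by (field; lra).
    apply Rmult_le_compat_l; [lra|unfold y; lra]. }
  specialize (HS eps Hey). set (S0 := gaussian_sum eps) in *.
  set (z := cusp_line g y). exists z. split; [apply cusp_line_H; lra|]. intros HAB.
  pose proof (theta_translate_at_cusp M Q g u y HA Hc Hc0 ltac:(lra)) as Cu.
  pose proof (theta_translate_at_cusp M Q g v y HA Hc Hc0 ltac:(lra)) as Cv.
  fold eps S0 al L z (w u) in Cu. fold eps S0 al L z (w v) in Cv.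
  pose proof (theta_near_1 (z + frac u M) ltac:(unfold z, cusp_line, frac; simpl; lra)) as Nu.
  pose proof (theta_near_1 (z + frac v M) ltac:(unfold z, cusp_line, frac; simpl; lra)) as Nv.
  set (Tu := theta (moebius g z + frac u M)) in *. set (Tv := theta (moebius g z + frac v M)) in *.
  set (Xu := theta (z + frac u M)) in *. set (Xv := theta (z + frac v M)) in *.
  assert (Hwu : Cmod (w u) = 1%R) by apply Cmod_phase. assert (Hwv : Cmod (w v) = 1%R) by apply Cmod_phase.
  set (wu := w u) in *. set (wv := w v) in *. clearbody wu wv.
  set (eu := Tu - wu * al * S0) in *. set (ev := Tv - wv * al * S0) in *.
  set (du := Xu - 1) in *. set (dv := Xv - 1) in *.
  assert (Key : 2 * (wu * wv) * al * S0
     = - (wu * wv * al * S0 * (du + dv)) + - (wv * (eu * (1 + dv))) + - (wu * (ev * (1 + du)))).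
  { transitivity (2 * (wu * wv) * al * S0 - (wv * (Tu * Xv) + wu * (Tv * Xu))); [rewrite HAB; ring|].
    unfold eu, ev, du, dv. ring. }
  apply (f_equal Cmod) in Key.
  assert (HS0 : (0 <= S0)%R).
  { eapply Rle_trans; [|exact HS]. apply Rle_div_r; [exact Hal|]. lra. }
  assert (K1 : Cmod (2 * (wu * wv) * al * S0) = (2 * (Cmod al * S0))%R).
  { rewrite !Cmod_mult, Hwu, Hwv, !Cmod_R, !Rabs_pos_eq by lra. ring. }
  assert (K2 : (Cmod (- (wu * wv * al * S0 * (du + dv))) <= Cmod al * S0 * / 2)%R).
  { rewrite Cmod_opp, !Cmod_mult, Hwu, Hwv, !Cmod_R, Rabs_pos_eq by lra. rewrite !Rmult_1_l.
    apply Rmult_le_compat_l; [apply Rmult_le_pos; lra|].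
    eapply Rle_trans; [apply Cmod_triangle|]. lra. }
  assert (K3 : forall w e d, Cmod w = 1%R -> (Cmod e <= 4 * L + 1)%R -> (Cmod d <= / 4)%R ->
     (Cmod (- (w * (e * (1 + d)))) <= (4 * L + 1) * (5 / 4))%R).
  { intros w' e d Hw He Hd'. rewrite Cmod_opp, !Cmod_mult, Hw, Rmult_1_l.
    apply Rmult_le_compat; [apply Cmod_ge_0|apply Cmod_ge_0|exact He|].
    eapply Rle_trans; [apply Cmod_triangle|]. rewrite Cmod_1. lra. }
  pose proof (K3 wv eu dv Hwv Cu Nv) as K4. pose proof (K3 wu ev du Hwu Cv Nu) as K5.
  assert (K6 := Cmod_triangle (- (wu * wv * al * S0 * (du + dv)) + - (wv * (eu * (1 + dv)))) (- (wu * (ev * (1 + du))))).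
  assert (K7 := Cmod_triangle (- (wu * wv * al * S0 * (du + dv))) (- (wv * (eu * (1 + dv))))).
  apply (Rle_div_l _ _ (Cmod al)) in HS; [|exact Hal]. lra.
Qed.

Lemma theta_pair_translation M Q g u v z : admissible_level M Q -> mc g = 0%Z ->
  (Q | md g - 1)%Z -> upper_half_plane z ->
  theta (moebius g z + frac u M) * theta (z + frac v M) = theta (moebius g z + frac v M) * theta (z + frac u M).
Proof.
  intros (HM & HQ & _ & [r Hr]) Hc0 Hd Hz.
  pose proof (SL2Z_det g) as D. rewrite Hc0 in D.
  assert (HQ4 : (4 | Q)%Z) by (exists (r * M)%Z; rewrite Hr; ring).
  assert (Hd1 : md g = 1%Z).
  { assert (Hdv : (md g | 1)%Z) by (exists (ma g); lia). apply Z.divide_1_r in Hdv.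
    apply (Z.divide_trans 4) in Hd; [|exact HQ4]. destruct Hd as [t Ht]. lia. }
  assert (Ha1 : ma g = 1%Z) by (rewrite Hd1 in D; lia).
  assert (Em : moebius g z = z + ZtoC (mb g)).
  { unfold moebius, denom. rewrite Ha1, Hc0, Hd1. change (ZtoC 1) with (RtoC 1). change (ZtoC 0) with (RtoC 0). field. }
  rewrite Em. replace (z + ZtoC (mb g) + frac u M) with (z + frac u M + ZtoC (mb g)) by ring.
  replace (z + ZtoC (mb g) + frac v M) with (z + frac v M + ZtoC (mb g)) by ring.
  rewrite !theta_period by now apply frac_H. ring.
Qed.

(** The squares of both sides agree, and the functions analytic on the disc
    form an integral domain, so the two sides agree up to a global sign; the
    behaviour at the cusp [a / c] determines it. *)
Lemma theta_pair M Q g u v z : admissible_level M Q ->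
  (Q | mc g)%Z -> (Q | ma g - 1)%Z -> (Q | md g - 1)%Z -> upper_half_plane z ->
  phase (IZR (v * theta_twist M Q * (mc g / Q)) / 2) * (theta (moebius g z + frac u M) * theta (z + frac v M)) =
  phase (IZR (u * theta_twist M Q * (mc g / Q)) / 2) * (theta (moebius g z + frac v M) * theta (z + frac u M)).
Proof.
  intros HA Hc Ha Hd Hz.
  destruct (Z.eq_dec (mc g) 0) as [Hc0|Hc0].
  { rewrite (theta_pair_translation M Q g u v z HA Hc0 Hd Hz), Hc0, Z.div_0_l, !Z.mul_0_r by (destruct HA; lia). ring. }
  pose proof (theta_pair_no_cancellation M Q g u v HA Hc Ha Hd Hc0) as (z1 & Hz1 & Hne).
  set (wu := phase (IZR (u * theta_twist M Q * (mc g / Q)) / 2)) in *.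
  set (wv := phase (IZR (v * theta_twist M Q * (mc g / Q)) / 2)) in *.
  assert (Hwu : wu * wu = 1) by apply phase_half_sqr. assert (Hwv : wv * wv = 1) by apply phase_half_sqr.
  set (A := fun z => wv * (theta (moebius g z + frac u M) * theta (z + frac v M))).
  set (B := fun z => wu * (theta (moebius g z + frac v M) * theta (z + frac u M))).
  change (A z = B z). change (A z1 + B z1 <> 0) in Hne.
  assert (An : forall x, analytic (fun w => theta (cayley w + RtoC x))).
  { intros x. apply (analytic_ext (fun w => theta (moebius (translation 0) (cayley w) + RtoC x))).
    - intros w _. unfold moebius, denom. cbn [ma mb mc md translation].
      change (ZtoC 1) with (RtoC 1). change (ZtoC 0) with (RtoC 0). do 2 f_equal. field.
    - apply (analytic_theta (fun w => moebius (translation 0) (cayley w) + RtoC x)), analytic_to_H_moebius. }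
  assert (Ang : forall x, analytic (fun w => theta (moebius g (cayley w) + RtoC x))).
  { intros x. apply (analytic_theta (fun w => moebius g (cayley w) + RtoC x)), analytic_to_H_moebius. }
  assert (AA : analytic (fun w => A (cayley w))) by (apply analytic_scal, analytic_mult; [apply Ang|apply An]).
  assert (AB : analytic (fun w => B (cayley w))) by (apply analytic_scal, analytic_mult; [apply Ang|apply An]).
  assert (Hsq : forall z, upper_half_plane z -> (A z - B z) * (A z + B z) = 0).
  { intros t Ht. pose proof (theta_law_translate M Q g u t HA Hc Ha Hd Ht) as Lu.
    pose proof (theta_law_translate M Q g v t HA Hc Ha Hd Ht) as Lv.
    transitivity (wv * wv * (theta (moebius g t + frac u M) ^ 2 * theta (t + frac v M) ^ 2)
       - wu * wu * (theta (moebius g t + frac v M) ^ 2 * theta (t + frac u M) ^ 2)); [unfold A, B; ring|].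
    rewrite Lu, Lv, Hwu, Hwv. ring. }
  destruct (analytic_integral_domain (fun w => A (cayley w) + - (1) * B (cayley w)) (fun w => A (cayley w) + B (cayley w))) as [H|H].
  - apply analytic_plus; [exact AA|]. now apply analytic_scal.
  - now apply analytic_plus.
  - intros w Hw. rewrite <- (Hsq (cayley w)) by (apply cayley_H; lra). ring.
  - destruct (cayley_surj z Hz) as (w & Hw & <-). specialize (H w Hw).
    replace (A (cayley w)) with (A (cayley w) + - (1) * B (cayley w) + B (cayley w)) by ring. rewrite H. ring.
  - exfalso. destruct (cayley_surj z1 Hz1) as (w & Hw & <-). exact (Hne (H w Hw)).
Qed.

(** * A maximum principle for SL_2(Z)-invariant functions *)

Lemma inversion_det : (0 * 0 - -1 * 1 = 1)%Z. Proof. reflexivity. Qed.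
Definition inversion : SL2Z := mkSL2Z 0 (-1) 1 0 inversion_det.

Lemma moebius_translation n z : moebius (translation n) z = z + ZtoC n.
Proof.
  unfold moebius, denom. cbn [ma mb mc md translation].
  change (ZtoC 1) with (RtoC 1). change (ZtoC 0) with (RtoC 0). field.
Qed.

Lemma reduce_to_strip z : upper_half_plane z ->
  exists n : Z, (Re (z + ZtoC n) ^ 2 <= / 4)%R /\ Im (z + ZtoC n) = Im z.
Proof.
  intros Hz. destruct (archimed (Re z - / 2)) as [H1 H2].
  exists (- up (Re z - / 2))%Z. destruct z as [x y]. simpl in *. rewrite opp_IZR. split; [nra|ring].
Qed.

(** Each inversion of a point of the strip below height [3/5] multiplies the
    height by at least [1 / (1/4 + 9/25) = 100/61]. *)
Lemma reach_height_3_5 z : upper_half_plane z -> exists g, (3 / 5 <= Im (moebius g z))%R.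
Proof.
  assert (Hstep : forall n z, upper_half_plane z -> (3 / 5 * (61 / 100) ^ n <= Im z)%R ->
    exists g, (3 / 5 <= Im (moebius g z))%R).
  { induction n as [|n IH]; intros t Ht Hn.
    - exists (translation 0). rewrite moebius_translation. destruct t as [x y]. simpl in *. lra.
    - destruct (Rle_lt_dec (3 / 5) (Im t)) as [Hy|Hy].
      { exists (translation 0). rewrite moebius_translation. destruct t as [x y]. simpl in *. lra. }
      destruct (reduce_to_strip t Ht) as (m & Hm & HIm).
      set (t1 := t + ZtoC m) in *. assert (Ht1 : upper_half_plane t1) by (unfold upper_half_plane in *; lra).
      destruct (IH (moebius inversion t1)) as [g Hg].
      + now apply moebius_H.
      + rewrite Im_moebius by exact Ht1.
        assert (Ed : (Cmod (denom inversion t1) ^ 2 = Re t1 ^ 2 + Im t1 ^ 2)%R).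
        { rewrite <- Cmod_sqr. do 2 f_equal. unfold denom. cbn [mc md inversion].
          change (ZtoC 1) with (RtoC 1). change (ZtoC 0) with (RtoC 0). ring. }
        assert (Hp : (0 < Cmod (denom inversion t1) ^ 2)%R) by now apply pow_lt, Cmod_gt_0, denom_neq_0.
        apply (Rle_div_r _ _ (Cmod (denom inversion t1) ^ 2)); [exact Hp|].
        unfold upper_half_plane in Ht. rewrite Ed, HIm. rewrite HIm in Ed.
        assert (Hb : (Re t1 ^ 2 + Im t ^ 2 <= 61 / 100)%R) by (simpl in *; nra).
        assert (0 <= 3 / 5 * (61 / 100) ^ n)%R by (assert (0 <= (61 / 100) ^ n)%R by (apply pow_le; lra); lra).
        simpl in Hn. simpl in Hb |- *. nra.
      + exists (mulSL2Z g (mulSL2Z inversion (translation m))).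
        rewrite moebius_mul, moebius_mul, moebius_translation by exact Ht. exact Hg. }
  intros Hz. unfold upper_half_plane in Hz.
  destruct (pow_lt_1_zero (61 / 100) ltac:(rewrite Rabs_pos_eq; lra) (Im z) Hz) as [N HN].
  apply (Hstep N z Hz). specialize (HN N (Nat.le_refl N)). rewrite Rabs_pos_eq in HN by (apply pow_le; lra).
  assert (0 <= (61 / 100) ^ N)%R by (apply pow_le; lra). lra.
Qed.

Lemma e2pi_div_height h (z : C) : (0 < h)%nat -> Cmod (e2pi (z / INR h)) = exp (- (2 * PI * (Im z / INR h))).
Proof.
  intros Hh. rewrite Cmod_e2pi. do 3 f_equal. assert (0 < INR h)%R by now apply lt_0_INR.
  destruct z as [x y]. unfold Cdiv, Cinv, Cmult, RtoC; simpl. field. lra.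
Qed.

Lemma e2pi_polar h x y : (0 < h)%nat ->
  e2pi (((INR h * x / (2 * PI), y)%R : C) / INR h) = RtoC (exp (- (2 * PI * (y / INR h)))) * cis x.
Proof.
  intros Hh. assert (0 < INR h)%R by now apply lt_0_INR. pose proof PI_RGT_0.
  unfold e2pi. replace (RtoC (2 * PI) * Ci * (((INR h * x / (2 * PI), y)%R : C) / INR h))
    with ((- (2 * PI * (y / INR h)), x)%R : C).
  - unfold Cexp. reflexivity.
  - unfold Ci, Cdiv, Cinv, Cmult, RtoC; simpl. f_equal; field; lra.
Qed.

Definition invariant (Phi : C -> R) : Prop :=
  forall g z, upper_half_plane z -> Phi (moebius g z) = Phi z.

(** Where [Phi] is large it must be large at some point of height at least
    [3/5]; there, moving down to [lambda] times the height, the Cauchy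
    estimates for a high power of [p] beat the factor lost on [y ^ w]. The
    high power makes the constant [1 - eps0] harmless. *)
Lemma invariant_form_vanishes (Phi : C -> R) (p : C -> C) (h : nat) (s w : R) :
  analytic p -> (0 < h)%nat -> (0 <= w)%R -> (w < 6 / 5 * PI * s)%R -> invariant Phi ->
  (forall z, upper_half_plane z ->
     Phi z = (Cmod (p (e2pi (z / INR h))) * (exp (- (2 * PI * s * Im z)) * Rpower (Im z) w))%R) ->
  forall z, upper_half_plane z -> Phi z = 0%R.
Proof.
  intros Hp Hh Hw Hws Hinv HPhi. pose proof PI_RGT_0 as HPI.
  assert (Hh' : (0 < INR h)%R) by now apply lt_0_INR.
  assert (Hs : (0 < PI * s)%R) by lra.
  set (W := (6 / 5 * PI * s)%R) in *. assert (HW : (0 < W)%R) by (unfold W; lra).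
  set (lam := ((1 + w / W) / 2)%R).
  assert (Hlam : (0 < lam < 1 /\ w < lam * W)%R).
  { assert (0 <= w / W < 1)%R by (split; [apply Rle_div_r; lra|apply Rlt_div_l; lra]).
    unfold lam. split; [lra|].
    replace ((1 + w / W) / 2 * W)%R with ((W + w) / 2)%R by (field; lra). lra. }
  destruct Hlam as [Hlam Hlw]. clearbody lam.
  set (kap := exp ((1 - lam) * (w / lam - W))).
  assert (Hkap : (0 <= kap < 1)%R).
  { split; [left; apply exp_pos|]. unfold kap. apply Rlt_le_trans with (exp 0); [apply exp_increasing|rewrite exp_0; lra].
    assert (Hq : (w / lam < W)%R) by (apply (Rlt_div_l w W lam); lra).
    assert (0 < (1 - lam) * (W - w / lam))%R by (apply Rmult_lt_0_compat; lra).
    replace ((1 - lam) * (w / lam - W))%R with (- ((1 - lam) * (W - w / lam)))%R by ring. lra. }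
  set (e0 := exp (- (2 * PI * ((1 - lam) * (3 / 5) / INR h)))).
  assert (He0 : (0 <= e0 < 1)%R).
  { apply exp_neg_bounds. apply Rmult_lt_0_compat; [lra|]. apply Rdiv_lt_0_compat; [nra|lra]. }
  destruct (geom_lim_0 (/ (1 - e0)) kap (/ 2) Hkap ltac:(lra)) as [N0 HN0].
  set (N := S N0). specialize (HN0 N ltac:(unfold N; lia)).
  assert (Hpos : forall z, upper_half_plane z -> (0 <= Phi z)%R).
  { intros z Hz. rewrite HPhi by exact Hz. apply Rmult_le_pos; [apply Cmod_ge_0|].
    apply Rmult_le_pos; left; apply exp_pos. }
  assert (Hhalve : forall X, (forall z, upper_half_plane z -> (Phi z ^ N <= X)%R) ->
     forall z, upper_half_plane z -> (Phi z ^ N <= X / 2)%R).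
  { intros X HX.
    assert (Hhigh : forall z, (3 / 5 <= Im z)%R -> (Phi z ^ N <= X / 2)%R).
    2:{ intros z Hz. destruct (reach_height_3_5 z Hz) as [g Hg]. rewrite <- (Hinv g z Hz). now apply Hhigh. }
    intros z Hz3. assert (Hz : upper_half_plane z) by (unfold upper_half_plane; lra).
    assert (X0 : (0 <= X)%R) by (eapply Rle_trans; [|apply (HX z Hz)]; apply pow_le, Hpos, Hz).
    set (y0 := Im z) in *. set (y1 := (lam * y0)%R). assert (Hy1 : (0 < y1)%R) by (unfold y1; nra).
    set (r1 := exp (- (2 * PI * (y1 / INR h)))). set (r0 := exp (- (2 * PI * (y0 / INR h)))).
    assert (Hr1 : (0 < r1 < 1)%R).
    { split; [apply exp_pos|]. apply exp_neg_bounds. apply Rmult_lt_0_compat; [lra|now apply Rdiv_lt_0_compat]. }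
    assert (Hr01 : (0 <= r0 / r1 <= e0)%R).
    { replace (r0 / r1)%R with (exp (- (2 * PI * ((1 - lam) * y0 / INR h)))).
      - split; [left; apply exp_pos|]. apply exp_le, Ropp_le_contravar. apply Rmult_le_compat_l; [lra|].
        apply Rmult_le_compat_r; [left; now apply Rinv_0_lt_compat|]. apply Rmult_le_compat_l; lra.
      - assert (E : r0 = (exp (- (2 * PI * ((1 - lam) * y0 / INR h))) * r1)%R)
          by (unfold r0, r1; rewrite <- exp_plus; f_equal; unfold y1; field; lra).
        rewrite E. field. lra. }
    set (wt := fun y : R => (exp (- (2 * PI * s * y)) * Rpower y w)%R).
    assert (Hwt : forall y, (0 < wt y)%R) by (intros; apply Rmult_lt_0_compat; apply exp_pos).
    destruct (analytic_pow p N Hp) as [c Hc].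
    assert (Hcauchy : forall n, (Cmod (c n) * r1 ^ n <= X / wt y1 ^ N)%R).
    { intros n. apply (cauchy_estimate _ _ r1 _ n Hc Hr1). intros x.
      set (v := ((INR h * x / (2 * PI), y1)%R : C)).
      assert (Hv : upper_half_plane v) by exact Hy1.
      specialize (HX v Hv). rewrite (HPhi v Hv) in HX. change (Im v) with y1 in HX.
      fold (wt y1) in HX. unfold v in HX. rewrite e2pi_polar in HX by exact Hh. fold r1 in HX.
      rewrite Rpow_mult_distr in HX. rewrite Cmod_pow.
      apply (Rle_div_r _ _ (wt y1 ^ N)); [now apply pow_lt|exact HX]. }
    assert (Hu : Cmod (e2pi (z / INR h)) = r0) by now apply e2pi_div_height.
    assert (Hr0 : (0 < r0 < 1)%R).
    { split; [apply exp_pos|]. apply exp_neg_bounds. apply Rmult_lt_0_compat; [lra|apply Rdiv_lt_0_compat; lra]. }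
    assert (HG : (Cmod (p (e2pi (z / INR h)) ^ N)%C <= X / wt y1 ^ N * / (1 - e0))%R).
    { eapply Rle_trans; [apply (is_Cseries_dom _ (fun n => X / wt y1 ^ N * (r0 / r1) ^ n)%R _ (Hc (e2pi (z / INR h)) ltac:(rewrite Hu; lra)))|].
      - intros n. rewrite Cmod_mult, Cmod_pow, Hu.
        replace (r0 ^ n)%R with (r1 ^ n * (r0 / r1) ^ n)%R by (rewrite <- Rpow_mult_distr; f_equal; field; lra).
        rewrite <- Rmult_assoc. apply Rmult_le_compat_r; [apply pow_le; lra|apply Hcauchy].
      - apply ex_series_geom_scal. lra.
      - rewrite Series_geom_scal by lra. apply Rmult_le_compat_l.
        + apply Rle_div_r; [now apply pow_lt|lra].
        + apply Rinv_le_contravar; lra. }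
    rewrite (HPhi z Hz). fold y0. fold (wt y0). rewrite Rpow_mult_distr, <- Cmod_pow.
    assert (Hratio : (wt y0 <= kap * wt y1)%R).
    { unfold wt, kap, Rpower. rewrite <- !exp_plus. apply exp_le.
      assert (Hln : (ln y0 = ln y1 - ln lam)%R) by (unfold y1; rewrite ln_mult by lra; ring).
      assert (Hlnl : (- ln lam <= (1 - lam) / lam)%R).
      { rewrite <- ln_Rinv by lra. replace ((1 - lam) / lam)%R with (/ lam - 1)%R by (field; lra).
        pose proof (one_plus_le_exp (ln (/ lam))) as H. rewrite exp_ln in H by (apply Rinv_0_lt_compat; lra). lra. }
      assert (Hwl : (w * - ln lam <= w * ((1 - lam) / lam))%R) by now apply Rmult_le_compat_l.
      rewrite Hln.
      replace ((1 - lam) * (w / lam - W))%R with (w * ((1 - lam) / lam) - (1 - lam) * W)%R by (field; lra).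
      assert (HWy : ((1 - lam) * W <= 2 * PI * s * (y0 - y1))%R).
      { unfold y1, W. replace (2 * PI * s * (y0 - lam * y0))%R with ((1 - lam) * (2 * (PI * s) * y0))%R by ring.
        apply Rmult_le_compat_l; [lra|]. nra. }
      lra. }
    assert (Hw1 : (0 < wt y1 ^ N)%R) by now apply pow_lt.
    assert (Hpw : (wt y0 ^ N <= kap ^ N * wt y1 ^ N)%R).
    { rewrite <- Rpow_mult_distr. apply pow_incr. split; [left; apply Hwt|exact Hratio]. }
    assert (Hi : (0 < / (1 - e0))%R) by (apply Rinv_0_lt_compat; lra).
    eapply Rle_trans; [apply Rmult_le_compat; [apply Cmod_ge_0|apply pow_le; left; apply Hwt|exact HG|exact Hpw]|].
    replace (X / wt y1 ^ N * / (1 - e0) * (kap ^ N * wt y1 ^ N))%R with (X * (/ (1 - e0) * kap ^ N))%R by (field; lra).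
    apply Rmult_le_compat_l; lra. }
  assert (Hbd : exists B, forall z, upper_half_plane z -> (Phi z <= B)%R).
  { set (r := exp (- (2 * PI * (3 / 5 / INR h)))).
    destruct (analytic_uniform_bound p r Hp) as [B HB].
    { apply exp_neg_bounds. apply Rmult_lt_0_compat; [lra|apply Rdiv_lt_0_compat; lra]. }
    exists B.
    assert (Hhigh : forall z, (3 / 5 <= Im z)%R -> (Phi z <= B)%R).
    2:{ intros z Hz. destruct (reach_height_3_5 z Hz) as [g Hg]. rewrite <- (Hinv g z Hz). now apply Hhigh. }
    intros z Hz3. assert (Hz : upper_half_plane z) by (unfold upper_half_plane; lra).
    rewrite (HPhi z Hz).
    assert (H1 : (Cmod (p (e2pi (z / INR h))) <= B)%R).
    { apply HB. rewrite e2pi_div_height by exact Hh. apply exp_le, Ropp_le_contravar.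
      apply Rmult_le_compat_l; [lra|]. apply Rmult_le_compat_r; [left; now apply Rinv_0_lt_compat|exact Hz3]. }
    assert (H2 : (exp (- (2 * PI * s * Im z)) * Rpower (Im z) w <= 1)%R).
    { unfold Rpower. rewrite <- exp_plus. apply Rle_trans with (exp 0); [apply exp_le|rewrite exp_0; lra].
      pose proof (one_plus_le_exp (ln (Im z))) as H. rewrite exp_ln in H by exact Hz.
      assert (w * ln (Im z) <= w * Im z)%R by (apply Rmult_le_compat_l; lra).
      assert (w * Im z <= 2 * PI * s * Im z)%R by (apply Rmult_le_compat_r; unfold W in *; lra). lra. }
    pose proof (Cmod_ge_0 (p (e2pi (z / INR h)))).
    apply (Rmult_le_compat_l (Cmod (p (e2pi (z / INR h))))) in H2; lra. }
  destruct Hbd as [B HB].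
  assert (Hall : forall j z, upper_half_plane z -> (Phi z ^ N <= B ^ N * (/ 2) ^ j)%R).
  { induction j as [|j IH]; intros z Hz.
    - rewrite pow_O, Rmult_1_r. apply (pow_incr (Phi z) B N). split; [now apply Hpos|now apply HB].
    - pose proof (Hhalve _ IH z Hz) as H.
      change ((/ 2) ^ S j)%R with (/ 2 * (/ 2) ^ j)%R. lra. }
  intros z Hz. destruct (Req_dec (Phi z) 0) as [E|E]; [exact E|exfalso].
  assert (HP : (0 < Phi z ^ N)%R) by (apply pow_lt; specialize (Hpos z Hz); lra).
  destruct (geom_lim_0 (B ^ N) (/ 2) _ ltac:(lra) HP) as [j Hj].
  specialize (Hj j (Nat.le_refl j)). specialize (Hall j z Hz). lra.
Qed.

(** * Products over the cosets of Gamma_1(Q) *)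

(** [|F(z)| y ^ w] for a function [F] on the upper half-plane with an
    expansion in powers of [q ^ (1 / h)], vanishing to order [s] in [q]. *)
Definition q_form (s w : R) (psi : C -> R) : Prop :=
  exists (p : C -> C) (h : nat), analytic p /\ (0 < h)%nat /\
    forall z, upper_half_plane z ->
      psi z = (Cmod (p (e2pi (z / INR h))) * (exp (- (2 * PI * s * Im z)) * Rpower (Im z) w))%R.

Lemma e2pi_refine h k z : (0 < h)%nat -> (0 < k)%nat -> e2pi (z / INR h) = 1 * e2pi (z / INR (h * k)) ^ k.
Proof.
  intros Hh Hk. rewrite e2pi_pow, Cmult_1_l. f_equal. rewrite mult_INR, RtoC_mult.
  assert (RtoC (INR h) <> 0) by (apply RtoC_neq_0; apply lt_0_INR in Hh; lra).
  assert (RtoC (INR k) <> 0) by (apply RtoC_neq_0; apply lt_0_INR in Hk; lra).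
  field. split; assumption.
Qed.

Lemma e2pi_refine' h k z : (0 < h)%nat -> (0 < k)%nat -> e2pi (z / INR k) = 1 * e2pi (z / INR (h * k)) ^ h.
Proof. intros Hh Hk. rewrite Nat.mul_comm. now apply e2pi_refine. Qed.

Lemma q_form_ext s w psi psi' : (forall z, upper_half_plane z -> psi z = psi' z) ->
  q_form s w psi -> q_form s w psi'.
Proof.
  intros H (p & h & Hp & Hh & E). exists p, h. repeat split; try assumption.
  intros z Hz. rewrite <- H by exact Hz. now apply E.
Qed.

Lemma q_form_mult s1 w1 psi1 s2 w2 psi2 : q_form s1 w1 psi1 -> q_form s2 w2 psi2 ->
  q_form (s1 + s2) (w1 + w2) (fun z => psi1 z * psi2 z)%R.
Proof.
  intros (p & h & Hp & Hh & E) (p' & h' & Hp' & Hh' & E').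
  exists (fun u => p (1 * u ^ h') * p' (1 * u ^ h)), (h * h')%nat.
  assert (H1 : (Cmod 1 <= 1)%R) by (rewrite Cmod_1; lra).
  split; [apply analytic_mult; now apply analytic_comp_monomial|]. split; [nia|].
  intros z Hz. rewrite E, E', <- e2pi_refine, <- e2pi_refine' by assumption.
  rewrite Cmod_mult, Rpower_plus.
  replace (- (2 * PI * (s1 + s2) * Im z))%R with (- (2 * PI * s1 * Im z) + - (2 * PI * s2 * Im z))%R by ring.
  rewrite exp_plus. ring.
Qed.

Lemma q_form_1 : q_form 0 0 (fun _ => 1%R).
Proof.
  exists (fun _ => 1), 1%nat. split; [apply analytic_const|]. split; [lia|]. intros z Hz.
  rewrite Cmod_1, Rpower_O by exact Hz. replace (- (2 * PI * 0 * Im z))%R with 0%R by ring. rewrite exp_0. ring.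
Qed.

Lemma e2pi_positive_real h x : (0 < h)%nat -> (0 < x < 1)%R ->
  exists z, upper_half_plane z /\ e2pi (z / INR h) = RtoC x.
Proof.
  intros Hh Hx. pose proof PI_RGT_0. assert (Hh' : (0 < INR h)%R) by now apply lt_0_INR.
  assert (Hl : (ln x < 0)%R) by (rewrite <- ln_1; apply ln_increasing; lra).
  exists ((INR h * 0 / (2 * PI), - ln x * INR h / (2 * PI))%R : C). split.
  - unfold upper_half_plane. simpl. apply Rdiv_lt_0_compat; nra.
  - rewrite e2pi_polar by exact Hh. rewrite cis_0.
    replace (- (2 * PI * (- ln x * INR h / (2 * PI) / INR h)))%R with (ln x) by (field; lra).
    rewrite exp_ln by lra. ring.
Qed.

Lemma q_form_zero_product s1 w1 psi1 s2 w2 psi2 : q_form s1 w1 psi1 -> q_form s2 w2 psi2 ->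
  (forall z, upper_half_plane z -> (psi1 z * psi2 z)%R = 0%R) ->
  (forall z, upper_half_plane z -> psi1 z = 0%R) \/ (forall z, upper_half_plane z -> psi2 z = 0%R).
Proof.
  intros (p & h & Hp & Hh & E) (p' & h' & Hp' & Hh' & E') H0.
  assert (H1 : (Cmod 1 <= 1)%R) by (rewrite Cmod_1; lra).
  set (F := fun u => p (1 * u ^ h')). set (G := fun u => p' (1 * u ^ h)).
  assert (HF : analytic F) by now apply analytic_comp_monomial.
  assert (HG : analytic G) by now apply analytic_comp_monomial.
  assert (Hhh : (0 < h * h')%nat) by nia.
  assert (Hpt : forall z, upper_half_plane z -> psi1 z =
     (Cmod (F (e2pi (z / INR (h * h')))) * (exp (- (2 * PI * s1 * Im z)) * Rpower (Im z) w1))%R).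
  { intros z Hz. unfold F. rewrite <- e2pi_refine by assumption. now apply E. }
  assert (Hpt' : forall z, upper_half_plane z -> psi2 z =
     (Cmod (G (e2pi (z / INR (h * h')))) * (exp (- (2 * PI * s2 * Im z)) * Rpower (Im z) w2))%R).
  { intros z Hz. unfold G. rewrite <- e2pi_refine' by assumption. now apply E'. }
  assert (Hlt : forall z, upper_half_plane z -> (Cmod (e2pi (z / INR (h * h'))) < 1)%R).
  { intros z Hz. rewrite e2pi_div_height by exact Hhh. apply exp_neg_bounds.
    pose proof PI_RGT_0. apply Rmult_lt_0_compat; [lra|]. apply Rdiv_lt_0_compat; [exact Hz|now apply lt_0_INR]. }
  assert (HFG : forall u, (Cmod u < 1)%R -> F u * G u = 0).
  { apply (analytic_zero_of_accumulation (fun u => F u * G u)); [now apply analytic_mult|].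
    intros d Hd. exists (RtoC (d / 2)). rewrite Cmod_R, Rabs_pos_eq by lra. split; [lra|].
    destruct (e2pi_positive_real (h * h') (d / 2) Hhh ltac:(lra)) as (z & Hz & Ez).
    specialize (H0 z Hz). rewrite Hpt, Hpt', Ez in H0 by exact Hz.
    apply Cmod_eq_0. rewrite Cmod_mult.
    assert (P1 : (0 < exp (- (2 * PI * s1 * Im z)) * Rpower (Im z) w1)%R) by (apply Rmult_lt_0_compat; apply exp_pos).
    assert (P2 : (0 < exp (- (2 * PI * s2 * Im z)) * Rpower (Im z) w2)%R) by (apply Rmult_lt_0_compat; apply exp_pos).
    apply Rmult_integral in H0. destruct H0 as [H0|H0]; apply Rmult_integral in H0; destruct H0 as [H0|H0]; try lra; rewrite H0; ring. }
  destruct (analytic_integral_domain F G HF HG) as [H|H].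
  - intros u Hu. apply HFG. lra.
  - left. intros z Hz. rewrite Hpt, H, Cmod_0 by (try exact Hz; now apply Hlt). ring.
  - right. intros z Hz. rewrite Hpt', H, Cmod_0 by (try exact Hz; now apply Hlt). ring.
Qed.

Lemma SL2Z_ext g h : ma g = ma h -> mb g = mb h -> mc g = mc h -> md g = md h -> g = h.
Proof.
  destruct g as [a b c d Hg], h as [a' b' c' d' Hh]. cbn. intros -> -> -> ->.
  f_equal. apply UIP_dec, Z.eq_dec.
Qed.

Lemma mul_assoc g h k : mulSL2Z g (mulSL2Z h k) = mulSL2Z (mulSL2Z g h) k.
Proof. apply SL2Z_ext; cbn; ring. Qed.

Lemma mul_inv_l g : mulSL2Z (invSL2Z g) g = translation 0.
Proof. pose proof (SL2Z_det g). apply SL2Z_ext; cbn; lia. Qed.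

Lemma mul_inv_r g : mulSL2Z g (invSL2Z g) = translation 0.
Proof. pose proof (SL2Z_det g). apply SL2Z_ext; cbn; lia. Qed.

Lemma mul_1_r g : mulSL2Z g (translation 0) = g.
Proof. apply SL2Z_ext; cbn -[Z.mul Z.add]; ring. Qed.

Lemma inv_mul g h : invSL2Z (mulSL2Z g h) = mulSL2Z (invSL2Z h) (invSL2Z g).
Proof. apply SL2Z_ext; cbn; ring. Qed.

Lemma inv_inv g : invSL2Z (invSL2Z g) = g.
Proof. apply SL2Z_ext; cbn; ring. Qed.

Lemma Gamma1_mul Q g h : Gamma1 Q g -> Gamma1 Q h -> Gamma1 Q (mulSL2Z g h).
Proof.
  intros ([c Hc] & [a Ha] & [d Hd]) ([c' Hc'] & [a' Ha'] & [d' Hd']). unfold Gamma1. cbn [ma mb mc md mulSL2Z].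
  repeat split.
  - exists (c * ma h + md g * c')%Z. rewrite Hc, Hc'. ring.
  - exists (a * ma h + a' + mb g * c')%Z. rewrite Hc'.
    replace (ma g) with (a * Q + 1)%Z by lia.
    replace ((a * Q + 1) * ma h + mb g * (c' * Q) - 1)%Z with ((ma h - 1) + (a * ma h + mb g * c') * Q)%Z by ring.
    rewrite Ha'. ring.
  - exists (c * mb h + d * md h + d')%Z. rewrite Hc.
    replace (md g) with (d * Q + 1)%Z by lia.
    replace (c * Q * mb h + (d * Q + 1) * md h - 1)%Z with ((md h - 1) + (c * mb h + d * md h) * Q)%Z by ring.
    rewrite Hd'. ring.
Qed.

Lemma Gamma1_inv Q g : Gamma1 Q g -> Gamma1 Q (invSL2Z g).
Proof.
  intros (Hc & Ha & Hd). repeat split; cbn; try assumption. now apply Z.divide_opp_r.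
Qed.

Lemma Gamma1_1 Q : Gamma1 Q (translation 0).
Proof. repeat split; exists 0%Z; reflexivity. Qed.

Definition same_coset (Q : Z) (g h : SL2Z) : Prop := Gamma1 Q (mulSL2Z g (invSL2Z h)).

Lemma same_coset_refl Q g : same_coset Q g g.
Proof. unfold same_coset. rewrite mul_inv_r. apply Gamma1_1. Qed.

Lemma same_coset_sym Q g h : same_coset Q g h -> same_coset Q h g.
Proof.
  unfold same_coset. intros H. apply Gamma1_inv in H. rewrite inv_mul, inv_inv in H. exact H.
Qed.

Lemma same_coset_trans Q g h k : same_coset Q g h -> same_coset Q h k -> same_coset Q g k.
Proof.
  unfold same_coset. intros H1 H2. pose proof (Gamma1_mul Q _ _ H1 H2) as H.
  rewrite mul_assoc, <- (mul_assoc g), mul_inv_l, mul_1_r in H. exact H.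
Qed.

Lemma same_coset_mul_r Q g h k : same_coset Q (mulSL2Z g k) (mulSL2Z h k) <-> same_coset Q g h.
Proof.
  unfold same_coset. rewrite inv_mul, mul_assoc, <- (mul_assoc g), mul_inv_r, mul_1_r. reflexivity.
Qed.

Definition independent (Q : Z) (l : list SL2Z) : Prop :=
  ForallOrdPairs (fun g h => ~ Gamma1 Q (mulSL2Z g (invSL2Z h))) l.

Lemma independent_inj Q l g h : independent Q l -> In g l -> In h l -> same_coset Q g h -> g = h.
Proof.
  intros Hl. revert g h. induction Hl as [|x l Hx Hl IH]; intros g h Hg Hh Hgh; [destruct Hg|].
  rewrite Forall_forall in Hx. destruct Hg as [<-|Hg], Hh as [<-|Hh]; [reflexivity| | |now apply IH].
  - exfalso. exact (Hx h Hh Hgh).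
  - exfalso. exact (Hx g Hg (same_coset_sym _ _ _ Hgh)).
Qed.

Lemma independent_NoDup Q l : independent Q l -> NoDup l.
Proof.
  intros Hl. induction Hl as [|x l Hx Hl IH]; constructor; [|exact IH].
  intros Hin. rewrite Forall_forall in Hx. exact (Hx x Hin (same_coset_refl Q x)).
Qed.

Lemma NoDup_map_inj (A B : Type) (f : A -> B) l :
  (forall x y, In x l -> In y l -> f x = f y -> x = y) -> NoDup l -> NoDup (map f l).
Proof.
  intros Hf Hl. induction Hl as [|x l Hx Hl IH]; simpl; constructor.
  - intros Hin. apply in_map_iff in Hin. destruct Hin as (y & E & Hy).
    apply Hx. rewrite (Hf x y); [exact Hy|now left|now right|now symmetry].
  - apply IH. intros. apply Hf; [now right|now right|assumption].
Qed.

Lemma independent_length Q l : (0 < Q)%Z -> independent Q l ->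
  (length l <= Z.to_nat Q * Z.to_nat Q * (Z.to_nat Q * Z.to_nat Q))%nat.
Proof.
  intros HQ Hl. set (L := map Z.of_nat (seq 0 (Z.to_nat Q))).
  set (code := fun g => ((ma g mod Q, mb g mod Q), (mc g mod Q, md g mod Q))%Z).
  assert (HinL : forall x, In (x mod Q)%Z L).
  { intros x. pose proof (Z.mod_pos_bound x Q HQ). unfold L. apply in_map_iff.
    exists (Z.to_nat (x mod Q)). split; [lia|]. apply in_seq. lia. }
  replace (Z.to_nat Q * Z.to_nat Q * (Z.to_nat Q * Z.to_nat Q))%nat
    with (length (list_prod (list_prod L L) (list_prod L L)))
    by (rewrite !length_prod; unfold L; now rewrite length_map, length_seq).
  rewrite <- (length_map code). apply NoDup_incl_length.
  - apply NoDup_map_inj; [|now apply (independent_NoDup Q)].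
    intros g h Hg Hh E. apply (independent_inj Q l); try assumption.
    assert (Hmod : forall x y, (x mod Q = y mod Q)%Z -> exists t, (x = y + t * Q)%Z).
    { intros x y Exy. exists (x / Q - y / Q)%Z. pose proof (Z.div_mod x Q ltac:(lia)). pose proof (Z.div_mod y Q ltac:(lia)). lia. }
    unfold code in E. injection E as Ea Eb Ec Ed.
    apply Hmod in Ea, Eb, Ec, Ed. destruct Ea as [ta Ea], Eb as [tb Eb], Ec as [tc Ec], Ed as [td Ed].
    pose proof (SL2Z_det h) as D. unfold same_coset, Gamma1. cbn [ma mb mc md mulSL2Z invSL2Z].
    rewrite Ea, Eb, Ec, Ed. repeat split.
    + exists (tc * md h - td * mc h)%Z. ring.
    + exists (ta * md h - tb * mc h)%Z.
      transitivity ((ma h * md h - mb h * mc h - 1) + (ta * md h - tb * mc h) * Q)%Z; [ring|rewrite D; ring].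
    + exists (td * ma h - tc * mb h)%Z.
      transitivity ((ma h * md h - mb h * mc h - 1) + (td * ma h - tc * mb h) * Q)%Z; [ring|rewrite D; ring].
  - intros x Hx. apply in_map_iff in Hx. destruct Hx as (g & <- & _). unfold code.
    apply in_prod; apply in_prod; apply HinL.
Qed.

(** Independent families inject into the matrices modulo [Q], so there is a
    longest one, and its cosets cover the group. *)
Lemma has_index_SL2Z_index Q : (0 < Q)%Z -> has_index (Gamma1 Q) (SL2Z_index (Gamma1 Q)).
Proof.
  intros HQ. unfold SL2Z_index. apply epsilon_spec.
  set (P := fun n => exists l, length l = n /\ independent Q l).
  assert (HP : exists n, P n /\ ~ P (S n)).
  { apply NNPP. intros Hno.
    assert (Hall : forall n, P n).
    { induction n as [|n IH]; [exists nil; split; [reflexivity|constructor]|].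
      apply NNPP. intros Hn. apply Hno. now exists n. }
    destruct (Hall (S (Z.to_nat Q * Z.to_nat Q * (Z.to_nat Q * Z.to_nat Q)))) as (l & Hlen & Hl).
    pose proof (independent_length Q l HQ Hl). lia. }
  destruct HP as (n & (l & Hlen & Hl) & Hn). exists n, l. split; [exact Hlen|]. split; [exact Hl|].
  intros g. apply NNPP. intros Hg. apply Hn. exists (g :: l). split; [simpl; lia|].
  constructor; [|exact Hl]. apply Forall_forall. intros h Hh Hgh. apply Hg. apply Exists_exists. now exists h.
Qed.

Definition list_product (l : list R) : R := fold_right Rmult 1%R l.

Lemma list_product_permutation l l' : Permutation l l' -> list_product l = list_product l'.
Proof.
  unfold list_product.
  induction 1 as [|x l l' _ IH|x y l|l l' l'' _ IH1 _ IH2]; simpl;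
    [reflexivity|now rewrite IH|ring|congruence].
Qed.

Lemma NoDup_incl_complement (A : Type) (l' l : list A) : NoDup l' -> incl l' l ->
  exists rest, Permutation l (l' ++ rest).
Proof.
  revert l. induction l' as [|x l' IH]; intros l Hnd Hincl; [exists l; reflexivity|].
  inversion Hnd as [|x0 l0 Hx Hnd' E1]; subst.
  assert (Hin : In x l) by (apply Hincl; now left).
  apply in_split in Hin. destruct Hin as (l1 & l2 & ->).
  destruct (IH (l1 ++ l2) Hnd') as [rest Hr].
  - intros y Hy. assert (Hy' : In y (l1 ++ x :: l2)) by (apply Hincl; now right).
    apply in_app_or in Hy'. apply in_or_app. destruct Hy' as [H|[H|H]]; [now left| |now right].
    subst y. contradiction.
  - exists rest. simpl. rewrite <- Hr. symmetry. apply Permutation_middle.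
Qed.

Lemma q_form_list_product s w (psi : C -> R) l :
  (forall g, In g l -> q_form s w (fun z => psi (moebius g z))) ->
  q_form (INR (length l) * s) (INR (length l) * w) (fun z => list_product (map (fun g => psi (moebius g z)) l)).
Proof.
  induction l as [|g l IH]; intros H.
  - simpl. rewrite !Rmult_0_l. exact q_form_1.
  - replace (INR (length (g :: l)) * s)%R with (s + INR (length l) * s)%R by (simpl length; rewrite S_INR; ring).
    replace (INR (length (g :: l)) * w)%R with (w + INR (length l) * w)%R by (simpl length; rewrite S_INR; ring).
    apply (q_form_mult s w (fun z => psi (moebius g z)) _ _ (fun z => list_product (map (fun g => psi (moebius g z)) l))).
    + apply H. now left.
    + apply IH. intros. apply H. now right.
Qed.

Lemma list_product_zero w (psi : C -> R) l :
  (forall g, In g l -> q_form 0 w (fun z => psi (moebius g z))) ->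
  (forall z, upper_half_plane z -> list_product (map (fun g => psi (moebius g z)) l) = 0%R) ->
  exists g, forall z, upper_half_plane z -> psi (moebius g z) = 0%R.
Proof.
  induction l as [|g l IH]; intros Hl H0.
  - exfalso. specialize (H0 Ci ltac:(unfold upper_half_plane; simpl; lra)). simpl in H0. lra.
  - destruct (q_form_zero_product 0 w (fun z => psi (moebius g z)) (INR (length l) * 0) (INR (length l) * w)
      (fun z => list_product (map (fun g => psi (moebius g z)) l))) as [H|H].
    + apply Hl. now left.
    + apply q_form_list_product. intros. apply Hl. now right.
    + exact H0.
    + now exists g.
    + apply IH; [intros; apply Hl; now right|exact H].
Qed.

Lemma list_product_app l l' : list_product (l ++ l') = (list_product l * list_product l')%R.
Proof.
  induction l as [|x l IH]; [unfold list_product; simpl; ring|].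
  change (list_product ((x :: l) ++ l')) with (x * list_product (l ++ l'))%R. rewrite IH.
  change (list_product (x :: l)) with (x * list_product l)%R. ring.
Qed.

(** A Sturm bound: the product of the translates of [psi] over the cosets is
    invariant under SL_2(Z); the special cosets are those whose factor is
    [psi] itself, and each contributes [s] to the order of vanishing. *)
Lemma sturm_bound Q (psi : C -> R) (s w : R) (special : list SL2Z) :
  (0 < Q)%Z -> (0 <= w)%R ->
  (forall g z, Gamma1 Q g -> upper_half_plane z -> psi (moebius g z) = psi z) ->
  (forall g, q_form 0 w (fun z => psi (moebius g z))) ->
  q_form s w psi ->
  independent Q special ->
  (forall g z, In g special -> upper_half_plane z -> psi (moebius g z) = psi z) ->
  (INR (SL2Z_index (Gamma1 Q)) * w < 6 / 5 * PI * (INR (length special) * s))%R ->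
  forall z, upper_half_plane z -> psi z = 0%R.
Proof.
  intros HQ Hw Hinv Hcusps Hinf Hind Hspec Hbound.
  destruct (has_index_SL2Z_index Q HQ) as (reps & Hlen & Hreps & Hcov).
  fold (independent Q reps) in Hreps.
  destruct (fun_choice SL2Z SL2Z (fun g h => In h reps /\ same_coset Q g h)) as [r Hr].
  { intros g. specialize (Hcov g). apply Exists_exists in Hcov. exact Hcov. }
  assert (Hcoset : forall g h z, same_coset Q g h -> upper_half_plane z -> psi (moebius g z) = psi (moebius h z)).
  { intros g h z Hgh Hz. rewrite <- (Hinv _ (moebius h z) Hgh) by now apply moebius_H.
    rewrite <- moebius_mul by exact Hz. rewrite <- mul_assoc, mul_inv_l, mul_1_r. reflexivity. }
  set (Phi := fun z => list_product (map (fun g => psi (moebius g z)) reps)).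
  assert (HPinv : invariant Phi).
  { intros g z Hz. unfold Phi.
    assert (Hperm : Permutation (map (fun h => r (mulSL2Z h g)) reps) reps).
    { apply NoDup_Permutation_bis.
      - apply NoDup_map_inj; [|now apply (independent_NoDup Q)]. intros x y Hx Hy E.
        apply (independent_inj Q reps); try assumption. apply (same_coset_mul_r Q x y g).
        apply (same_coset_trans _ _ (r (mulSL2Z x g))); [apply Hr|]. rewrite E. apply same_coset_sym, Hr.
      - rewrite length_map. lia.
      - intros x Hx. apply in_map_iff in Hx. destruct Hx as (y & <- & _). apply Hr. }
    rewrite <- (list_product_permutation _ _ (Permutation_map (fun h => psi (moebius h z)) Hperm)).
    rewrite map_map. f_equal. apply map_ext. intros h. rewrite <- moebius_mul by exact Hz.
    apply Hcoset; [apply Hr|exact Hz]. }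
  set (sp' := map r special).
  assert (Hsp : NoDup sp').
  { apply NoDup_map_inj; [|now apply (independent_NoDup Q)]. intros x y Hx Hy E.
    apply (independent_inj Q special); try assumption.
    apply (same_coset_trans _ _ (r x)); [apply Hr|]. rewrite E. apply same_coset_sym, Hr. }
  destruct (NoDup_incl_complement _ sp' reps Hsp) as [rest Hrest].
  { intros x Hx. apply in_map_iff in Hx. destruct Hx as (y & <- & _). apply Hr. }
  assert (Hform : q_form (INR (length special) * s) (INR (length reps) * w) Phi).
  { replace (INR (length reps) * w)%R with (INR (length sp') * w + INR (length rest) * w)%R
      by (rewrite (Permutation_length Hrest), length_app, plus_INR; ring).
    replace (INR (length special) * s)%R with (INR (length sp') * s + INR (length rest) * 0)%R
      by (unfold sp'; rewrite length_map; ring).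
    apply (q_form_ext _ _ (fun z => list_product (map (fun g => psi (moebius g z)) sp')
                                  * list_product (map (fun g => psi (moebius g z)) rest))%R).
    - intros z _. unfold Phi.
      rewrite (list_product_permutation _ _ (Permutation_map (fun h => psi (moebius h z)) Hrest)), map_app.
      symmetry. apply list_product_app.
    - apply q_form_mult; apply q_form_list_product.
      + intros g Hg. apply in_map_iff in Hg. destruct Hg as (y & <- & Hy).
        apply (q_form_ext _ _ psi); [|exact Hinf]. intros z Hz.
        rewrite <- (Hspec y z Hy Hz). apply Hcoset; [apply Hr|exact Hz].
      + intros g _. apply Hcusps. }
  destruct Hform as (p & h & Hp & Hh & HE).
  assert (H0 := invariant_form_vanishes Phi p h _ _ Hp Hh
    (Rmult_le_pos _ _ (pos_INR (length reps)) Hw) ltac:(rewrite Hlen; exact Hbound) HPinv HE).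
  destruct (list_product_zero w psi reps (fun g _ => Hcusps g) H0) as [g Hg].
  intros z Hz. rewrite <- (moebius_inv_r g z Hz). apply Hg. now apply moebius_H.
Qed.

(** * Translates of a cusp form by multiples of 1/M *)

Section Translates.
Variables (k : nat) (N : Z) (chi : Z -> C) (f : C -> C) (M Q : Z).
Hypothesis k_odd : Nat.Odd k.
Hypothesis HN : (0 < N)%Z.
Hypothesis Hchi : is_Dirichlet_character N chi.
Hypothesis Hf : cusp_form k N chi f.
Hypothesis HA : admissible_level M Q.
Hypothesis HNQ : (N | Q)%Z.

(** The multiplier of the translate by [u / M] relative to that of [f], for
    [t = c' * u]: a factor from [chi] and one from theta. *)
Definition twist (t : Z) : C := chi (1 - Q / M * t)%Z * phase (IZR (t * theta_twist M Q) / 2).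

Lemma chi_1 : chi 1%Z = 1. Proof. apply Hchi. Qed.

Lemma chi_congr m n : (N | m - n)%Z -> chi m = chi n.
Proof.
  destruct Hchi as (_ & _ & Hp & _).
  assert (Hnat : forall j x, chi (x + Z.of_nat j * N)%Z = chi x).
  { induction j as [|j IH]; intros x; [f_equal; lia|]. rewrite <- (IH x), <- (Hp (x + Z.of_nat j * N)%Z). f_equal. lia. }
  intros [t Ht]. destruct (Z_le_gt_dec 0 t) as [H|H].
  - rewrite <- (Hnat (Z.to_nat t) n). f_equal. rewrite Z2Nat.id by exact H. lia.
  - rewrite <- (Hnat (Z.to_nat (- t)) m). f_equal. rewrite Z2Nat.id by lia. lia.
Qed.

Lemma Q_div_M : exists q : Z, Q = (q * (M * M))%Z /\ (Q / M = M * q)%Z.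
Proof.
  destruct HA as (HM & HQ & [q Hq] & _). exists q. split; [exact Hq|]. now apply level_quotient.
Qed.

(** [1 - (Q/M) t] is multiplicative in [t] modulo [N], because [Q] divides [(Q/M) ^ 2]. *)
Lemma twist_add s t : twist (s + t) = twist s * twist t.
Proof.
  unfold twist. destruct Q_div_M as (q & Hq & HQM). destruct HNQ as [n Hn].
  transitivity (chi ((1 - Q / M * s) * (1 - Q / M * t))%Z * (phase (IZR (s * theta_twist M Q) / 2) * phase (IZR (t * theta_twist M Q) / 2))).
  - f_equal.
    + apply chi_congr. exists (- (n * q * s * t))%Z. rewrite HQM.
      transitivity (- (q * (M * M) * q * s * t))%Z; [ring|]. rewrite <- Hq, Hn. ring.
    + rewrite <- phase_add. f_equal. rewrite !mult_IZR, plus_IZR. field.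
  - destruct Hchi as (_ & Hm & _ & _). rewrite Hm. ring.
Qed.

Lemma twist_M t : twist (M * t) = 1.
Proof.
  unfold twist. pose proof (theta_twist_spec M Q HA) as HT. destruct Q_div_M as (q & Hq & HQM). destruct HNQ as [n Hn].
  rewrite (chi_congr _ 1%Z), chi_1.
  - rewrite Cmult_1_l. destruct HT as [[_ ->]|(_ & _ & [[m Hm]|[m Hm]])].
    + rewrite Z.mul_0_r. replace (IZR 0 / 2)%R with (IZR 0) by (simpl; field). apply phase_Z.
    + rewrite Hm at 1. replace (IZR (m * 2 * t * theta_twist M Q) / 2)%R with (IZR (m * t * theta_twist M Q)).
      * apply phase_Z.
      * rewrite !mult_IZR. field.
    + rewrite Hm. replace (IZR (M * t * (m * 2)) / 2)%R with (IZR (M * t * m)); [apply phase_Z|].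
      rewrite !mult_IZR. field.
  - exists (- (n * t))%Z. rewrite HQM. transitivity (- (q * (M * M) * t))%Z; [ring|]. rewrite <- Hq, Hn. ring.
Qed.

Lemma twist_0 : twist 0 = 1.
Proof. rewrite <- (twist_M 0). f_equal. ring. Qed.

Lemma twist_pow t n : twist (t * Z.of_nat n) = twist t ^ n.
Proof.
  induction n as [|n IH]; [rewrite Z.mul_0_r; apply twist_0|].
  replace (t * Z.of_nat (S n))%Z with (t + t * Z.of_nat n)%Z by lia. rewrite twist_add, IH. reflexivity.
Qed.

Definition zeta : C := twist 1.

Lemma zeta_pow_M : zeta ^ Z.to_nat M = 1.
Proof.
  unfold zeta. rewrite <- twist_pow. destruct HA as (HM & _).
  rewrite Z2Nat.id by lia. replace (1 * M)%Z with (M * 1)%Z by ring. apply twist_M.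
Qed.

Lemma twist_zeta t e : (M | t - Z.of_nat e)%Z -> twist t = zeta ^ e.
Proof.
  intros [j Hj]. unfold zeta. rewrite <- twist_pow.
  replace t with (1 * Z.of_nat e + M * j)%Z by lia. rewrite twist_add, twist_M. ring.
Qed.

Lemma Cpow_0_l n : (0 < n)%nat -> 0 ^ n = 0.
Proof. destruct n; [lia|intros _; simpl; ring]. Qed.

Lemma k_pos : (0 < k)%nat. Proof. destruct k_odd as [m Hm]. lia. Qed.

Lemma Cinv_0 : / 0 = 0.
Proof. unfold Cinv, RtoC. simpl. f_equal; unfold Rdiv; ring. Qed.

(** Division by zero gives zero, so the factor of automorphy vanishes at a zero
    of theta, and with it [f]. *)
Lemma form_at_theta_zero g z : Gamma0 N g -> upper_half_plane z -> theta z = 0 -> f (moebius g z) = 0.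
Proof.
  intros Hg Hz H0. destruct Hf as (_ & Ht & _). rewrite (Ht g z Hg Hz). unfold theta_factor, Cdiv.
  rewrite H0, Cinv_0, Cmult_0_r, Cpow_0_l by exact k_pos. ring.
Qed.

Lemma form_zero z : upper_half_plane z -> theta z = 0 -> f z = 0.
Proof.
  intros Hz H0. replace z with (moebius (translation 0) z).
  - apply form_at_theta_zero; [exists 0%Z; reflexivity|exact Hz|exact H0].
  - rewrite moebius_translation. unfold ZtoC. ring.
Qed.

Lemma odd_pow_of_sign w : w * w = 1 -> w ^ k = w.
Proof.
  intros Hw. destruct k_odd as [m ->]. rewrite Nat.add_1_r, Cpow_S, Cpow_mult_r.
  replace (w ^ 2) with (w * w) by ring. rewrite Hw, Cpow_1_l. ring.
Qed.

(** Any translate of theta that does not vanish at [z] provides [J]. If they all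
    vanish there, so do all translates of [f]. *)
Lemma translate_law g z : Gamma1 Q g -> upper_half_plane z ->
  exists J, (Cmod J ^ 2 = Cmod (denom g z) ^ k)%R /\
    forall u, f (moebius g z + frac u M) = J * twist (mc g / Q * u) * f (z + frac u M).
Proof.
  intros (Hc & Ha & Hd) Hz. set (c' := (mc g / Q)%Z). set (kap := theta_twist M Q).
  assert (Hlaw : forall u, theta (z + frac u M) <> 0 ->
    f (moebius g z + frac u M) = chi (1 - Q / M * (c' * u))%Z *
      (theta (moebius g z + frac u M) / theta (z + frac u M)) ^ k * f (z + frac u M)).
  { intros u Hth. destruct (conjugate_by_translation M Q g u HA Hc Ha Hd) as (h & Ec & Ed & Hh).
    destruct (Hh z Hz) as [Em _]. rewrite <- Em. destruct Hf as (_ & Ht & _).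
    rewrite Ht; [|unfold Gamma0; rewrite Ec; now apply (Z.divide_trans _ Q)|now apply frac_H].
    unfold theta_factor. do 2 f_equal. apply chi_congr. rewrite Ed. fold c'.
    replace (md g - Q / M * c' * u - (1 - Q / M * (c' * u)))%Z with (md g - 1)%Z by ring.
    now apply (Z.divide_trans _ Q). }
  assert (Hzero : forall u, theta (z + frac u M) = 0 -> f (moebius g z + frac u M) = 0 /\ f (z + frac u M) = 0).
  { intros u H0. split; [|apply form_zero; [now apply frac_H|exact H0]].
    destruct (conjugate_by_translation M Q g u HA Hc Ha Hd) as (h & Ec & Ed & Hh).
    destruct (Hh z Hz) as [Em _]. rewrite <- Em. apply form_at_theta_zero; [|now apply frac_H|exact H0].
    unfold Gamma0. rewrite Ec. now apply (Z.divide_trans _ Q). }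
  destruct (classic (exists v, theta (z + frac v M) <> 0)) as [[v Hv]|Hno].
  - set (wv := phase (IZR (v * kap * c') / 2)).
    assert (Hwv : wv * wv = 1) by apply phase_half_sqr.
    set (X := theta (moebius g z + frac v M) / theta (z + frac v M)).
    exists ((wv * X) ^ k). split.
    + rewrite Cmod_pow, Cmod_mult. unfold wv. rewrite Cmod_phase, Rmult_1_l, <- pow_mult, Nat.mul_comm, pow_mult.
      f_equal. rewrite <- Cmod_pow. f_equal. unfold X.
      pose proof (theta_law_translate M Q g v z HA Hc Ha Hd Hz) as HL.
      transitivity (theta (moebius g z + frac v M) ^ 2 / theta (z + frac v M) ^ 2).
      * field. exact Hv.
      * rewrite HL. field. exact Hv.
    + intros u. destruct (classic (theta (z + frac u M) = 0)) as [H0|H0].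
      { destruct (Hzero u H0) as [-> ->]. ring. }
      rewrite (Hlaw u H0). set (wu := phase (IZR (u * kap * c') / 2)).
      assert (Hwu : wu * wu = 1) by apply phase_half_sqr.
      pose proof (theta_pair M Q g u v z HA Hc Ha Hd Hz) as HP. fold kap c' in HP. fold wu wv in HP.
      assert (EX : theta (moebius g z + frac u M) / theta (z + frac u M) = wu * (wv * X)).
      { unfold X.
        transitivity (wv * (wv * (theta (moebius g z + frac u M) * theta (z + frac v M))) / (theta (z + frac u M) * theta (z + frac v M))).
        - rewrite Cmult_assoc, Hwv. field. split; assumption.
        - rewrite HP. field. split; assumption. }
      rewrite EX, Cpow_mult_l, (odd_pow_of_sign wu Hwu). unfold twist. fold kap.
      replace (IZR (c' * u * kap) / 2)%R with (IZR (u * kap * c') / 2)%R by (do 2 f_equal; ring).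
      fold wu. ring.
  - exists (RtoC (sqrt (Cmod (denom g z) ^ k))). split.
    + rewrite Cmod_R, Rabs_pos_eq by apply sqrt_pos. rewrite pow2_sqrt by (apply pow_le, Cmod_ge_0). reflexivity.
    + intros u. destruct (Hzero u) as [-> ->]; [|ring]. apply NNPP. intros H. apply Hno. now exists u.
Qed.

End Translates.

(** * Expansions at the cusps *)

Definition upper_sqrt (w : C) : C := (sqrt ((Cmod w + Re w) / 2), sqrt ((Cmod w - Re w) / 2)).

Lemma Re_bounds w : (- Cmod w <= Re w <= Cmod w)%R.
Proof. pose proof (re_le_Cmod w) as H. apply Rabs_le_between in H. exact H. Qed.

Lemma upper_sqrt_sqr w : (0 <= Im w)%R -> upper_sqrt w * upper_sqrt w = w.
Proof.
  intros Hw. pose proof (Re_bounds w) as Hb. pose proof (Cmod_sqr w) as HC.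
  unfold upper_sqrt. set (p := ((Cmod w + Re w) / 2)%R). set (n := ((Cmod w - Re w) / 2)%R).
  assert (Hp : (0 <= p)%R) by (unfold p; lra). assert (Hn : (0 <= n)%R) by (unfold n; lra).
  assert (Hpn : (sqrt p * sqrt n = Im w / 2)%R).
  { rewrite <- sqrt_mult by assumption. replace (p * n)%R with ((Im w / 2) ^ 2)%R.
    - apply sqrt_pow2. lra.
    - unfold p, n. replace ((Im w / 2) ^ 2)%R with ((Im w ^ 2) / 4)%R by field.
      replace (Im w ^ 2)%R with (Cmod w ^ 2 - Re w ^ 2)%R by lra. field. }
  destruct w as [x y]. unfold Cmult. cbn [fst snd Re Im] in *. f_equal.
  - rewrite !sqrt_sqrt by assumption. unfold p, n. field.
  - rewrite (Rmult_comm (sqrt n)). rewrite Hpn. field.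
Qed.

Lemma upper_sqrt_Im w : (0 < Im w)%R -> (0 < Im (upper_sqrt w))%R.
Proof.
  intros Hw. unfold upper_sqrt. cbn [Im snd]. apply sqrt_lt_R0.
  pose proof (Cmod_sqr w) as HC. pose proof (Re_bounds w) as Hb. pose proof (Cmod_ge_0 w) as H0.
  assert (Re w < Cmod w)%R; [|lra].
  apply Rnot_le_lt. intros H. assert (E : Re w = Cmod w) by lra. rewrite E in HC. simpl in HC. nra.
Qed.

Lemma upper_sqrt_scal r w : (0 <= r)%R -> upper_sqrt (RtoC r * w) = RtoC (sqrt r) * upper_sqrt w.
Proof.
  intros Hr. pose proof (Re_bounds w) as Hb. unfold upper_sqrt. rewrite Cmod_mult, Cmod_R, Rabs_pos_eq by exact Hr.
  replace (Re (RtoC r * w)) with (r * Re w)%R by (destruct w; simpl; ring).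
  replace ((r * Cmod w + r * Re w) / 2)%R with (r * ((Cmod w + Re w) / 2))%R by field.
  replace ((r * Cmod w - r * Re w) / 2)%R with (r * ((Cmod w - Re w) / 2))%R by field.
  rewrite !sqrt_mult by lra. unfold Cmult, RtoC; simpl. f_equal; ring.
Qed.

Lemma is_derive_quadratic (F : C -> C) z l K d : (0 < d)%R -> (0 <= K)%R ->
  (forall w, (Cmod (w - z) < d)%R -> (Cmod (F w - F z - (w - z) * l)%C <= K * Cmod (w - z) ^ 2)%R) ->
  is_derive (K := C_AbsRing) (V := C_NormedModule) F z l.
Proof.
  intros Hd HK H. split.
  - apply (is_linear_scal_l (K := C_AbsRing) (V := C_NormedModule) l).
  - intros x Hx eps. apply (is_filter_lim_locally_unique (K := C_AbsRing) (V := AbsRing_NormedModule C_AbsRing)) in Hx. subst x.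
    apply (locally_le_locally_norm (K := C_AbsRing) (V := AbsRing_NormedModule C_AbsRing)).
    assert (Hp : (0 < Rmin d (eps / (K + 1)))%R).
    { apply Rmin_pos; [exact Hd|]. apply Rdiv_lt_0_compat; [apply cond_pos|lra]. }
    exists (mkposreal _ Hp). intros w Hw.
    change (Cmod (w - z) < Rmin d (eps / (K + 1)))%R in Hw.
    change (Cmod ((F w - F z) - (w - z) * l)%C <= eps * Cmod (w - z))%R.
    assert (H1 : (Cmod (w - z) < d)%R) by (eapply Rlt_le_trans; [exact Hw|apply Rmin_l]).
    assert (H2 : (Cmod (w - z) < eps / (K + 1))%R) by (eapply Rlt_le_trans; [exact Hw|apply Rmin_r]).
    eapply Rle_trans; [apply H; exact H1|]. pose proof (Cmod_ge_0 (w - z)).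
    apply Rlt_div_r in H2; [|lra]. simpl. rewrite Rmult_1_r, <- Rmult_assoc.
    apply Rmult_le_compat_r; [assumption|]. nra.
Qed.

Definition denom_sign (g : SL2Z) : Z :=
  if Z_lt_le_dec 0 (mc g) then 1%Z
  else if Z.eq_dec (mc g) 0 then Z.sgn (md g) else (-1)%Z.

Lemma denom_sign_unit g : denom_sign g = 1%Z \/ denom_sign g = (-1)%Z.
Proof.
  unfold denom_sign. destruct (Z_lt_le_dec 0 (mc g)); [now left|].
  destruct (Z.eq_dec (mc g) 0) as [E|E]; [|now right].
  pose proof (SL2Z_det g) as D. rewrite E in D. assert (md g <> 0)%Z by (intros E'; rewrite E' in D; lia).
  destruct (md g); simpl; auto; lia.
Qed.

Lemma denom_sign_mc g : mc g <> 0%Z -> (0 < denom_sign g * mc g)%Z.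
Proof.
  intros H. unfold denom_sign. destruct (Z_lt_le_dec 0 (mc g)); [lia|].
  destruct (Z.eq_dec (mc g) 0); lia.
Qed.

(** A holomorphic square root of [denom g], up to a sign: the sign puts the
    argument of the root in the upper half-plane. *)
Definition denom_root (g : SL2Z) (z : C) : C := upper_sqrt (ZtoC (denom_sign g) * denom g z).

Lemma Im_sign_denom g z : Im (ZtoC (denom_sign g) * denom g z) = (IZR (denom_sign g * mc g) * Im z)%R.
Proof. unfold denom, ZtoC. rewrite mult_IZR. destruct z as [x y]. simpl. ring. Qed.

Lemma denom_root_sqr g z : upper_half_plane z -> denom_root g z * denom_root g z = ZtoC (denom_sign g) * denom g z.
Proof.
  intros Hz. apply upper_sqrt_sqr. rewrite Im_sign_denom. apply Rmult_le_pos; [|now left].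
  apply IZR_le. destruct (Z.eq_dec (mc g) 0) as [->|H]; [lia|]. pose proof (denom_sign_mc g H). lia.
Qed.

Lemma Cmod_sign g : Cmod (ZtoC (denom_sign g)) = 1%R.
Proof. unfold ZtoC. rewrite Cmod_R. destruct (denom_sign_unit g) as [->| ->]; [apply Rabs_R1|]. rewrite Rabs_left; simpl; lra. Qed.

Lemma metaplectic_denom_root g : metaplectic g (denom_root g).
Proof.
  split.
  - intros z Hz. destruct (Z.eq_dec (mc g) 0) as [E|E].
    + exists (RtoC 0). apply (is_derive_ext (K := C_AbsRing) (V := C_NormedModule) (fun _ => upper_sqrt (ZtoC (denom_sign g) * ZtoC (md g)))).
      * intros w. unfold denom_root, denom. rewrite E. do 2 f_equal. change (ZtoC 0) with (RtoC 0). ring.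
      * apply (is_derive_const (K := C_AbsRing) (V := C_NormedModule)).
    + set (s := IZR (denom_sign g * mc g)).
      assert (Hs : (0 < s)%R) by (apply IZR_lt; now apply denom_sign_mc).
      set (a := ZtoC (denom_sign g) * denom g z).
      assert (Ha : (0 < Im a)%R) by (unfold a; rewrite Im_sign_denom; now apply Rmult_lt_0_compat).
      set (m := Im (upper_sqrt a)). assert (Hm : (0 < m)%R) by now apply upper_sqrt_Im.
      assert (Hsa : upper_sqrt a <> 0) by (intros E0; unfold m in Hm; rewrite E0 in Hm; simpl in Hm; lra).
      exists (RtoC s / (2 * upper_sqrt a)).
      apply (is_derive_quadratic _ _ _ (s ^ 2 / m ^ 3) (Im z)); [exact Hz| |].
      { apply Rle_div_r; [now apply pow_lt|]. rewrite Rmult_0_l. apply pow2_ge_0. }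
      intros w Hw. set (b := ZtoC (denom_sign g) * denom g w).
      assert (HwH : upper_half_plane w).
      { unfold upper_half_plane. assert (Rabs (Im (w - z)) <= Cmod (w - z))%R by (eapply Rle_trans; [|apply Rmax_Cmod]; apply Rmax_r).
        replace (Im (w - z)) with (Im w - Im z)%R in H by (destruct w, z; simpl; ring).
        apply Rabs_le_between in H. lra. }
      assert (Hb : (0 < Im b)%R) by (unfold b; rewrite Im_sign_denom; now apply Rmult_lt_0_compat).
      change (denom_root g w) with (upper_sqrt b). change (denom_root g z) with (upper_sqrt a).
      pose proof (upper_sqrt_sqr a ltac:(lra)) as Ea. pose proof (upper_sqrt_sqr b ltac:(lra)) as Eb.
      pose proof (upper_sqrt_Im b Hb) as Hmb.
      set (sa := upper_sqrt a) in *. set (sb := upper_sqrt b) in *.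
      assert (Hba : b - a = RtoC s * (w - z)).
      { unfold a, b, denom, s. rewrite mult_IZR. unfold ZtoC. rewrite RtoC_mult. ring. }
      assert (HIm : (m <= Im (sa + sb))%R) by (unfold m; destruct sa, sb; simpl in *; lra).
      assert (Hsum : (m <= Cmod (sa + sb))%R).
      { eapply Rle_trans; [exact HIm|]. eapply Rle_trans; [apply Rle_abs|]. eapply Rle_trans; [|apply Rmax_Cmod]. apply Rmax_r. }
      assert (Hsn : sa + sb <> 0) by (apply Cmod_gt_0; lra).
      assert (Hma : (m <= Cmod sa)%R).
      { unfold m. eapply Rle_trans; [apply Rle_abs|]. eapply Rle_trans; [|apply Rmax_Cmod]. apply Rmax_r. }
      replace (sb - sa - (w - z) * (RtoC s / (2 * sa))) with (- ((b - a) * (b - a)) / (2 * sa * ((sa + sb) * (sa + sb)))).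
      * rewrite Cmod_div, Cmod_opp, Hba.
        2:{ repeat apply Cmult_neq_0; try assumption. intros E0. apply (f_equal Re) in E0. simpl in E0. lra. }
        rewrite !Cmod_mult, !Cmod_R, (Rabs_pos_eq s), (Rabs_pos_eq 2) by lra.
        replace (s ^ 2 / m ^ 3 * Cmod (w - z) ^ 2)%R with (s * Cmod (w - z) * (s * Cmod (w - z)) * / m ^ 3)%R by (field; lra).
        apply Rmult_le_compat_l.
        { pose proof (Cmod_ge_0 (w - z)). apply Rmult_le_pos; apply Rmult_le_pos; lra. }
        apply Rinv_le_contravar; [now apply pow_lt|].
        replace (m ^ 3)%R with (m * (m * m))%R by ring.
        apply Rmult_le_compat; [lra|apply Rmult_le_pos; lra|lra|apply Rmult_le_compat; lra].
      * assert (E1 : (b - a) = (sb - sa) * (sa + sb)) by (rewrite <- Ea, <- Eb; ring).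
        assert (E2 : RtoC s * (w - z) = (sb - sa) * (sa + sb)) by (rewrite <- Hba; exact E1).
        rewrite E1. transitivity (sb - sa - RtoC s * (w - z) / (2 * sa)); [rewrite E2|]; field; repeat split; assumption.
  - exists (ZtoC (denom_sign g)). split; [apply Cmod_sign|]. intros z Hz.
    rewrite <- denom_root_sqr by exact Hz. ring.
Qed.

Lemma denom_root_neq_0 g z : upper_half_plane z -> denom_root g z <> 0.
Proof.
  intros Hz E. pose proof (denom_root_sqr g z Hz) as H. rewrite E, Cmult_0_l in H.
  symmetry in H. revert H. apply Cmult_neq_0; [|now apply denom_neq_0].
  apply Cmod_gt_0. rewrite Cmod_sign. lra.
Qed.

Lemma Cmod_denom_root g z : upper_half_plane z -> (Cmod (denom_root g z) ^ 2 = Cmod (denom g z))%R.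
Proof.
  intros Hz. rewrite <- Cmod_pow. replace (denom_root g z ^ 2) with (denom_root g z * denom_root g z) by ring.
  rewrite denom_root_sqr, Cmod_mult, Cmod_sign by exact Hz. ring.
Qed.

Definition q_expansion (F : C -> C) : Prop :=
  exists (p : C -> C) (h : nat), analytic p /\ (0 < h)%nat /\
    forall z, upper_half_plane z -> F z = p (e2pi (z / INR h)).

Lemma q_expansion_const c : q_expansion (fun _ => c).
Proof. exists (fun _ => c), 1%nat. split; [apply analytic_const|]. split; [lia|reflexivity]. Qed.

Lemma q_expansion_scal c F : q_expansion F -> q_expansion (fun z => c * F z).
Proof.
  intros (p & h & Hp & Hh & E). exists (fun u => c * p u), h.
  split; [now apply analytic_scal|]. split; [exact Hh|]. intros z Hz. now rewrite E.
Qed.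

Lemma q_expansion_plus F G : q_expansion F -> q_expansion G -> q_expansion (fun z => F z + G z).
Proof.
  intros (p & h & Hp & Hh & E) (p' & h' & Hp' & Hh' & E').
  assert (H1 : (Cmod 1 <= 1)%R) by (rewrite Cmod_1; lra).
  exists (fun u => p (1 * u ^ h') + p' (1 * u ^ h)), (h * h')%nat.
  split; [apply analytic_plus; now apply analytic_comp_monomial|]. split; [nia|].
  intros z Hz. now rewrite E, E', <- e2pi_refine, <- e2pi_refine' by assumption.
Qed.

Lemma q_expansion_ext F G : (forall z, upper_half_plane z -> F z = G z) -> q_expansion F -> q_expansion G.
Proof.
  intros H (p & h & Hp & Hh & E). exists p, h. repeat split; try assumption.
  intros z Hz. rewrite <- H by exact Hz. now apply E.
Qed.

Lemma q_expansion_csum n (F : nat -> C -> C) :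
  (forall u, q_expansion (F u)) -> q_expansion (fun z => csum n (fun u => F u z)).
Proof.
  intros H. induction n as [|n IH].
  { apply (q_expansion_ext (fun _ => 0)); [reflexivity|apply q_expansion_const]. }
  apply (q_expansion_plus (fun z => csum n (fun u => F u z))); [exact IH|apply H].
Qed.

Lemma affine_H A B D z : (0 < A)%Z -> (0 < D)%Z -> upper_half_plane z ->
  upper_half_plane ((ZtoC A * z + ZtoC B) / ZtoC D).
Proof.
  intros HA HD Hz. apply IZR_lt in HA, HD. unfold upper_half_plane, ZtoC in *.
  replace ((RtoC (IZR A) * z + RtoC (IZR B)) / RtoC (IZR D)) with (RtoC (/ IZR D) * (RtoC (IZR A) * z + RtoC (IZR B))).
  - destruct z as [x y]. simpl in *. ring_simplify.
    apply Rmult_lt_0_compat; [apply Rmult_lt_0_compat|]; try assumption. now apply Rinv_0_lt_compat.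
  - rewrite RtoC_inv by lra. field. apply RtoC_neq_0. lra.
Qed.

Lemma q_expansion_affine F (A B D : Z) : (0 < A)%Z -> (0 < D)%Z -> q_expansion F ->
  q_expansion (fun z => F ((ZtoC A * z + ZtoC B) / ZtoC D)).
Proof.
  intros HA HD (p & h & Hp & Hh & E).
  set (z0 := e2pi (ZtoC B / (ZtoC D * INR h))).
  assert (HhC : RtoC (INR h) <> 0) by (apply RtoC_neq_0; apply lt_0_INR in Hh; lra).
  assert (HDC : ZtoC D <> 0) by (apply ZtoC_neq_0; lia).
  exists (fun u => p (z0 * u ^ Z.to_nat A)), (Z.to_nat D * h)%nat. split; [|split].
  - apply analytic_comp_monomial; [exact Hp| |lia]. unfold z0.
    replace (ZtoC B / (ZtoC D * INR h)) with (RtoC (IZR B / (IZR D * INR h))).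
    + pose proof (Cmod_phase (IZR B / (IZR D * INR h))) as H1. unfold phase in H1. rewrite H1. lra.
    + unfold ZtoC. rewrite RtoC_div, RtoC_mult; [reflexivity|].
      apply Rmult_integral_contrapositive. split; [intros E0; apply eq_IZR in E0; lia|apply lt_0_INR in Hh; lra].
  - nia.
  - intros z Hz. rewrite E.
    + f_equal. unfold z0. rewrite e2pi_pow, <- e2pi_add. f_equal.
      rewrite mult_INR, RtoC_mult, !INR_IZR_INZ, !Z2Nat.id by lia. fold (ZtoC A) (ZtoC D).
      rewrite <- INR_IZR_INZ. field. split; assumption.
    + now apply affine_H.
Qed.

Section Cusps.
Variables (k : nat) (N : Z) (chi : Z -> C) (f : C -> C).
Hypothesis k_odd : Nat.Odd k.
Hypothesis HN : (0 < N)%Z.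
Hypothesis H4N : (4 | N)%Z.
Hypothesis Hchi : is_Dirichlet_character N chi.
Hypothesis Hf : cusp_form k N chi f.

Lemma form_law_sqr h x : upper_half_plane x -> (N | mc h)%Z -> (N | md h - 1)%Z ->
  f (moebius h x) ^ 2 = denom h x ^ k * f x ^ 2.
Proof.
  intros Hx Hc Hd. destruct (classic (theta x = 0)) as [H0|H0].
  - rewrite (form_at_theta_zero k N chi f k_odd Hf h x Hc Hx H0), (form_zero k N chi f k_odd Hf x Hx H0). ring.
  - destruct Hf as (_ & Ht & _). rewrite (Ht h x Hc Hx).
    rewrite (chi_congr N chi Hchi (md h) 1%Z Hd), (chi_1 N chi Hchi), Cmult_1_l, Cpow_mult_l.
    f_equal. rewrite <- Cpow_mult_r, Nat.mul_comm, Cpow_mult_r. f_equal. unfold theta_factor.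
    assert (HL := theta_law_Gamma1_4 h (Z.divide_trans _ _ _ H4N Hc) (Z.divide_trans _ _ _ H4N Hd) x Hx).
    transitivity (theta (moebius h x) ^ 2 / theta x ^ 2); [field; exact H0|]. rewrite HL. field. exact H0.
Qed.

Definition form_at_cusp (g : SL2Z) (w : C) : C := f (moebius g w) / denom_root g w ^ k.

Lemma shift_H w n : upper_half_plane w -> upper_half_plane (w + ZtoC n).
Proof. apply plus_real_H. Qed.

(** [g T^N g^-1] lies in Gamma_1(N), so the square of [f | g] has period [N]. *)
Lemma form_at_cusp_sqr_period g w : upper_half_plane w ->
  form_at_cusp g (w + ZtoC N) ^ 2 = form_at_cusp g w ^ 2.
Proof.
  intros Hw. set (d := mulSL2Z (mulSL2Z g (translation N)) (invSL2Z g)).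
  pose proof (SL2Z_det g) as D.
  assert (Hd : (N | mc d)%Z) by (exists (- mc g * mc g)%Z; unfold d; cbn [ma mb mc md mulSL2Z invSL2Z translation]; ring).
  assert (Hd1 : (N | md d - 1)%Z).
  { exists (mc g * ma g)%Z. unfold d; cbn [ma mb mc md mulSL2Z invSL2Z translation].
    transitivity (mc g * ma g * N + (ma g * md g - mb g * mc g - 1))%Z; [ring|rewrite D; ring]. }
  assert (Ew : moebius g (w + ZtoC N) = moebius d (moebius g w)).
  { rewrite <- moebius_mul by exact Hw. unfold d. rewrite <- mul_assoc, mul_inv_l, mul_1_r.
    rewrite moebius_mul, moebius_translation by exact Hw. reflexivity. }
  assert (Edn : denom g (w + ZtoC N) = denom d (moebius g w) * denom g w).
  { rewrite <- denom_mul by exact Hw. unfold d. rewrite <- mul_assoc, mul_inv_l, mul_1_r.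
    rewrite denom_mul, moebius_translation by exact Hw. unfold denom at 3. cbn [mc md translation].
    change (ZtoC 1) with (RtoC 1). change (ZtoC 0) with (RtoC 0). ring. }
  assert (Hsq : forall v, upper_half_plane v -> form_at_cusp g v ^ 2 = f (moebius g v) ^ 2 / (ZtoC (denom_sign g) * denom g v) ^ k).
  { intros v Hv. unfold form_at_cusp. pose proof (denom_root_neq_0 g v Hv) as Hr.
    rewrite <- denom_root_sqr, Cpow_mult_l by exact Hv. pose proof (Cpow_nz _ k Hr). field. assumption. }
  rewrite !Hsq by (try apply shift_H; exact Hw). rewrite Ew, Edn.
  rewrite form_law_sqr by (try assumption; now apply moebius_H).
  pose proof (moebius_H g w Hw) as HgH.
  pose proof (Cpow_nz _ k (denom_neq_0 d _ HgH)) as N1. pose proof (Cpow_nz _ k (denom_neq_0 g w Hw)) as N2.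
  assert (N3 : ZtoC (denom_sign g) ^ k <> 0) by (apply Cpow_nz, Cmod_gt_0; rewrite Cmod_sign; lra).
  rewrite !Cpow_mult_l. field. repeat split; assumption.
Qed.

(** The square has an integral period, so the exponent [r] of the expansion
    is rational unless the form vanishes identically. *)
Lemma cusp_expansion g : q_expansion (form_at_cusp g).
Proof.
  destruct Hf as (_ & _ & Hv).
  destruct (Hv g (denom_root g) (metaplectic_denom_root g)) as (h & r & b & Hh & Hr & _ & Hb).
  fold (form_at_cusp g) in Hb. 
  assert (Hh' : (0 < INR h)%R) by now apply lt_0_INR.
  set (F := slash k f g (denom_root g)) in Hb.
  assert (HF : forall z, F z = form_at_cusp g z) by reflexivity.
  assert (HN' : (0 < INR (Z.to_nat N))%R) by (apply lt_0_INR; lia).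
  assert (Hiter : forall j w, upper_half_plane w -> form_at_cusp g (w + ZtoC (Z.of_nat j * N)) ^ 2 = form_at_cusp g w ^ 2).
  { induction j as [|j IH]; intros w Hw.
    - do 2 f_equal. unfold ZtoC. simpl. ring.
    - replace (Z.of_nat (S j) * N)%Z with (Z.of_nat j * N + N)%Z by lia.
      rewrite ZtoC_plus, Cplus_assoc. rewrite form_at_cusp_sqr_period by now apply shift_H. now apply IH. }
  set (e := phase (r * IZR N)).
  assert (Hshift : forall w, upper_half_plane w -> form_at_cusp g (w + ZtoC (Z.of_nat h * N)) = e * form_at_cusp g w).
  { intros w Hw. pose proof (Hb _ (shift_H w (Z.of_nat h * N) Hw)) as H1.
    pose proof (is_Cseries_scal e _ _ (Hb w Hw)) as H2. apply (is_Cseries_unique _ _ _ H1).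
    eapply is_Cseries_ext; [|exact H2]. intros n. cbv beta.
    replace (RtoC ((INR n + r) / INR h) * (w + ZtoC (Z.of_nat h * N)))
      with (RtoC ((INR n + r) / INR h) * w + (RtoC (r * IZR N) + ZtoC (Z.of_nat n * N))).
    - rewrite !e2pi_add, e2pi_Z. unfold e, phase. ring.
    - unfold ZtoC. rewrite !mult_IZR, <- !INR_IZR_INZ, <- RtoC_plus.
      rewrite Cmult_plus_distr_l. f_equal. rewrite <- RtoC_mult. f_equal. field. lra. }
  destruct (classic (exists w, upper_half_plane w /\ form_at_cusp g w <> 0)) as [(w0 & Hw0 & Hne)|Hno].
  2:{ apply (q_expansion_ext (fun _ => 0)); [|apply q_expansion_const].
      intros z Hz. symmetry. apply NNPP. intros H. apply Hno. now exists z. }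
  assert (He2 : phase (r * IZR N + r * IZR N) = 1).
  { rewrite phase_add. fold e. pose proof (Hiter h w0 Hw0) as H. rewrite Hshift, Cpow_mult_l in H by exact Hw0.
    pose proof (Cpow_nz _ 2 Hne) as Hne2.
    transitivity (e ^ 2 * form_at_cusp g w0 ^ 2 / form_at_cusp g w0 ^ 2); [field; exact Hne|].
    rewrite H. field. exact Hne. }
  destruct (phase_1_integer _ He2) as [P HP].
  assert (HNR : INR (Z.to_nat N) = IZR N) by (rewrite INR_IZR_INZ, Z2Nat.id by lia; reflexivity).
  assert (HP0 : (0 <= P)%Z). { apply le_IZR. rewrite <- HP, <- HNR. assert (0 <= r * INR (Z.to_nat N))%R by (apply Rmult_le_pos; lra). lra. }
  set (K := (2 * Z.to_nat N)%nat). set (B := fun u => CSeries (fun n => b n * u ^ n)).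
  assert (HB : analytic_with b B).
  { apply analytic_of_bounded. intros rho Hrho. pose proof PI_RGT_0.
    destruct (e2pi_positive_real h rho Hh Hrho) as (z & Hz & Ez).
    destruct (is_Cseries_bounded _ _ (Hb z Hz)) as [X HX].
    set (t := Cmod (e2pi (RtoC (r / INR h) * z))).
    assert (Ht : (0 < t)%R) by (apply Cmod_gt_0, e2pi_neq_0).
    exists (X / t)%R. intros n. specialize (HX n).
    apply (Rle_div_r _ _ t); [exact Ht|].
    replace (Cmod (b n) * rho ^ n * t)%R with (Cmod (b n * e2pi (RtoC ((INR n + r) / INR h) * z))); [exact HX|].
    rewrite Cmod_mult, Rmult_assoc. f_equal.
    replace (RtoC ((INR n + r) / INR h) * z) with (RtoC (INR n) * (z / INR h) + RtoC (r / INR h) * z).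
    - rewrite e2pi_add, <- e2pi_pow, Cmod_mult, Ez, Cmod_pow, Cmod_R, Rabs_pos_eq by lra. reflexivity.
    - rewrite !RtoC_div by lra. rewrite RtoC_plus. field. apply RtoC_neq_0. lra. }
  exists (fun u => u ^ Z.to_nat P * B (1 * u ^ K)), (h * K)%nat.
  assert (HK : (0 < K)%nat) by (unfold K; lia).
  split; [|split].
  - apply analytic_shift, analytic_comp_monomial; [now exists b|rewrite Cmod_1; lra|exact HK].
  - nia.
  - intros z Hz. rewrite <- e2pi_refine by assumption.
    apply (is_Cseries_unique _ _ _ (Hb z Hz)).
    assert (Hq : (Cmod (e2pi (z / INR h)) < 1)%R).
    { rewrite e2pi_div_height by exact Hh. apply exp_neg_bounds. pose proof PI_RGT_0.
      apply Rmult_lt_0_compat; [lra|]. now apply Rdiv_lt_0_compat. }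
    eapply is_Cseries_ext; [|apply (is_Cseries_scal (e2pi (z / INR (h * K)) ^ Z.to_nat P) _ _ (HB _ Hq))].
    intros n. cbv beta. rewrite !e2pi_pow.
    transitivity (b n * (e2pi (INR (Z.to_nat P) * (z / INR (h * K))) * e2pi (INR n * (z / INR h)))); [ring|].
    rewrite <- e2pi_add. do 2 f_equal.
    assert (Hr2 : r = (INR (Z.to_nat P) / INR K)%R).
    { unfold K. rewrite mult_INR, HNR, (INR_IZR_INZ (Z.to_nat P)), Z2Nat.id, <- HP by exact HP0.
      simpl INR. field. rewrite <- HNR. lra. }
    assert (HKC : (0 < INR K)%R) by now apply lt_0_INR.
    rewrite mult_INR. rewrite Hr2 at 1. rewrite RtoC_div, RtoC_plus, RtoC_div, RtoC_mult by lra.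
    field. split; apply RtoC_neq_0; lra.
Qed.

Lemma bezout_column x y : x <> 0%Z \/ y <> 0%Z ->
  exists (g : SL2Z) (d : Z), (0 < d)%Z /\ x = (d * ma g)%Z /\ y = (d * mc g)%Z.
Proof.
  intros H. set (d := Z.gcd x y).
  assert (Hd : (0 < d)%Z).
  { pose proof (Z.gcd_nonneg x y). fold d in H0. assert (d <> 0)%Z; [|lia].
    intros E. apply Z.gcd_eq_0 in E. lia. }
  destruct (Z.gcd_divide_l x y) as [x1 Hx]. destruct (Z.gcd_divide_r x y) as [y1 Hy]. fold d in Hx, Hy.
  destruct (Z.gcd_bezout x y d eq_refl) as (u & v & Huv).
  assert (Hdet : (x1 * u - (- v) * y1 = 1)%Z).
  { apply (Z.mul_reg_l _ _ d); [lia|].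
    transitivity (u * (x1 * d) + v * (y1 * d))%Z; [ring|]. rewrite <- Hx, <- Hy. lia. }
  exists (mkSL2Z x1 (- v) y1 u Hdet), d. cbn. split; [exact Hd|]. split; lia.
Qed.

Variable M : Z.
Hypothesis HM : (1 <= M)%Z.

(** The matrix [(M u; 0 M) g] is an element of SL_2(Z) times an upper
    triangular one, so a translate of [f] expands at every cusp like [f]. *)
Lemma translate_at_cusp g u :
  q_expansion (fun z => f (moebius g z + frac u M) / denom_root g z ^ k).
Proof.
  pose proof (SL2Z_det g) as D.
  set (x := (M * ma g + u * mc g)%Z). set (y := (M * mc g)%Z).
  assert (Hxy : x <> 0%Z \/ y <> 0%Z).
  { destruct (Z.eq_dec (mc g) 0) as [E|E]; [left|right; unfold y; nia].
    unfold x. rewrite E in D |- *. assert (ma g <> 0)%Z by (intros E'; rewrite E' in D; lia). nia. }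
  destruct (bezout_column x y Hxy) as (g' & A & HA & Ex & Ey).
  pose proof (SL2Z_det g') as D'.
  set (p := (M * mb g + u * md g)%Z). set (q := (M * md g)%Z).
  set (B := (md g' * p - mb g' * q)%Z). set (E := (ma g' * q - mc g' * p)%Z).
  assert (Ep : p = (ma g' * B + mb g' * E)%Z).
  { transitivity (p * (ma g' * md g' - mb g' * mc g'))%Z; [rewrite D'; ring|unfold B, E; ring]. }
  assert (Eq : q = (mc g' * B + md g' * E)%Z).
  { transitivity (q * (ma g' * md g' - mb g' * mc g'))%Z; [rewrite D'; ring|unfold B, E; ring]. }
  assert (HAE : (A * E = M * M)%Z).
  { transitivity (x * q - y * p)%Z; [rewrite Ex, Ey; unfold E; ring|].
    transitivity (M * M * (ma g * md g - mb g * mc g))%Z; [unfold x, y, p, q; ring|rewrite D; ring]. }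
  assert (HE : (0 < E)%Z) by nia.
  set (tau := fun z => (ZtoC A * z + ZtoC B) / ZtoC E).
  assert (HMC : ZtoC M <> 0) by (apply ZtoC_neq_0; lia).
  assert (HEC : ZtoC E <> 0) by (apply ZtoC_neq_0; lia).
  assert (HER : (0 < IZR E)%R) by now apply IZR_lt. assert (HMR : (0 < IZR M)%R) by (apply IZR_lt; lia).
  assert (HAR : (0 < IZR A)%R) by now apply IZR_lt.
  assert (Htau : forall z, upper_half_plane z -> upper_half_plane (tau z)).
  { intros z Hz. now apply affine_H. }
  assert (Hden : forall z, denom g' (tau z) = ZtoC M / ZtoC E * denom g z).
  { intros z. unfold denom, tau.
    transitivity ((ZtoC A * ZtoC (mc g') * z + (ZtoC (mc g') * ZtoC B + ZtoC (md g') * ZtoC E)) / ZtoC E); [field; exact HEC|].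
    rewrite <- !ZtoC_mult, <- ZtoC_plus, <- Ey, <- Eq. unfold y, q. rewrite !ZtoC_mult. field. exact HEC. }
  assert (Hmoeb : forall z, upper_half_plane z -> moebius g z + frac u M = moebius g' (tau z)).
  { intros z Hz. pose proof (denom_neq_0 g z Hz) as Hd. pose proof (denom_neq_0 g' _ (Htau z Hz)) as Hd'.
    unfold moebius. rewrite Hden.
    assert (Hnum : ZtoC (ma g') * tau z + ZtoC (mb g') = (ZtoC M * (ZtoC (ma g) * z + ZtoC (mb g)) + ZtoC u * denom g z) / ZtoC E).
    { unfold tau.
      transitivity ((ZtoC A * ZtoC (ma g') * z + (ZtoC (ma g') * ZtoC B + ZtoC (mb g') * ZtoC E)) / ZtoC E); [field; exact HEC|].
      rewrite <- !ZtoC_mult, <- ZtoC_plus, <- Ex, <- Ep. unfold x, p, denom. rewrite !ZtoC_plus, !ZtoC_mult. field. exact HEC. }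
    rewrite Hnum. unfold frac, ZtoC at 3. rewrite RtoC_div by lra. fold (ZtoC u) (ZtoC M). field. repeat split; assumption. }
  assert (Hsign : denom_sign g' = denom_sign g).
  { unfold denom_sign. unfold y in Ey.
    destruct (Z.eq_dec (mc g) 0) as [E0|E0].
    - assert (E1 : mc g' = 0%Z) by nia. rewrite E0, E1. simpl.
      unfold q in Eq. rewrite E1 in Eq.
      destruct (Z_lt_le_dec 0 (md g)) as [H|H].
      + rewrite !Z.sgn_pos; nia.
      + assert (md g <> 0)%Z by (intros E'; rewrite E', E0 in D; lia). rewrite !Z.sgn_neg; nia.
    - assert (E1 : mc g' <> 0%Z) by nia.
      destruct (Z_lt_le_dec 0 (mc g)), (Z_lt_le_dec 0 (mc g')), (Z.eq_dec (mc g) 0), (Z.eq_dec (mc g') 0); try reflexivity; try contradiction; nia. }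
  set (rt := RtoC (sqrt (IZR M / IZR E))).
  assert (Hroot : forall z, denom_root g' (tau z) = rt * denom_root g z).
  { intros z. unfold denom_root, rt. rewrite Hsign, Hden, <- upper_sqrt_scal.
    - f_equal. rewrite RtoC_div by lra. unfold ZtoC. ring.
    - left. now apply Rdiv_lt_0_compat. }
  assert (Hrt : rt <> 0).
  { intros E0. apply (f_equal Re) in E0. simpl in E0.
    assert (0 < sqrt (IZR M / IZR E))%R by (apply sqrt_lt_R0; now apply Rdiv_lt_0_compat). lra. }
  apply (q_expansion_ext (fun z => rt ^ k * form_at_cusp g' (tau z))).
  - intros z Hz. rewrite (Hmoeb z Hz). unfold form_at_cusp. rewrite Hroot, Cpow_mult_l.
    pose proof (Cpow_nz _ k Hrt). pose proof (Cpow_nz _ k (denom_root_neq_0 g z Hz)). field. split; assumption.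
  - apply q_expansion_scal. apply (q_expansion_affine (form_at_cusp g') A B E HA HE). apply cusp_expansion.
Qed.

End Cusps.

(** * Weighted absolute values *)

Definition weighted (k : nat) (F : C -> C) (z : C) : R := (Cmod (F z) * Rpower (Im z) (INR k / 4))%R.

Lemma weight_factor k X y D : (0 < y)%R -> (0 < D)%R -> (0 <= X)%R -> (X ^ 2 = D ^ k)%R ->
  (X * Rpower (y / D ^ 2) (INR k / 4) = Rpower y (INR k / 4))%R.
Proof.
  intros Hy HD HX E.
  assert (EX : X = Rpower D (INR k / 2)).
  { apply Rsqr_inj; [exact HX|left; apply exp_pos|]. rewrite !Rsqr_pow2, E, <- (Rpower_pow k D HD).
    rewrite <- (Rpower_pow 2 (Rpower D (INR k / 2))) by apply exp_pos.
    rewrite Rpower_mult. f_equal. simpl. field. }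
  rewrite EX. unfold Rpower. rewrite <- exp_plus. f_equal.
  rewrite ln_div by (try assumption; now apply pow_lt).
  replace (D ^ 2)%R with (D * D)%R by ring. rewrite ln_mult by assumption. field.
Qed.

Lemma weighted_law k g F G z J : upper_half_plane z ->
  F (moebius g z) = J * G z -> (Cmod J ^ 2 = Cmod (denom g z) ^ k)%R ->
  weighted k F (moebius g z) = weighted k G z.
Proof.
  intros Hz E HJ. unfold weighted. rewrite E, Cmod_mult, Im_moebius by exact Hz.
  rewrite <- (weight_factor k (Cmod J) (Im z) (Cmod (denom g z))) at 1.
  - ring.
  - exact Hz.
  - now apply Cmod_gt_0, denom_neq_0.
  - apply Cmod_ge_0.
  - exact HJ.
Qed.

Lemma weighted_q_form_cusp k g F : q_expansion (fun z => F (moebius g z) / denom_root g z ^ k) ->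
  q_form 0 (INR k / 4) (fun z => weighted k F (moebius g z)).
Proof.
  intros (p & h & Hp & Hh & E). exists p, h. split; [exact Hp|]. split; [exact Hh|]. intros z Hz.
  pose proof (Cpow_nz _ k (denom_root_neq_0 g z Hz)) as Hne.
  rewrite (weighted_law k g F (fun z => p (e2pi (z / INR h))) z (denom_root g z ^ k) Hz).
  - unfold weighted. replace (- (2 * PI * 0 * Im z))%R with 0%R by ring. rewrite exp_0. ring.
  - rewrite <- E by exact Hz. field. exact Hne.
  - rewrite Cmod_pow, <- pow_mult, Nat.mul_comm, pow_mult, Cmod_denom_root by exact Hz. reflexivity.
Qed.

Lemma analytic_with_order c F s : analytic_with c F -> (forall n, (n < s)%nat -> c n = 0) ->
  exists G, analytic G /\ forall w, (Cmod w < 1)%R -> F w = w ^ s * G w.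
Proof.
  intros Hc H0. set (G := fun w => CSeries (fun n => c (s + n)%nat * w ^ n)).
  assert (HG : analytic_with (fun n => c (s + n)%nat) G).
  { apply analytic_of_bounded. intros r Hr.
    destruct (analytic_with_geom c F r Hc ltac:(lra)) as (K & q & HK & Hq & Hg).
    assert (Hrs : (0 < r ^ s)%R) by (apply pow_lt; lra).
    exists (K / r ^ s)%R. intros n. apply (Rle_div_r _ _ (r ^ s)); [exact Hrs|].
    specialize (Hg (s + n)%nat). rewrite pow_add in Hg.
    assert (q ^ (s + n) <= 1)%R by (rewrite <- (pow1 (s + n)); apply pow_incr; lra). nra. }
  exists G. split; [now exists (fun n => c (s + n)%nat)|]. intros w Hw.
  apply (is_Cseries_unique _ _ _ (Hc w Hw)). apply (is_Cseries_tail s).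
  rewrite csum_zero by (intros i Hi; rewrite H0 by exact Hi; ring).
  replace (w ^ s * G w - 0) with (w ^ s * G w) by ring.
  eapply is_Cseries_ext; [|apply is_Cseries_scal, (HG w Hw)]. intros n. cbv beta. rewrite Cpow_add_r. ring.
Qed.

Lemma weighted_q_form_infinity k c P F s : analytic_with c P -> (forall n, (n < s)%nat -> c n = 0) ->
  (forall z, upper_half_plane z -> F z = P (e2pi z)) -> q_form (INR s) (INR k / 4) (weighted k F).
Proof.
  intros Hc H0 E. destruct (analytic_with_order c P s Hc H0) as (G & HG & EG).
  exists G, 1%nat. split; [exact HG|]. split; [lia|]. intros z Hz.
  replace (z / INR 1) with z by (simpl; field). unfold weighted.
  rewrite (E z Hz), EG by (apply Cmod_e2pi_lt_1; exact Hz).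
  rewrite Cmod_mult, Cmod_pow, Cmod_e2pi, exp_pow.
  replace (INR s * - (2 * PI * Im z))%R with (- (2 * PI * INR s * Im z))%R by ring. ring.
Qed.

Lemma analytic_with_zero c F : analytic_with c F ->
  (forall z, upper_half_plane z -> F (e2pi z) = 0) -> forall n, c n = 0.
Proof.
  intros Hc H0 n. assert (HF : forall w, (Cmod w < 1)%R -> F w = 0).
  { apply analytic_zero_of_accumulation; [now exists c|]. intros d Hd. exists (RtoC (d / 2)).
    rewrite Cmod_R, Rabs_pos_eq by lra. split; [lra|].
    destruct (e2pi_positive_real 1 (d / 2) ltac:(lia) ltac:(lra)) as (z & Hz & <-).
    replace (z / INR 1) with z by (simpl; field). now apply H0. }
  assert (H := cauchy_estimate c F (/ 2) 0 n Hc ltac:(lra)).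
  assert (Hle : (Cmod (c n) * (/ 2) ^ n <= 0)%R).
  { apply H. intros x. rewrite HF; [rewrite Cmod_0; lra|]. rewrite Cmod_mult, Cmod_cis, Cmod_R, Rabs_pos_eq; lra. }
  assert (0 < (/ 2) ^ n)%R by (apply pow_lt; lra). pose proof (Cmod_ge_0 (c n)).
  apply Cmod_eq_0. nra.
Qed.

Fixpoint rprod (n : nat) (h : nat -> R) : R :=
  match n with O => 1%R | S m => (rprod m h * h m)%R end.

Lemma rprod_ext n h h' : (forall j, (j < n)%nat -> h j = h' j) -> rprod n h = rprod n h'.
Proof.
  induction n as [|n IH]; intros H; simpl; [reflexivity|].
  rewrite IH by (intros; apply H; lia). now rewrite H by lia.
Qed.

Lemma rprod_rotate n h e : (forall j, h (j + n)%nat = h j) -> rprod n (fun j => h (j + e)%nat) = rprod n h.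
Proof.
  intros H.
  destruct (Nat.eq_dec n 0) as [->|Hn]; [reflexivity|].
  assert (Hsplit : forall h e, rprod (S e) h = (h O * rprod e (fun j => h (S j)))%R).
  { clear. intros h e. induction e as [|e IH]; [simpl; ring|]. 
    change (rprod (S (S e)) h) with (rprod (S e) h * h (S e))%R. rewrite IH. simpl. ring. }
  induction e as [|e IH]; [apply rprod_ext; intros; f_equal; lia|].
  rewrite <- IH. destruct n as [|n]; [lia|]. rewrite (Hsplit (fun j => h (j + e)%nat)). simpl.
  rewrite Rmult_comm. f_equal.
  - rewrite <- (H e). f_equal. lia.
  - apply rprod_ext. intros. f_equal. lia.
Qed.

Lemma rprod_q_form s w n (psi : nat -> C -> R) : (forall j, q_form s w (psi j)) ->
  q_form (INR n * s) (INR n * w) (fun z => rprod n (fun j => psi j z)).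
Proof.
  intros H. induction n as [|n IH]; [simpl; rewrite !Rmult_0_l; exact q_form_1|].
  replace (INR (S n) * s)%R with (INR n * s + s)%R by (rewrite S_INR; ring).
  replace (INR (S n) * w)%R with (INR n * w + w)%R by (rewrite S_INR; ring).
  apply (q_form_mult _ _ (fun z => rprod n (fun j => psi j z))); [exact IH|apply H].
Qed.

Lemma rprod_zero s w n (psi : nat -> C -> R) : (forall j, q_form s w (psi j)) ->
  (forall z, upper_half_plane z -> rprod n (fun j => psi j z) = 0%R) ->
  exists j, forall z, upper_half_plane z -> psi j z = 0%R.
Proof.
  intros H. induction n as [|n IH]; intros H0.
  - exfalso. specialize (H0 Ci ltac:(unfold upper_half_plane; simpl; lra)). simpl in H0. lra.
  - destruct (q_form_zero_product _ _ _ _ _ _ (rprod_q_form s w n psi H) (H n) H0) as [E|E];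
      [now apply IH|now exists n].
Qed.

Lemma neg_det (g : SL2Z) : (- ma g * - md g - - mb g * - mc g = 1)%Z.
Proof. pose proof (SL2Z_det g). lia. Qed.
Definition opp_mat (g : SL2Z) : SL2Z := mkSL2Z _ _ _ _ (neg_det g).

Lemma moebius_neg g z : upper_half_plane z -> moebius (opp_mat g) z = moebius g z.
Proof.
  intros Hz. pose proof (denom_neq_0 g z Hz) as H. unfold moebius, denom in *. cbn [opp_mat ma mb mc md].
  rewrite !ZtoC_opp. field. split; [exact H|]. intros E. apply H.
  replace (ZtoC (mc g) * z + ZtoC (md g)) with (- (- ZtoC (mc g) * z + - ZtoC (md g))) by ring.
  rewrite E. ring.
Qed.

Lemma not_multiple x t Q : (0 < x < Q \/ - Q < x < 0)%Z -> x <> (t * Q)%Z.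
Proof.
  intros H E. assert (t <= -1 \/ t = 0 \/ 1 <= t)%Z as [Ht|[Ht|Ht]] by lia; nia.
Qed.

Lemma neg_1_independent Q : (4 <= Q)%Z -> independent Q (translation 0 :: opp_mat (translation 0) :: nil).
Proof.
  intros HQ. constructor; [|constructor; constructor]. constructor; [|constructor].
  intros (_ & _ & [t Ht]). cbn -[Z.mul] in Ht. apply (not_multiple (-2) t Q); lia.
Qed.

(** The lower right entries are [1 + Q/M], [- (1 + Q/M)], [1] and [-1], distinct
    modulo [Q]. *)
Lemma four_independent Q M h : (4 <= Q)%Z -> (2 <= M)%Z -> (4 * M | Q)%Z -> md h = (1 + Q / M)%Z ->
  independent Q (h :: opp_mat h :: translation 0 :: opp_mat (translation 0) :: nil).
Proof.
  intros HQ HM [r Hr] Hh.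
  assert (HQM : (Q / M = r * 4)%Z) by (rewrite Hr; replace (r * (4 * M))%Z with (r * 4 * M)%Z by ring; apply Z.div_mul; lia).
  assert (Hr0 : (0 < r)%Z) by nia.
  pose proof (SL2Z_det h) as D.
  assert (N1 : forall t, (r * 4 <> t * Q)%Z) by (intros t; apply not_multiple; nia).
  assert (N2 : forall t, (- (1 + r * 4) - 1 <> t * Q)%Z) by (intros t; apply not_multiple; nia).
  assert (N3 : forall t, (-2 <> t * Q)%Z) by (intros t; apply not_multiple; lia).
  rewrite HQM in Hh.
  constructor; [|constructor; [|now apply neg_1_independent]].
  - repeat constructor; intros (_ & _ & [t Ht]); cbn -[Z.mul Z.add] in Ht; revert Ht; rewrite ?Hh in *.
    + intros Ht. apply (N3 t). lia.
    + intros Ht. apply (N1 t). lia.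
    + intros Ht. apply (N2 t). lia.
  - repeat constructor; intros (_ & _ & [t Ht]); cbn -[Z.mul Z.add] in Ht; revert Ht; rewrite ?Hh in *.
    + intros Ht. apply (N2 t). lia.
    + intros Ht. apply (N1 t). lia.
Qed.

(** * Projections onto residue classes *)

Section Criterion.
Variables (k : nat) (N : Z) (chi : Z -> C) (f : C -> C) (coef : nat -> C) (a M Q : Z).
Hypothesis k_odd : Nat.Odd k.
Hypothesis HN : (0 < N)%Z.
Hypothesis H4N : (4 | N)%Z.
Hypothesis Hchi : is_Dirichlet_character N chi.
Hypothesis Hf : cusp_form k N chi f.
Hypothesis Hq : has_q_expansion f coef.
Hypothesis HA : admissible_level M Q.
Hypothesis HNQ : (N | Q)%Z.

Let m := Z.to_nat M.
Let zt := zeta chi M Q.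

Definition coef0 (n : nat) : C := match n with O => 0 | S _ => coef n end.

Definition select (P : nat -> Prop) (n : nat) : C :=
  if excluded_middle_informative (P n) then coef0 n else 0.

Definition part (P : nat -> Prop) (w : C) : C := CSeries (fun n => select P n * w ^ n).

Lemma level_facts : (1 <= M)%Z /\ (0 < INR m)%R /\ IZR M = INR m /\ (4 <= Q)%Z /\ Z.of_nat m = M.
Proof.
  destruct HA as (HM & HQ & _ & [r Hr]). unfold m.
  assert (E : Z.of_nat (Z.to_nat M) = M) by (apply Z2Nat.id; lia).
  repeat split; try assumption.
  - apply lt_0_INR. lia.
  - rewrite INR_IZR_INZ, E. reflexivity.
  - nia.
Qed.

Lemma coef0_series z : upper_half_plane z -> is_Cseries (fun n => coef0 n * e2pi z ^ n) (f z).
Proof.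
  intros Hz. apply (is_Cseries_tail 1).
  replace (f z - csum 1 (fun n => coef0 n * e2pi z ^ n)) with (f z) by (simpl; ring).
  exact (Hq z Hz).
Qed.

Lemma part_analytic P : analytic_with (select P) (part P).
Proof.
  apply analytic_of_bounded. intros r Hr.
  destruct (e2pi_positive_real 1 r ltac:(lia) Hr) as (z & Hz & Ez).
  replace (z / INR 1) with z in Ez by (simpl; field).
  destruct (is_Cseries_bounded _ _ (coef0_series z Hz)) as [B HB]. exists B. intros n.
  specialize (HB n). rewrite Ez, Cmod_mult, Cmod_pow, Cmod_R, Rabs_pos_eq in HB by lra.
  eapply Rle_trans; [|exact HB]. apply Rmult_le_compat_r; [apply pow_le; lra|].
  unfold select. destruct (excluded_middle_informative (P n)); [lra|]. rewrite Cmod_0. apply Cmod_ge_0.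
Qed.

(** For [x ^ M = 1] this is the part of [f] supported on the residue class of
    the [n] with [x * phase (n / M) = 1]. *)
Definition proj (x : C) (z : C) : C :=
  / INR m * csum m (fun u => x ^ u * f (z + frac (Z.of_nat u) M)).

Definition in_class (x : C) (n : nat) : Prop := x * phase (INR n / IZR M) = 1.

(** Orthogonality of the characters of Z/M. *)
Lemma proj_part x z : x ^ m = 1 -> upper_half_plane z -> proj x z = part (in_class x) (e2pi z).
Proof.
  intros Hx Hz. destruct level_facts as (HM & Hm & HMm & _ & _).
  assert (HmC : RtoC (INR m) <> 0) by (apply RtoC_neq_0; lra).
  apply (is_Cseries_unique (fun n => select (in_class x) n * e2pi z ^ n)).
  2:{ apply part_analytic. now apply Cmod_e2pi_lt_1. }
  assert (HS : is_Cseries (fun n => / INR m * csum m (fun u => x ^ u * (coef0 n * e2pi (z + frac (Z.of_nat u) M) ^ n)))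
     (proj x z)).
  { apply is_Cseries_scal. apply (is_Cseries_csum m (fun u n => x ^ u * (coef0 n * e2pi (z + frac (Z.of_nat u) M) ^ n))).
    intros u _. apply is_Cseries_scal, coef0_series. now apply frac_H. }
  eapply is_Cseries_ext; [|exact HS]. intros n. cbv beta.
  rewrite (csum_ext m _ (fun u => (coef0 n * e2pi z ^ n) * (x * phase (INR n / IZR M)) ^ u)).
  - rewrite csum_scal. unfold select. destruct (excluded_middle_informative (in_class x n)) as [H|H].
    + unfold in_class in H. rewrite (csum_ext m _ (fun _ => 1)) by (intros; rewrite H; apply Cpow_1_l).
      rewrite csum_const. field. exact HmC.
    + rewrite csum_root_of_unity; [ring| |exact H].
      rewrite Cpow_mult_l, Hx, Cmult_1_l. unfold phase. rewrite e2pi_pow, <- RtoC_mult.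
      replace (INR m * (INR n / IZR M))%R with (IZR (Z.of_nat n)); [apply phase_Z|].
      rewrite <- INR_IZR_INZ, HMm. field. lra.
  - intros u _. rewrite Cpow_mult_l, e2pi_add, Cpow_mult_l.
    replace (e2pi (frac (Z.of_nat u) M) ^ n) with (phase (INR n / IZR M) ^ u); [ring|].
    unfold phase, frac. rewrite !e2pi_pow. f_equal. rewrite <- !RtoC_mult. f_equal.
    rewrite <- INR_IZR_INZ, HMm. field. lra.
Qed.

Lemma complement_part x z : x ^ m = 1 -> upper_half_plane z ->
  f z + - (1) * proj x z = part (fun n => ~ in_class x n) (e2pi z).
Proof.
  intros Hx Hz. pose proof (Cmod_e2pi_lt_1 z Hz) as He.
  apply (is_Cseries_unique (fun n => select (fun n => ~ in_class x n) n * e2pi z ^ n)).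
  2:{ apply part_analytic. apply He. }
  rewrite (proj_part x z Hx Hz).
  eapply is_Cseries_ext; [|apply (is_Cseries_plus _ _ _ _ (coef0_series z Hz)
    (is_Cseries_scal (- (1)) _ _ (part_analytic (in_class x) _ (proj2 He))))].
  intros n. cbv beta. unfold select.
  destruct (excluded_middle_informative (in_class x n)), (excluded_middle_informative (~ in_class x n)); try tauto; ring.
Qed.

Lemma zeta_pow : zt ^ m = 1.
Proof. apply (zeta_pow_M N chi M Q Hchi HA HNQ). Qed.

Lemma frac_0 : frac 0 M = 0.
Proof. unfold frac. f_equal. unfold Rdiv. simpl. ring. Qed.

Lemma proj_law g e z : Gamma1 Q g -> (M | mc g / Q - Z.of_nat e)%Z -> upper_half_plane z ->
  exists J, (Cmod J ^ 2 = Cmod (denom g z) ^ k)%R /\ f (moebius g z) = J * f z /\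
    forall x, proj x (moebius g z) = J * proj (x * zt ^ e) z.
Proof.
  intros Hg [j Hj] Hz.
  destruct (translate_law k N chi f M Q k_odd Hchi Hf HA HNQ g z Hg Hz) as (J & HJ & Hlaw).
  assert (Htw : forall u : nat, twist chi M Q (mc g / Q * Z.of_nat u) = (zt ^ e) ^ u).
  { intros u. rewrite <- Cpow_mult_r. apply (twist_zeta N chi M Q Hchi HA HNQ).
    exists (j * Z.of_nat u)%Z. rewrite Nat2Z.inj_mul.
    replace (mc g / Q * Z.of_nat u - Z.of_nat e * Z.of_nat u)%Z with ((mc g / Q - Z.of_nat e) * Z.of_nat u)%Z by ring.
    rewrite Hj. ring. }
  exists J. split; [exact HJ|]. split.
  - pose proof (Hlaw 0%Z) as H. rewrite frac_0, !Cplus_0_r in H. rewrite H.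
    pose proof (Htw 0%nat) as H0. simpl Z.of_nat in H0. rewrite H0. simpl. ring.
  - intros x. unfold proj.
    rewrite (csum_ext m _ (fun u => J * ((x * zt ^ e) ^ u * f (z + frac (Z.of_nat u) M)))).
    + rewrite csum_scal. ring.
    + intros u _. rewrite Hlaw, Htw, (Cpow_mult_l x). ring.
Qed.

Lemma proj_law_ex g : Gamma1 Q g -> exists e, forall z, upper_half_plane z ->
  exists J, (Cmod J ^ 2 = Cmod (denom g z) ^ k)%R /\ f (moebius g z) = J * f z /\
    forall x, proj x (moebius g z) = J * proj (x * zt ^ e) z.
Proof.
  intros Hg. destruct level_facts as (HM & _). exists (Z.to_nat ((mc g / Q) mod M)).
  intros z Hz. apply proj_law; [exact Hg| |exact Hz].
  rewrite Z2Nat.id by (apply Z.mod_pos_bound; lia).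
  exists (mc g / Q / M)%Z. pose proof (Z.div_mod (mc g / Q) M ltac:(lia)). lia.
Qed.

Lemma proj_cusp x g : q_expansion (fun z => proj x (moebius g z) / denom_root g z ^ k).
Proof.
  destruct level_facts as (HM & _).
  apply (q_expansion_ext (fun z => / INR m * csum m (fun u => x ^ u * (f (moebius g z + frac (Z.of_nat u) M) / denom_root g z ^ k)))).
  - intros z Hz. unfold proj.
    rewrite (csum_ext m _ (fun u => / denom_root g z ^ k * (x ^ u * f (moebius g z + frac (Z.of_nat u) M)))).
    + rewrite csum_scal. unfold Cdiv. ring.
    + intros u _. unfold Cdiv. ring.
  - apply q_expansion_scal. apply (q_expansion_csum m (fun u z => x ^ u * (f (moebius g z + frac (Z.of_nat u) M) / denom_root g z ^ k))).
    intros u. apply q_expansion_scal. now apply (translate_at_cusp k N chi f k_odd HN H4N Hchi Hf M HM).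
Qed.

Lemma form_cusp g : q_expansion (fun z => f (moebius g z) / denom_root g z ^ k).
Proof.
  destruct level_facts as (HM & _).
  apply (q_expansion_ext (fun z => f (moebius g z + frac 0 M) / denom_root g z ^ k)).
  - intros z _. now rewrite frac_0, Cplus_0_r.
  - now apply (translate_at_cusp k N chi f k_odd HN H4N Hchi Hf M HM).
Qed.

Lemma proj_translate x z : x ^ m = 1 -> upper_half_plane z ->
  weighted k (proj x) (z + frac 1 M) = weighted k (proj x) z.
Proof.
  intros Hx Hz. destruct level_facts as (HM & Hm & HMm & _ & _).
  assert (E : x * proj x (z + frac 1 M) = proj x z).
  { rewrite !proj_part by (try exact Hx; try apply frac_H; exact Hz).
    pose proof (part_analytic (in_class x)) as HP.
    pose proof (HP _ (proj2 (Cmod_e2pi_lt_1 z Hz))) as H1.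
    pose proof (HP _ (proj2 (Cmod_e2pi_lt_1 _ (frac_H z 1 M Hz)))) as H2.
    apply (is_Cseries_scal x) in H2. apply (is_Cseries_unique _ _ _ H2).
    eapply is_Cseries_ext; [|exact H1]. intros n. cbv beta. rewrite e2pi_add, Cpow_mult_l.
    unfold select. destruct (excluded_middle_informative (in_class x n)) as [H|H]; [|ring].
    replace (e2pi (frac 1 M) ^ n) with (phase (INR n / IZR M)).
    - transitivity (coef0 n * e2pi z ^ n * (x * phase (INR n / IZR M))); [rewrite H|]; ring.
    - unfold phase, frac. rewrite e2pi_pow, <- RtoC_mult. do 2 f_equal. unfold Rdiv. ring. }
  assert (Hx1 : Cmod x = 1%R).
  { apply (f_equal Cmod) in Hx. rewrite Cmod_pow, Cmod_1 in Hx. pose proof (Cmod_ge_0 x) as H0.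
    assert (Hm1 : (m <> 0)%nat) by (intros E0; rewrite E0 in Hm; simpl in Hm; lra).
    destruct (Rtotal_order (Cmod x) 1) as [H|[H|H]]; [exfalso|exact H|exfalso].
    - assert (Cmod x ^ m < 1)%R; [|lra]. destruct m; [lia|]. simpl.
      assert (Cmod x ^ n <= 1)%R by (rewrite <- (pow1 n); apply pow_incr; lra).
      assert (0 <= Cmod x ^ n)%R by (apply pow_le; lra). nra.
    - pose proof (Rlt_pow_R1 (Cmod x) m H ltac:(lia)). lra. }
  unfold weighted. rewrite <- E, Cmod_mult, Hx1.
  replace (Im (z + frac 1 M)) with (Im z) by (destruct z; simpl; ring). ring.
Qed.

Let x0 := phase (- IZR a / IZR M).

Lemma x0_pow : x0 ^ m = 1.
Proof.
  destruct level_facts as (HM & Hm & HMm & _ & _). unfold x0, phase. rewrite e2pi_pow, <- RtoC_mult.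
  replace (INR m * (- IZR a / IZR M))%R with (IZR (- a)); [apply phase_Z|].
  rewrite opp_IZR, HMm. field. lra.
Qed.

Lemma in_class_x0 n : in_class x0 n <-> Zcongr (Z.of_nat n) a M.
Proof.
  destruct level_facts as (HM & Hm & HMm & _ & _).
  unfold in_class, x0, Zcongr. rewrite <- phase_add. split.
  - intros H. apply phase_1_integer in H. destruct H as [p Hp]. exists p.
    apply eq_IZR. rewrite minus_IZR, mult_IZR, <- INR_IZR_INZ, <- Hp. field. lra.
  - intros [p Hp]. replace (- IZR a / IZR M + INR n / IZR M)%R with (IZR p); [apply phase_Z|].
    apply (f_equal IZR) in Hp. rewrite minus_IZR, mult_IZR, <- INR_IZR_INZ in Hp.
    replace (INR n) with (IZR p * IZR M + IZR a)%R by lra. field. lra.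
Qed.

Lemma in_class_unique x y n : in_class x n -> in_class y n -> x = y.
Proof.
  unfold in_class. intros Hx Hy. set (p := phase (INR n / IZR M)) in *.
  transitivity (x * (y * p)); [rewrite Hy; ring|]. transitivity (y * (x * p)); [ring|rewrite Hx; ring].
Qed.

Variable s : nat.
Hypothesis Hs : (vanishing_bound k (Gamma1 Q) + 1 < INR s)%R.
Hypothesis Hvan : forall n, (1 <= n < s)%nat -> ~ Zcongr (Z.of_nat n) a M -> coef n = 0.

Lemma select_vanishes (P : nat -> Prop) : (forall n, P n -> ~ in_class x0 n) ->
  forall n, (n < s)%nat -> select P n = 0.
Proof.
  intros HP n Hn. unfold select. destruct (excluded_middle_informative (P n)) as [H|H]; [|reflexivity].
  destruct n as [|n]; [reflexivity|]. simpl. apply Hvan; [lia|]. rewrite <- in_class_x0. now apply HP.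
Qed.

Let rest (z : C) : C := f z + - (1) * proj x0 z.

Lemma rest_q_form : q_form (INR s) (INR k / 4) (weighted k rest).
Proof.
  apply (weighted_q_form_infinity k (select (fun n => ~ in_class x0 n)) (part (fun n => ~ in_class x0 n))).
  - apply part_analytic.
  - apply select_vanishes. auto.
  - intros z Hz. apply complement_part; [exact x0_pow|exact Hz].
Qed.

Lemma rest_cusp g : q_form 0 (INR k / 4) (fun z => weighted k rest (moebius g z)).
Proof.
  apply weighted_q_form_cusp. unfold rest.
  apply (q_expansion_ext (fun z => f (moebius g z) / denom_root g z ^ k + - (1) * (proj x0 (moebius g z) / denom_root g z ^ k))).
  - intros z _. unfold Cdiv. ring.
  - apply q_expansion_plus; [apply form_cusp|]. apply q_expansion_scal, proj_cusp.
Qed.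

Lemma PI_gt_3 : (3 < PI)%R.
Proof. pose proof PI2_3_2. lra. Qed.

(** The special cosets are those of [1] and [-1]; the bound needs
    [k / 4 < 6/5 * PI * 2 * k / 24]. *)
Lemma rest_vanishes_of_law :
  (forall g z, Gamma1 Q g -> upper_half_plane z -> exists J,
     (Cmod J ^ 2 = Cmod (denom g z) ^ k)%R /\ rest (moebius g z) = J * rest z) ->
  forall z, upper_half_plane z -> weighted k rest z = 0%R.
Proof.
  intros Hlaw. destruct level_facts as (_ & _ & _ & HQ & _).
  apply (sturm_bound Q (weighted k rest) (INR s) (INR k / 4) (translation 0 :: opp_mat (translation 0) :: nil)).
  - lia.
  - pose proof (pos_INR k). lra.
  - intros g z Hg Hz. destruct (Hlaw g z Hg Hz) as (J & HJ & E). now apply (weighted_law k g rest rest z J).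
  - apply rest_cusp.
  - apply rest_q_form.
  - now apply neg_1_independent.
  - intros g z [<-|[<-|[]]] Hz; [|rewrite moebius_neg by exact Hz];
      (replace (moebius (translation 0) z) with z; [reflexivity|rewrite moebius_translation; unfold ZtoC; ring]).
  - unfold vanishing_bound in Hs. set (I := INR (SL2Z_index (Gamma1 Q))) in *.
    assert (HI : (0 <= I)%R) by apply pos_INR. pose proof (pos_INR k) as Hk.
    assert (0 <= INR k * I)%R by now apply Rmult_le_pos. pose proof PI_gt_3. simpl length. simpl INR. nra.
Qed.

(** When [zeta <> 1], two neighbours [x, x * zeta] are never both [x0], so one
    of the two factors vanishes to order [s] at infinity. *)
Let pair (j : nat) (z : C) : R :=
  (weighted k (proj (x0 * zt ^ j)) z * weighted k (proj (x0 * zt ^ S j)) z)%R.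

Lemma class_pow j : (x0 * zt ^ j) ^ m = 1.
Proof. rewrite Cpow_mult_l, x0_pow, <- Cpow_mult_r, Nat.mul_comm, Cpow_mult_r, zeta_pow, Cpow_1_l. ring. Qed.

Lemma proj_q_form_0 x : x ^ m = 1 -> q_form 0 (INR k / 4) (weighted k (proj x)).
Proof.
  intros Hx. change 0%R with (INR 0).
  apply (weighted_q_form_infinity k (select (in_class x)) (part (in_class x))).
  - apply part_analytic.
  - intros; lia.
  - intros z Hz. now apply proj_part.
Qed.

Lemma proj_q_form_s x : x ^ m = 1 -> x <> x0 -> q_form (INR s) (INR k / 4) (weighted k (proj x)).
Proof.
  intros Hx Hne. apply (weighted_q_form_infinity k (select (in_class x)) (part (in_class x))).
  - apply part_analytic.
  - apply select_vanishes. intros n Hn Hn0. apply Hne. now apply (in_class_unique x x0 n).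
  - intros z Hz. now apply proj_part.
Qed.

Lemma pair_q_form j : zt <> 1 -> q_form (INR s) (INR k / 2) (pair j).
Proof.
  intros Hz1. unfold pair. replace (INR k / 2)%R with (INR k / 4 + INR k / 4)%R by field.
  destruct (classic (x0 * zt ^ j = x0)) as [E|E].
  - replace (INR s) with (0 + INR s)%R by ring. apply q_form_mult.
    + apply proj_q_form_0, class_pow.
    + apply proj_q_form_s; [apply class_pow|]. intros E'. apply Hz1.
      assert (Hx : x0 <> 0) by (apply Cmod_gt_0; unfold x0; rewrite Cmod_phase; lra).
      transitivity (x0 * zt ^ S j / (x0 * zt ^ j)).
      * assert (zt ^ j <> 0) by (intros E2; rewrite E2, Cmult_0_r in E; now apply Hx).
        rewrite Cpow_S. field. split; assumption.
      * rewrite E, E'. field. exact Hx.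
  - replace (INR s) with (INR s + 0)%R by ring. apply q_form_mult.
    + apply proj_q_form_s; [apply class_pow|exact E].
    + apply proj_q_form_0, class_pow.
Qed.

Let orbit_product (z : C) : R := rprod m (fun j => pair j z).

Lemma orbit_product_Gamma1 g z : Gamma1 Q g -> upper_half_plane z ->
  orbit_product (moebius g z) = orbit_product z.
Proof.
  intros Hg Hz. destruct level_facts as (HM & Hm & HMm & _ & HmZ).
  destruct (proj_law_ex g Hg) as [e He]. destruct (He z Hz) as (J & HJ & _ & Hproj).
  assert (Hw : forall j, weighted k (proj (x0 * zt ^ j)) (moebius g z) = weighted k (proj (x0 * zt ^ (j + e))) z).
  { intros j. apply (weighted_law k g (proj (x0 * zt ^ j)) (proj (x0 * zt ^ (j + e))) z J Hz); [|exact HJ].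
    rewrite Hproj, Cpow_add_r, Cmult_assoc. reflexivity. }
  unfold orbit_product. rewrite <- (rprod_rotate m (fun j => pair j z) e).
  - apply rprod_ext. intros j _. unfold pair. rewrite !Hw. reflexivity.
  - intros j. unfold pair. rewrite <- Nat.add_succ_l, !Cpow_add_r, zeta_pow, !Cmult_1_r. reflexivity.
Qed.

Lemma orbit_product_translate z : upper_half_plane z -> orbit_product (z + frac 1 M) = orbit_product z.
Proof.
  intros Hz. apply rprod_ext. intros j _. unfold pair. now rewrite !proj_translate by (try apply class_pow; exact Hz).
Qed.

Lemma lower_Gamma1 : Gamma1 Q (lower_unipotent Q) /\ mc (lower_unipotent Q) = Q.
Proof.
  split; [|reflexivity]. split; [exists 1%Z; cbn -[Z.mul]; ring|split; exists 0%Z; reflexivity].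
Qed.

(** The conjugate of [(1 0; Q 1)] by the translation by [1 / M] is not in
    Gamma_1(Q), but the moduli of the projections do not see translations by
    [1 / M]. *)
Lemma extra_coset : exists h, md h = (1 + Q / M)%Z /\
  forall z, upper_half_plane z -> orbit_product (moebius h z) = orbit_product z.
Proof.
  destruct level_facts as (HM & Hm & HMm & HQ & HmZ). destruct lower_Gamma1 as [(G1 & G2 & G3) G4].
  destruct (conjugate_by_translation M Q (lower_unipotent Q) (-1) HA G1 G2 G3) as (h & Ec & Ed & Hh).
  exists h. split.
  - rewrite Ed, G4, Z.div_same by lia. cbn [md lower_unipotent]. ring.
  - intros z Hz.
    assert (Hzz : z = z + frac 1 M + frac (-1) M) by (unfold frac; rewrite <- Cplus_assoc, <- RtoC_plus; replace (IZR 1 / IZR M + IZR (-1) / IZR M)%R with 0%R by (unfold Rdiv; ring); ring).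
    assert (Hz1 : upper_half_plane (z + frac 1 M)) by now apply frac_H.
    rewrite Hzz at 1. destruct (Hh _ Hz1) as [-> _].
    set (w := moebius (lower_unipotent Q) (z + frac 1 M)).
    assert (HwH : upper_half_plane w) by now apply moebius_H.
    assert (Hw : w = w + frac (-1) M + frac 1 M) by (unfold frac; rewrite <- Cplus_assoc, <- RtoC_plus; replace (IZR (-1) / IZR M + IZR 1 / IZR M)%R with 0%R by (unfold Rdiv; ring); ring).
    rewrite <- orbit_product_translate by now apply frac_H. rewrite <- Hw. unfold w.
    rewrite orbit_product_Gamma1 by (try exact Hz1; now repeat split).
    now apply orbit_product_translate.
Qed.

(** With [4] special cosets, order [M * s] and weight exponent [M * k / 2], the
    bound needs [k / 2 < 6/5 * PI * 4 * k / 24]. *)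
Lemma orbit_product_vanishes : zt <> 1 -> forall z, upper_half_plane z -> orbit_product z = 0%R.
Proof.
  intros Hz1. destruct level_facts as (HM & Hm & HMm & HQ & HmZ).
  assert (HM2 : (2 <= M)%Z).
  { assert (M <> 1)%Z; [|lia]. intros E. apply Hz1. pose proof zeta_pow as H. unfold m in H. rewrite E in H.
    simpl in H. rewrite Cmult_1_r in H. exact H. }
  destruct extra_coset as (h & Hmd & Hh). destruct HA as (_ & _ & _ & H4M).
  assert (Hid : forall z, moebius (translation 0) z = z) by (intros z; rewrite moebius_translation; unfold ZtoC; ring).
  apply (sturm_bound Q orbit_product (INR m * INR s) (INR m * (INR k / 2))
    (h :: opp_mat h :: translation 0 :: opp_mat (translation 0) :: nil)).
  - lia.
  - pose proof (pos_INR k). apply Rmult_le_pos; lra.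
  - apply orbit_product_Gamma1.
  - intros g. replace 0%R with (INR m * 0)%R by ring.
    apply (rprod_q_form 0 (INR k / 2) m (fun j z => pair j (moebius g z))). intros j. unfold pair.
    replace (INR k / 2)%R with (INR k / 4 + INR k / 4)%R by field. replace 0%R with (0 + 0)%R by ring.
    apply (q_form_mult 0 (INR k / 4) (fun z => weighted k (proj (x0 * zt ^ j)) (moebius g z)) 0 (INR k / 4)
      (fun z => weighted k (proj (x0 * zt ^ S j)) (moebius g z))); apply weighted_q_form_cusp, proj_cusp.
  - apply (rprod_q_form (INR s) (INR k / 2) m pair). intros j. now apply pair_q_form.
  - now apply (four_independent Q M).
  - intros g z [<-|[<-|[<-|[<-|[]]]]] Hz; rewrite ?moebius_neg, ?Hid by exact Hz; try reflexivity; now apply Hh.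
  - unfold vanishing_bound in Hs. set (I := INR (SL2Z_index (Gamma1 Q))) in *.
    assert (HI : (0 <= I)%R) by apply pos_INR. pose proof (pos_INR k) as Hk.
    assert (0 <= INR k * I)%R by now apply Rmult_le_pos. pose proof PI_gt_3.
    replace (I * (INR m * (INR k / 2)))%R with (INR m * (INR k * I / 2))%R by field.
    simpl length. replace (INR 4) with 4%R by (simpl; ring).
    replace (6 / 5 * PI * (4 * (INR m * INR s)))%R with (INR m * (24 / 5 * PI * INR s))%R by field.
    apply Rmult_lt_compat_l; [exact Hm|]. nra.
Qed.

(** Some projection in the orbit vanishes; [(1 0; Q 1)], whose [c'] is 1, moves
    it step by step along the orbit, which is cyclic and contains [x0]. *)
Lemma proj_x0_vanishes : zt <> 1 -> forall z, upper_half_plane z -> proj x0 z = 0.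
Proof.
  intros Hz1. destruct level_facts as (HM & Hm & HMm & HQ & HmZ).
  destruct (rprod_zero _ _ m pair (fun j => pair_q_form j Hz1) (orbit_product_vanishes Hz1)) as [j Hj].
  assert (Hproj : exists i, forall z, upper_half_plane z -> proj (x0 * zt ^ i) z = 0).
  { destruct (q_form_zero_product _ _ _ _ _ _ (proj_q_form_0 _ (class_pow j)) (proj_q_form_0 _ (class_pow (S j))) Hj) as [H|H];
      [exists j|exists (S j)]; intros z Hz; specialize (H z Hz); unfold weighted in H;
      apply Rmult_integral in H; destruct H as [H|H]; try (now apply Cmod_eq_0);
      exfalso; pose proof (exp_pos (INR k / 4 * ln (Im z))); unfold Rpower in H; lra. }
  destruct Hproj as [i Hi]. destruct lower_Gamma1 as [G1 G4].
  assert (Hup : forall t z, upper_half_plane z -> proj (x0 * zt ^ (i + t)) z = 0).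
  { induction t as [|t IH]; intros z Hz; [rewrite Nat.add_0_r; now apply Hi|].
    assert (H1 : (M | mc (lower_unipotent Q) / Q - Z.of_nat 1)%Z).
    { rewrite G4, Z.div_same by lia. exists 0%Z. reflexivity. }
    destruct (proj_law (lower_unipotent Q) 1 z G1 H1 Hz) as (J & HJ & _ & HP).
    specialize (HP (x0 * zt ^ (i + t))). rewrite IH in HP by now apply moebius_H.
    replace (x0 * zt ^ (i + S t)) with (x0 * zt ^ (i + t) * zt ^ 1) by (rewrite Nat.add_succ_r, Cpow_1_r, (Cpow_S zt (i + t)); ring).
    assert (HJ0 : J <> 0).
    { intros E. rewrite E, Cmod_0 in HJ. simpl in HJ. rewrite Rmult_0_l in HJ.
      assert (0 < Cmod (denom (lower_unipotent Q) z) ^ k)%R by (now apply pow_lt, Cmod_gt_0, denom_neq_0). lra. }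
    apply NNPP. intros Hne. symmetry in HP. revert HP. now apply Cmult_neq_0. }
  intros z Hz. specialize (Hup (m * S i - i)%nat z Hz).
  assert (Hm1 : (m <> 0)%nat) by (intros E0; rewrite E0 in Hm; simpl in Hm; lra).
  replace (i + (m * S i - i))%nat with (m * S i)%nat in Hup by nia.
  rewrite Cpow_mult_r, zeta_pow, Cpow_1_l, Cmult_1_r in Hup. exact Hup.
Qed.

(** If [zeta = 1], both [f] and its projection have the multiplier [J];
    otherwise the projection is zero and [rest] is [f]. *)
Lemma rest_vanishes z : upper_half_plane z -> rest z = 0.
Proof.
  intros Hz. destruct level_facts as (HM & Hm & HMm & HQ & HmZ).
  assert (H : weighted k rest z = 0%R).
  { revert z Hz. apply rest_vanishes_of_law. intros g z Hg Hz.
    destruct (proj_law_ex g Hg) as [e He]. destruct (He z Hz) as (J & HJ & HfJ & HP). exists J. split; [exact HJ|].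
    unfold rest. rewrite HfJ.
    destruct (classic (zt = 1)) as [E|E].
    - rewrite HP, E, Cpow_1_l, Cmult_1_r. ring.
    - rewrite !(proj_x0_vanishes E) by (try exact Hz; now apply moebius_H). ring. }
  unfold weighted in H. apply Rmult_integral in H. destruct H as [H|H]; [now apply Cmod_eq_0|].
  exfalso. unfold Rpower in H. pose proof (exp_pos (INR k / 4 * ln (Im z))). lra.
Qed.

Lemma coef_vanishes n : (1 <= n)%nat -> ~ Zcongr (Z.of_nat n) a M -> coef n = 0.
Proof.
  intros Hn Ha. pose proof (analytic_with_zero _ _ (part_analytic (fun n => ~ in_class x0 n))) as H.
  assert (H0 := H (fun z Hz => eq_trans (eq_sym (complement_part x0 z x0_pow Hz)) (rest_vanishes z Hz)) n).
  unfold select in H0. destruct (excluded_middle_informative (~ in_class x0 n)) as [_|Hc].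
  - destruct n as [|n]; [lia|exact H0].
  - exfalso. apply Hc. now rewrite in_class_x0.
Qed.

End Criterion.

Lemma vanishing_criterion k N chi f coef a M Q :
  Nat.Odd k -> (0 < N)%Z -> (4 | N)%Z -> is_Dirichlet_character N chi -> cusp_form k N chi f ->
  has_q_expansion f coef -> admissible_level M Q -> (N | Q)%Z ->
  (forall n : nat, (1 <= n)%nat -> (INR n <= vanishing_bound k (Gamma1 Q) + 1)%R ->
     ~ Zcongr (Z.of_nat n) a M -> coef n = RtoC 0) ->
  forall n : nat, (1 <= n)%nat -> ~ Zcongr (Z.of_nat n) a M -> coef n = RtoC 0.
Proof.
  intros Hk HN H4 Hchi Hf Hq HA HNQ Hvan n Hn Ha.
  set (B := (vanishing_bound k (Gamma1 Q) + 1)%R) in *.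
  assert (HB : (0 <= B)%R).
  { unfold B, vanishing_bound. pose proof (pos_INR k). pose proof (pos_INR (SL2Z_index (Gamma1 Q))).
    assert (0 <= INR k / 24 * INR (SL2Z_index (Gamma1 Q)))%R by (apply Rmult_le_pos; lra). lra. }
  destruct (archimed B) as [H1 H2].
  assert (Hu : (0 <= up B)%Z) by (apply le_IZR; lra).
  assert (Hs : INR (Z.to_nat (up B)) = IZR (up B)) by (rewrite INR_IZR_INZ, Z2Nat.id by exact Hu; reflexivity).
  apply (coef_vanishes k N chi f coef a M Q Hk HN H4 Hchi Hf Hq HA HNQ (Z.to_nat (up B))); try assumption.
  - fold B. rewrite Hs. lra.
  - intros i Hi Hia. apply Hvan; [lia| |exact Hia].
    assert (INR (S i) <= INR (Z.to_nat (up B)))%R by (apply le_INR; lia). rewrite S_INR in H. lra.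
Qed.

Theorem theorem8 :
  forall (k : nat) (N : Z) (chi : Z -> C) (f : C -> C) (coef : nat -> C)
         (a M : Z),
    Nat.Odd k ->
    (0 < N)%Z ->
    (4 | N)%Z ->
    is_Dirichlet_character N chi ->
    cusp_form k N chi f ->
    has_q_expansion f coef ->
    (1 <= M)%Z ->
    Z.gcd a M = 1%Z ->
    let criterion := fun B : R =>
      (forall n : nat, (1 <= n)%nat -> (INR n <= B + 1)%R ->
         ~ Zcongr (Z.of_nat n) a M -> coef n = RtoC 0) ->
      (forall n : nat, (1 <= n)%nat ->
         ~ Zcongr (Z.of_nat n) a M -> coef n = RtoC 0) in
    criterion (vanishing_bound k (Gamma1 (N * M ^ 2))) /\
    ((M ^ 2 | N)%Z ->
       (((N / M) mod 4 = 0)%Z -> criterion (vanishing_bound k (Gamma1 N))) /\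
       (((N / M) mod 4 = 2)%Z -> criterion (vanishing_bound k (Gamma1 (2 * N))))).
Proof.
  intros k N chi f coef a M Hk HN H4 Hchi Hf Hq HM _ criterion.
  assert (Hcrit : forall Q, admissible_level M Q -> (N | Q)%Z -> criterion (vanishing_bound k (Gamma1 Q))).
  { intros Q HA HNQ. exact (vanishing_criterion k N chi f coef a M Q Hk HN H4 Hchi Hf Hq HA HNQ). }
  assert (E2 : (M ^ 2 = M * M)%Z) by ring. rewrite E2.
  split; [|intros [q Hq2]].
  - apply Hcrit; [|now apply Z.divide_factor_l].
    split; [exact HM|]. split; [nia|]. split; [now apply Z.divide_factor_r|].
    destruct H4 as [r Hr]. exists (r * M)%Z. rewrite Hr. ring.
  - assert (HNM : (N = M * (N / M))%Z).
    { apply Z.div_exact; [lia|]. rewrite Hq2. replace (q * (M * M))%Z with (q * M * M)%Z by ring. apply Z.mod_mul. lia. }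
    set (t := (N / M)%Z) in *. pose proof (Z.div_mod t 4 ltac:(lia)) as Et.
    split; intros Ht; rewrite Ht in Et; apply Hcrit.
    + split; [exact HM|]. split; [exact HN|]. split; [now exists q|]. exists (t / 4)%Z. rewrite HNM at 1. rewrite Et at 1. ring.
    + apply Z.divide_refl.
    + split; [exact HM|]. split; [lia|]. split; [exists (2 * q)%Z; rewrite Hq2; ring|].
      exists (2 * (t / 4) + 1)%Z. rewrite HNM at 1. rewrite Et at 1. ring.
    + apply Z.divide_factor_r.
Qed.
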